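(* Let $\mathbf{k}$ be a field with $\operatorname{char}(\mathbf{k})\neq 2$, let $g\geq 3$, and let $R$ be the homogeneous coordinate ring of the tangential variety $\mathcal{T}\subseteq\mathbf{P}^g$ of the rational normal curve of degree $g$. Then $R$ is Gorenstein with Castelnuovo--Mumford regularity $\operatorname{reg}(R)=3$.
   Context: The rational normal curve $\Gamma\subseteq\mathbf{P}^g$ is the image of $\mathbf{P}^1$ under $[a:b]\mapsto[a^g:a^{g-1}b:\cdots:b^g]$, and its tangential variety $\mathcal{T}$ is the surface swept out by the tangent lines to $\Gamma$, with reduced structure. With $S=\mathbf{k}[z_0,\ldots,z_g]$ the homogeneous coordinate ring of $\mathbf{P}^g$, $R=S/I$, where $I$ is the homogeneous ideal of $\mathcal{T}$; equivalently $I$ is the kernel of the ring map $S\to\mathbf{k}[t,u,v]$, $z_i\mapsto u\,t^i+i\,v\,t^{i-1}$. The regularity is $\operatorname{reg}(R)=\max\{j:\operatorname{Tor}_i^S(R,\mathbf{k})_{i+j}\neq 0\text{ for some }i\}$. *)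

(* Defs.v *)
From HB Require Import structures.
From mathcomp Require Import all_boot all_order all_algebra.
From mathcomp Require Import mpoly.

Set Implicit Arguments.
Unset Strict Implicit.
Unset Printing Implicit Defensive.

Import GRing.Theory.
Local Open Scope ring_scope.

(* ---- Gorenstein rings ---- *)

Definition noetherian (R : comNzRingType) : Prop :=
  forall I : {pred R},
    0 \in I -> (forall a x y, x \in I -> y \in I -> a * x + y \in I) ->
  exists (n : nat) (s : 'I_n -> R),
    forall x, x \in I <-> exists c : 'I_n -> R, x = \sum_(i < n) c i * s i.

(* [phi] exhibits [A] as the localization of [R] at the complement of [P]. *)
Definition is_localization (R A : comNzRingType) (P : prime_idealr R)
    (phi : {rmorphism R -> A}) : Prop :=
  [/\ forall s, s \notin (P : {pred R}) -> exists b, b * phi s = 1,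
      forall a, exists r s, s \notin (P : {pred R}) /\ a * phi s = phi r
    & forall r, phi r = 0 -> exists2 s, s \notin (P : {pred R}) & s * r = 0].

Definition injective_module (A : comNzRingType) (E : lmodType A) : Prop :=
  forall (U V : lmodType A) (f : {linear U -> V}) (g : {linear U -> E}),
    injective f -> exists h : {linear V -> E}, forall u, h (f u) = g u.

(* [M] has an injective resolution
   0 -> M -> E 0 -> E 1 -> ... -> E n -> 0 of finite length. *)
Definition finite_injective_dimension (A : comNzRingType) (M : lmodType A) :
    Prop :=
  exists (n : nat) (E : nat -> lmodType A) (eta : {linear M -> E 0%N})
         (d : forall i, {linear E i -> E i.+1}),
  [/\ forall i, injective_module (E i),
      injective eta,
      forall x, d 0%N x = 0 <-> exists m, eta m = x,
      forall i y, d i.+1 y = 0 <-> exists x, d i x = y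
    & forall i, (n < i)%N -> forall x : E i, x = 0].

Definition gorenstein (R : comNzRingType) : Prop :=
  noetherian R /\
  forall (P : prime_idealr R) (A : comNzRingType) (phi : {rmorphism R -> A}),
    is_localization P phi -> finite_injective_dimension A^o.

(* ---- Graded Tor and regularity ---- *)

(* [p] is homogeneous of degree [d], the zero polynomial being homogeneous of
   every degree. *)
Definition in_hdegree (k : fieldType) (n : nat) (d : int) (p : {mpoly k[n]}) : bool :=
  if d is Posz m then p \is m.-homog else p == 0.

(* A graded free resolution over S = k[X_0, ..., X_(n-1)] of the S-algebra R,
   graded by the images under pi of the homogeneous polynomials:
     ... -> F_1 -> F_0 -> R -> 0,   F_i = \bigoplus_a S(- gdeg i a),
   where the elements of F_i are row vectors and maps act by multiplication on
   the right.  R being finitely generated and S Noetherian, it suffices to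
   consider resolutions by modules of finite rank. *)
Record graded_free_resolution (k : fieldType) (n : nat) (R : comNzRingType)
    (pi : {rmorphism {mpoly k[n]} -> R}) := GradedFreeResolution {
  grank : nat -> nat;
  gdeg : forall i, 'I_(grank i) -> int;
  gdiff : forall i, 'M[{mpoly k[n]}]_(grank i.+1, grank i);
  gaug : 'cV[R]_(grank 0);
  gdiff_homog : forall i a b, in_hdegree (gdeg a - gdeg b) (gdiff i a b);
  gaug_homog : forall a, exists2 p, in_hdegree (gdeg a) p & pi p = gaug a 0;
  gaug_surj : forall r : R, exists v : 'rV_(grank 0), map_mx pi v *m gaug = r%:M;
  gexact0 : forall v : 'rV_(grank 0),
    map_mx pi v *m gaug = 0 <-> exists w, w *m gdiff 0 = v;
  gexact : forall i (v : 'rV_(grank i.+1)),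
    v *m gdiff i = 0 <-> exists w, w *m gdiff i.+1 = v
}.

Section Tor.
Variables (k : fieldType) (n : nat) (R : comNzRingType).
Variable pi : {rmorphism {mpoly k[n]} -> R}.

Section Resolution.
Variable F : graded_free_resolution pi.

(* The differential of F \otimes_S k, where k = S / (X_0, ..., X_(n-1)). *)
Definition tdiff (i : nat) : 'M[k]_(grank F i.+1, grank F i) :=
  map_mx (mcoeff 0%MM) (gdiff F i).

Definition in_degree (i : nat) (d : int) (v : 'rV[k]_(grank F i)) : Prop :=
  forall a, v 0 a != 0 -> gdeg a = d.

Definition tcycle (i : nat) : 'rV[k]_(grank F i) -> Prop :=
  match i with
  | 0%N => fun=> True
  | i'.+1 => fun v => v *m tdiff i' = 0
  end.

Definition tboundary (i : nat) (d : int) (v : 'rV[k]_(grank F i)) : Prop :=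
  exists2 w, in_degree d w & v = w *m tdiff i.

End Resolution.

(* Tor_i^S(R, k)_d <> 0, i.e. H_i(F \otimes_S k)_d <> 0 for a graded free
   resolution F of R; Tor does not depend on the choice of F. *)
Definition tor_nonzero (i : nat) (d : int) : Prop :=
  exists (F : graded_free_resolution pi) (v : 'rV[k]_(grank F i)),
    [/\ in_degree d v, tcycle v & ~ tboundary d v].

(* reg(R) = r *)
Definition is_regularity (r : int) : Prop :=
  (exists i : nat, tor_nonzero i (i%:Z + r)) /\
  (forall (i : nat) (j : int), tor_nonzero i (i%:Z + j) -> (j <= r)%R).

End Tor.

(* ---- The tangential variety of the rational normal curve ---- *)

Section Tangential.
Variables (k : fieldType) (g : nat).

Definition Xt : {mpoly k[3]} := 'X_(inord 0).
Definition Xu : {mpoly k[3]} := 'X_(inord 1).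
Definition Xv : {mpoly k[3]} := 'X_(inord 2).

(* The ring map S -> k[t, u, v], z_i |-> u t^i + i v t^(i-1); the second term
   vanishes for i = 0. *)
Definition tangent_map : {rmorphism {mpoly k[g.+1]} -> {mpoly k[3]}} :=
  comp_mpoly [tuple Xu * Xt ^+ i + (Xv * Xt ^+ i.-1) *+ i | i < g.+1].

(* The homogeneous ideal of the tangential variety. *)
Definition tangential_ideal : {pred {mpoly k[g.+1]}} :=
  fun p => tangent_map p == 0.

Lemma tangential_ideal_closed : idealr_closed tangential_ideal.
Proof.
split=> [||a p q]; rewrite !unfold_in ?rmorph0 ?rmorph1 ?oner_eq0 //.
by move=> /eqP p0 /eqP q0; rewrite rmorphD rmorphM p0 q0 mulr0 addr0.
Qed.

HB.instance Definition _ :=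
  isIdealr.Build {mpoly k[g.+1]} tangential_ideal tangential_ideal_closed.

Definition tangential_ring : comNzRingType := {ideal_quot tangential_ideal}.

Definition tangential_proj : {rmorphism {mpoly k[g.+1]} -> tangential_ring} :=
  \pi_{ideal_quot tangential_ideal}%qT.

End Tangential.

(* Main.v *)
(* R is the subring of k[t,u,v] generated by the E_i = u t^i + i v t^(i-1).  Let
   {G, G'} = {g-1, g} with G invertible in k.  Then R is free over the polynomial
   ring T = k[x, y, z] with x = E_0, y = E_G, z = E_1 + (G' - G) E_G'.  As 2 is
   invertible, R contains the q_m = v^2 t^(m-2); writing w = v^3 t^(G-2), a basis
   is given by 1, the E_i, certain combinations qh_i of the q_m (1 <= i <= g-2),
   and w, in degrees 0, 1, 2, 3.  Modulo (x, y, z) one has E_i qh_j = delta_ij w,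
   so the multiplication followed by the coefficient of w is a perfect pairing
   and R is isomorphic to Hom_T(R, T).

   Gorenstein: the T-module Hom_k(R, T) has three commuting differences
   t - t^*, one for each variable t of T, whose common kernel is
   Hom_T(R, T) = R, and which are successively surjective.  As Hom_k(R, T) is an
   injective R-module, their Koszul complex is an injective resolution of R of
   length 3; it localizes because R is Noetherian.

   Regularity: since x, y, z are a regular sequence of linear forms, a graded free
   resolution stays exact modulo x, y, z, where it resolves R / (x, y, z), of top
   degree 3.  Killing the remaining coordinates of P^g one at a time bounds the
   degree of Tor_i by i + 3, and w yields a class in Tor_(g-2) of degree (g-2) + 3. *)

Require Import Defs.
From mathcomp Require Import all_boot all_order all_algebra.
From mathcomp Require Import mpoly.
From HB Require Import structures.
From mathcomp Require Import ssrcomplements boolp.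
From mathcomp Require classical_sets.
From mathcomp Require Import ring zify bigenough.
Import BigEnough.

Set Implicit Arguments.
Unset Strict Implicit.
Unset Printing Implicit Defensive.

Import Order.TTheory GRing.Theory Num.Theory.
Local Open Scope ring_scope.

(** The characteristic of [k] shapes the choice of parameters. It may divide [g] or [g.-1] but not
    both, so [G] is whichever of the two is invertible; the number [G' - G] is 1 or -1, its square
    is 1, and this lets both cases share one set of congruences. That the basis spans is graded
    Nakayama. Its independence comes from a rank count: [R] contains the 2g-2 elements u v^2 t^j,
    independent over T because, once v is eliminated, t satisfies an equation of degree 2g-2 with
    leading coefficient x and none of lower degree. [gorenstein] quantifies over every ring [A]
    characterized as a localization, so modules over such an [A] are built from fractions.
    Injectivity survives localization because over a Noetherian ring it concerns finitely many
    generators and finitely many syzygies, whose denominators can be cleared together. [tor_nonzero]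
    allows any resolution, so the upper bound on degrees is proved for every one; only the existence
    of a top class picks one. *)

(** * Baer's criterion and injective modules *)

Definition mk_linear (A : nzRingType) (U V : lmodType A) (h : U -> V)
    (h_lin : linear h) : {linear U -> V} :=
  HB.pack h (GRing.isLinear.Build A U V *:%R h h_lin).

(** A partial linear map from [V] to [E], stored as a relation so that Zorn's lemma applies to
    inclusion; the last clause makes the relation single-valued. *)
Definition functional_graph (A : comNzRingType) (V E : lmodType A)
    (G : V -> E -> Prop) : Prop :=
  [/\ G 0 0,
      forall a u e v f, G u e -> G v f -> G (a *: u + v) (a *: e + f)
    & forall e, G 0 e -> e = 0].

(** The ideal is a predicate and [phi] a total function constrained only on [I], which spares a type
    of submodules. *)
Definition baer (A : comNzRingType) (E : lmodType A) : Prop :=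
  forall (I : A -> Prop) (phi : A -> E), I 0 ->
    (forall a x y, I x -> I y ->
       I (a * x + y) /\ phi (a * x + y) = a *: phi x + phi y) ->
  exists e, forall x, I x -> phi x = x *: e.

Section BaerExtension.
Variables (A : comNzRingType) (V E : lmodType A).
Hypothesis baerE : baer E.

Lemma functional_graph_uniq (G : V -> E -> Prop) u e f :
  functional_graph G -> G u e -> G u f -> e = f.
Proof.
case=> _ GD G0 Ge Gf; have := GD (-1) _ _ _ _ Ge Gf.
rewrite !scaleN1r addNr => /G0/eqP.
by rewrite addrC subr_eq0 => /eqP.
Qed.

Lemma functional_graphZ (G : V -> E -> Prop) a u e :
  functional_graph G -> G u e -> G (a *: u) (a *: e).
Proof. by case=> G0 GD _ Ge; have := GD a _ _ _ _ Ge G0; rewrite !addr0. Qed.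

(** The scalars [a] for which [a *: v] already has a value form an ideal; Baer's condition on it
    supplies a value [e0] for [v] compatible with all of them. *)
Lemma functional_graph_extend1 (H : V -> E -> Prop) (v : V) :
    functional_graph H ->
  exists e0, functional_graph (fun u e => exists a,
    H (u - a *: v) (e - a *: e0)).
Proof.
move=> H_fg; have [H0 HD Hf] := H_fg.
pose I a := exists e, H (a *: v) e.
have /choice [phi phiP] : forall a, exists e, I a -> H (a *: v) e.
  move=> a; case: (EM (I a)) => [[e He]|nI]; first by exists e.
  by exists 0 => /nI.
have [||e0 e0P] := baerE (I := I) (phi := phi).
- by exists 0; rewrite scale0r.
- move=> a x y Ix Iy.
  have Hxy : H ((a * x + y) *: v) (a *: phi x + phi y).
    by rewrite scalerDl -scalerA; apply: HD; apply: phiP.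
  split; first by exists (a *: phi x + phi y).
  by apply: (functional_graph_uniq H_fg (phiP _ _) Hxy); exists (a *: phi x + phi y).
exists e0; split.
- by exists 0; rewrite !scale0r !subr0.
- move=> a u e w f [x Hx] [y Hy]; exists (a * x + y).
  have := HD a _ _ _ _ Hx Hy; congr H.
    by rewrite scalerBr scalerA addrACA -opprD -scalerDl.
  by rewrite scalerBr scalerA addrACA -opprD -scalerDl.
- move=> e [a]; rewrite sub0r => Ha.
  have Ia : H (a *: v) (- (e - a *: e0)).
    by have := functional_graphZ (-1) H_fg Ha; rewrite !scaleN1r opprK.
  have := functional_graph_uniq H_fg Ia (phiP a (ex_intro _ _ Ia)).
  rewrite e0P; last by exists (- (e - a *: e0)).
  by rewrite opprB => /eqP; rewrite subr_eq addrC -subr_eq subrr => /eqP.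
Qed.

(** Zorn's lemma on the partial linear maps extending [G]: a maximal one is total, since
    [functional_graph_extend1] cannot enlarge it. *)
Lemma baer_extend (G : V -> E -> Prop) : functional_graph G ->
  exists h : {linear V -> E}, forall u e, G u e -> h u = e.
Proof.
move=> G_fg.
pose T := {H : V -> E -> Prop | functional_graph H /\ forall u e, G u e -> H u e}.
pose R (H K : T) := `[< forall u e, sval H u e -> sval K u e >].
have [||C Ctot|H Hmax] := @classical_sets.ZL_preorder T
    (exist _ G (conj G_fg (fun _ _ => id))) R.
- by move=> H; apply/asboolP.
- move=> H K L /asboolP HK /asboolP KL; apply/asboolP => u e /HK; exact: KL.
- case: (EM (exists H, C H)) => [[H0 CH0]|nC]; last first.
    by exists (exist _ G (conj G_fg (fun _ _ => id))) => H CH; case: nC; exists H.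
  pose K u e := exists2 H, C H & sval H u e.
  have K_fg : functional_graph K.
    split.
    - by exists H0 => //; case: (svalP H0) => -[].
    - move=> a u e v f [H CH Hu] [L CL Lv].
      case: (Ctot H L CH CL) => /asboolP HL.
        exists L => //; have [[_ LD _] _] := svalP L.
        by apply: LD => //; apply: HL.
      exists H => //; have [[_ HD _] _] := svalP H.
      by apply: HD => //; apply: HL.
    - by move=> e [H CH He]; have [[_ _ Hf] _] := svalP H; apply: Hf.
  have GK : forall u e, G u e -> K u e.
    by move=> u e Gue; exists H0 => //; have [_] := svalP H0; apply.
  exists (exist _ K (conj K_fg GK)) => H CH.
  by apply/asboolP => u e Hu; exists H.
have [H_fg GH] := svalP H.
have Htot v : exists e, sval H v e.
  have [e0 K_fg] := functional_graph_extend1 v H_fg.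
  set K := (fun u e => _) in K_fg.
  have HK u e : sval H u e -> K u e by exists 0; rewrite !scale0r !subr0.
  have GK u e : G u e -> K u e by move/GH/HK.
  have /asboolP KH := Hmax (exist _ K (conj K_fg GK)) (asboolT HK).
  exists e0; apply: KH; exists 1; rewrite !scale1r !subrr.
  by case: H_fg.
have [h hP] := choice Htot.
have h_lin : linear h.
  move=> a u v; apply: (functional_graph_uniq H_fg (hP _)).
  by case: H_fg => _ HD _; apply: HD.
exists (mk_linear h_lin) => u e /GH Hu /=.
exact: functional_graph_uniq H_fg (hP u) Hu.
Qed.

End BaerExtension.

Lemma injective_of_baer (A : comNzRingType) (E : lmodType A) :
  baer E -> injective_module E.
Proof.
move=> E_baer U V f g f_inj.
have [|h hP] := baer_extend E_baer
    (G := fun (v : V) e => exists2 u, v = f u & e = g u).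
  split.
  - by exists 0; rewrite linear0.
  - move=> a _ _ _ _ [u -> ->] [v -> ->]; exists (a *: u + v); by rewrite linearP.
  - by move=> e [u /esym/eqP]; rewrite raddf_eq0 // => /eqP -> ->; rewrite linear0.
by exists h => u; apply: hP; exists u.
Qed.

Lemma field_baer (k : fieldType) (W : lmodType k) : baer W.
Proof.
move=> I phi I0 IP.
have phi0 : phi 0 = 0.
  have [_] := IP 1 _ _ I0 I0; rewrite mulr0 add0r scale1r => phiD.
  by apply: (addrI (phi 0)); rewrite addr0 -phiD.
case: (EM (exists2 x, I x & x != 0)) => [[x Ix x0]|nI].
  exists (x^-1 *: phi x) => y Iy.
  have [_] := IP (y / x) _ _ Ix I0.
  by rewrite addr0 mulfVK // phi0 addr0 scalerA.
exists 0 => x Ix; rewrite scaler0.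
by case: (eqVneq x 0) => [->//|x0]; case: nI; exists x.
Qed.

Lemma zero_module_injective (A : comNzRingType) (E : lmodType A) :
  (forall x : E, x = 0) -> injective_module E.
Proof.
move=> E0 U V f g _; have h_lin : linear (fun _ : V => 0 : E).
  by move=> a u v; rewrite scaler0 addr0.
by exists (mk_linear h_lin) => u /=; rewrite (E0 (g u)).
Qed.

Lemma injective_module_prod (A : comNzRingType) (E F : lmodType A) :
  injective_module E -> injective_module F ->
  injective_module ((E * F)%type : lmodType A).
Proof.
move=> injE injF U V f g f_inj.
have g1_lin : linear (fun u => (g u).1) by move=> a u v; rewrite linearP.
have g2_lin : linear (fun u => (g u).2) by move=> a u v; rewrite linearP.
have [h1 h1P] := injE U V f (mk_linear g1_lin) f_inj.
have [h2 h2P] := injF U V f (mk_linear g2_lin) f_inj.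
have h_lin : linear (fun v => (h1 v, h2 v)).
  by move=> a u v; rewrite !linearP.
exists (mk_linear h_lin) => u /=.
by rewrite h1P h2P /= -surjective_pairing.
Qed.

(** * Coinduced modules and a finite form of Baer's criterion *)

(** Baer's condition for the ideal generated by the [r i], phrased through syzygies: a linear map on
    that ideal is a family of values respecting every relation. Only finitely many elements occur,
    so this form can be localized. *)
Definition finitely_baer (R : comNzRingType) (E : lmodType R) : Prop :=
  forall m (r : 'I_m -> R) (e : 'I_m -> E),
    (forall c : 'I_m -> R,
       \sum_i c i * r i = 0 -> \sum_i c i *: e i = 0) ->
  exists e0, forall i, e i = r i *: e0.

Definition restrict_scalars (k : fieldType) (R : comNzRingType)
  (kappa : {rmorphism k -> R}) : Type := R.

Section RestrictScalars.
Variables (k : fieldType) (R : comNzRingType) (kappa : {rmorphism k -> R}).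
Local Notation Rk := (restrict_scalars kappa).

HB.instance Definition _ := GRing.Zmodule.on Rk.

Definition restrict_scale (c : k) (a : Rk) : Rk := kappa c * (a : R).

Fact restrict_scaleA c d a :
  restrict_scale c (restrict_scale d a) = restrict_scale (c * d) a.
Proof. by rewrite /restrict_scale rmorphM mulrA. Qed.

Fact restrict_scale1 : left_id 1 restrict_scale.
Proof. by move=> a; rewrite /restrict_scale rmorph1 mul1r. Qed.

Fact restrict_scaleDr : right_distributive restrict_scale +%R.
Proof. by move=> c a b; rewrite /restrict_scale mulrDr. Qed.

Fact restrict_scaleDl a : {morph restrict_scale^~ a : c d / c + d}.
Proof. by move=> c d; rewrite /restrict_scale rmorphD mulrDl. Qed.

HB.instance Definition _ := GRing.Zmodule_isLmodule.Build k Rk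
  restrict_scaleA restrict_scale1 restrict_scaleDr restrict_scaleDl.

Variable W : lmodType k.

(* The R-module Hom_k(R, W), with R acting through the source. *)
Record coinduced := Coinduced { coind_fun :> {linear Rk -> W} }.

Lemma coindP (f g : coinduced) : (forall a, f a = g a) -> f = g.
Proof.
case: f => f; case: g => g /= fg; congr Coinduced.
have {}fg : f =1 g by [].
have {fg} : (f : _ -> _) = g by apply: funext.
case: f g => [f [[fa] [fs]]] [g [[ga] [gs]]] /= fg.
rewrite -{}fg in ga gs *.
by rewrite (Prop_irrelevance fa ga) (Prop_irrelevance fs gs).
Qed.

HB.instance Definition _ := gen_eqMixin coinduced.
HB.instance Definition _ := gen_choiceMixin coinduced.

Fact coind0_lin : linear ((fun=> 0) : Rk -> W).
Proof. by move=> c a b; rewrite scaler0 addr0. Qed.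

Fact coindD_lin (f h : coinduced) : linear ((fun a => f a + h a) : Rk -> W).
Proof. by move=> c a b; rewrite (linearP f) (linearP h) scalerDr addrACA. Qed.

Fact coindN_lin (f : coinduced) : linear ((fun a => - f a) : Rk -> W).
Proof. by move=> c a b; rewrite (linearP f) opprD scalerN. Qed.

Fact coindZ_lin (r : R) (f : coinduced) :
  linear ((fun a => f (r * a : R)) : Rk -> W).
Proof.
move=> c a b; rewrite -linearP; congr (f _).
rewrite /GRing.scale /= /restrict_scale;
  exact: etrans (mulrDr _ _ _) (congr1 (+%R^~ _) (mulrCA _ _ _)).
Qed.

Definition coind0 := Coinduced (mk_linear coind0_lin).
Definition coindD f h := Coinduced (mk_linear (coindD_lin f h)).
Definition coindN f := Coinduced (mk_linear (coindN_lin f)).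
Definition coindZ r f := Coinduced (mk_linear (coindZ_lin r f)).

Fact coindDA : associative coindD.
Proof. by move=> f g h; apply: coindP => a /=; rewrite addrA. Qed.
Fact coindDC : commutative coindD.
Proof. by move=> f g; apply: coindP => a /=; rewrite addrC. Qed.
Fact coind0D : left_id coind0 coindD.
Proof. by move=> f; apply: coindP => a /=; rewrite add0r. Qed.
Fact coindND : left_inverse coind0 coindN coindD.
Proof. by move=> f; apply: coindP => a /=; rewrite addNr. Qed.

HB.instance Definition _ :=
  GRing.isZmodule.Build coinduced coindDA coindDC coind0D coindND.

Fact coindZA r s f : coindZ r (coindZ s f) = coindZ (r * s) f.
Proof. by apply: coindP => a /=; rewrite mulrA (mulrC s). Qed.
Fact coind1Z : left_id 1 coindZ.
Proof. by move=> f; apply: coindP => a /=; rewrite mul1r. Qed.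
Fact coindZDr : right_distributive coindZ +%R.
Proof. by move=> r f g; apply: coindP => a. Qed.
Fact coindZDl f : {morph coindZ^~ f : r s / r + s}.
Proof. by move=> r s; apply: coindP => a /=; rewrite mulrDl linearD. Qed.

HB.instance Definition _ := GRing.Zmodule_isLmodule.Build R coinduced
  coindZA coind1Z coindZDr coindZDl.

Lemma coindED (f h : coinduced) a : (f + h) a = f a + h a. Proof. by []. Qed.
Lemma coindEZ r (f : coinduced) a : (r *: f) a = f (r * a : R).
Proof. by []. Qed.
Lemma coindE_sum I (s : seq I) (F : I -> coinduced) a :
  (\sum_(i <- s) F i) a = \sum_(i <- s) F i a.
Proof. by elim/big_rec2: _ => // i y1 y2 _ <-. Qed.

(** The adjunction Hom_R(I, Hom_k(R, W)) = Hom_k(I, W): prescribed values become a [k]-linear map on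
    the ideal, which extends to [R] because [k] is a field. *)
Lemma coinduced_finitely_baer : finitely_baer (coinduced : lmodType R).
Proof.
move=> m r e eP.
pose G (a : Rk) w := exists c : 'I_m -> R,
  a = \sum_i c i * r i :> R /\ w = \sum_i e i (c i).
have [|h hP] := baer_extend (@field_baer k W) (G := G).
  split.
  - exists (fun=> 0); split; last by rewrite big1 // => i _; rewrite linear0.
    by rewrite big1 // => i _; rewrite mul0r.
  - move=> a _ _ _ _ [c [-> ->]] [d [-> ->]].
    exists (fun i => kappa a * c i + d i); split.
      rewrite /GRing.scale /= /restrict_scale mulr_sumr -big_split /=.
      by apply: eq_bigr => i _; rewrite mulrDl mulrA.
    rewrite scaler_sumr -big_split /=; apply: eq_bigr => i _.
    by rewrite -linearP.
  - move=> w [c [/esym c0 ->]].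
    (* The map on the ideal is well defined: a syzygy annihilates the values, and this is evaluated
       at 1. *)
    have /(congr1 (fun f : coinduced => f 1)) := eP c c0.
    rewrite coindE_sum => S0; rewrite -[RHS]S0; apply: eq_bigr => i _.
    by rewrite coindEZ mulr1.
exists (Coinduced h) => i; apply: coindP => a; rewrite coindEZ /=; apply/esym/hP.
exists (fun j => if j == i then a else 0); split.
  rewrite (bigD1 i) //= eqxx big1 ?addr0 1?mulrC // => j /negPf ->.
  by rewrite mul0r.
rewrite (bigD1 i) //= eqxx big1 ?addr0 // => j /negPf ->.
by rewrite linear0.
Qed.

End RestrictScalars.

(** * Localization of modules over an abstract localization of the ring *)

Section ModuleLocalization.
Variables (R A : comNzRingType) (P : prime_idealr R) (phi : {rmorphism R -> A}).
Hypothesis phi_loc : is_localization P phi.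

Let denom := {s : R | s \notin (P : {pred R})}.

Let mk_denom s Ps : denom := exist (fun s => s \notin (P : {pred R})) s Ps.

Fact denom1_subproof : 1 \notin (P : {pred R}).
Proof. by rewrite idealr1. Qed.
Fact denomM_subproof (s t : denom) : sval s * sval t \notin (P : {pred R}).
Proof. by rewrite prime_idealrM negb_or (svalP s) (svalP t). Qed.
Let denom1 : denom := mk_denom denom1_subproof.
Let denomM (s t : denom) : denom := mk_denom (denomM_subproof s t).

Section Construction.
Variable E : lmodType R.

Let same_frac (x y : E * denom) : Prop :=
  exists u : denom, (sval u * sval y.2) *: x.1 = (sval u * sval x.2) *: y.1.

Lemma same_frac_refl x : same_frac x x. Proof. by exists denom1. Qed.
Lemma same_frac_sym x y : same_frac x y -> same_frac y x.
Proof. by case=> u; exists u. Qed.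
Lemma same_frac_trans x y z : same_frac x y -> same_frac y z -> same_frac x z.
Proof.
move=> [u xy] [v yz]; exists (denomM (denomM u v) y.2) => /=.
have -> : sval u * sval v * sval y.2 * sval z.2
  = (sval v * sval z.2) * (sval u * sval y.2) by ring.
rewrite -scalerA xy scalerA.
have -> : sval v * sval z.2 * (sval u * sval x.2)
  = (sval u * sval x.2) * (sval v * sval z.2) by ring.
by rewrite -scalerA yz scalerA; congr (_ *: _); ring.
Qed.

(** An equivalence class of fractions, stored as a predicate; extensionality then turns equivalence
    into equality. *)
Record localized := Localized {
  loc_class : E * denom -> Prop;
  loc_classP : exists x, loc_class = same_frac x }.

Lemma loc_class_inj l m : loc_class l = loc_class m -> l = m.
Proof.
case: l => C p; case: m => D q /= CD; move: q; rewrite -CD => q.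
by rewrite (Prop_irrelevance p q).
Qed.

Definition frac (e : E) (s : denom) : localized :=
  Localized (ex_intro _ (e, s) erefl).

Lemma frac_eq e s f t : frac e s = frac f t <->
  exists u : denom, (sval u * sval t) *: e = (sval u * sval s) *: f.
Proof.
split=> [[/(congr1 (fun C => C (f, t)))] | ef].
  move=> E_; have : same_frac (f, t) (f, t) by apply: same_frac_refl.
  by rewrite -E_.
apply: loc_class_inj => /=; apply: funext => x; apply: propext; split.
  by apply: same_frac_trans; apply: same_frac_sym.
exact: same_frac_trans.
Qed.

Lemma frac_surj l : exists x : E * denom, l = frac x.1 x.2.
Proof.
by case: (loc_classP l) => -[e s] lE; exists (e, s); apply: loc_class_inj.
Qed.

Lemma frac_congr e s f t : e = f -> sval s = sval t -> frac e s = frac f t.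
Proof. by move=> -> st; apply/frac_eq; exists denom1; rewrite st. Qed.

Lemma frac_cancel u e s : frac (sval u *: e) (denomM u s) = frac e s.
Proof.
by apply/frac_eq; exists denom1 => /=; rewrite scalerA; congr (_ *: _); ring.
Qed.

Let repr l : E * denom := sval (cid (frac_surj l)).
Let reprK l : frac (repr l).1 (repr l).2 = l.
Proof. by rewrite -(svalP (cid (frac_surj l))). Qed.

HB.instance Definition _ := gen_eqMixin localized.
HB.instance Definition _ := gen_choiceMixin localized.

Let add l m :=
  frac (sval (repr m).2 *: (repr l).1 + sval (repr l).2 *: (repr m).1)
       (denomM (repr l).2 (repr m).2).
Let opp l := frac (- (repr l).1) (repr l).2.

Let addE e s f t :
  add (frac e s) (frac f t) = frac (sval t *: e + sval s *: f) (denomM s t).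
Proof.
rewrite /add; move: (repr _) (reprK (frac e s)) => [e' s'] /frac_eq /= [u ue].
move: (repr _) (reprK (frac f t)) => [f' t'] /frac_eq /= [v vf].
apply/frac_eq; exists (denomM u v) => /=; rewrite !scalerDr !scalerA.
congr (_ + _).
  transitivity ((sval v * sval t * sval t') *: ((sval u * sval s) *: e')).
    by rewrite scalerA; congr (_ *: _); ring.
  by rewrite ue scalerA; congr (_ *: _); ring.
transitivity ((sval u * sval s * sval s') *: ((sval v * sval t) *: f')).
  by rewrite scalerA; congr (_ *: _); ring.
by rewrite vf scalerA; congr (_ *: _); ring.
Qed.

Let oppE e s : opp (frac e s) = frac (- e) s.
Proof.
rewrite /opp; move: (repr _) (reprK (frac e s)) => [e' s'] /frac_eq /= [u ue].
by apply/frac_eq; exists u => /=; rewrite !scalerN ue.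
Qed.

Fact loc_addA : associative add.
Proof.
move=> l m n; rewrite -(reprK l) -(reprK m) -(reprK n) !addE.
apply: frac_congr => /=; last by rewrite mulrA.
by rewrite !scalerDr !scalerA addrA; congr (_ *: _ + _ *: _ + _ *: _); ring.
Qed.
Fact loc_addC : commutative add.
Proof.
move=> l m; rewrite -(reprK l) -(reprK m) !addE.
by apply: frac_congr => /=; [rewrite addrC | rewrite mulrC].
Qed.
Fact loc_add0 : left_id (frac 0 denom1) add.
Proof.
move=> l; rewrite -(reprK l) !addE.
by apply: frac_congr => /=; rewrite ?scaler0 ?add0r ?scale1r ?mul1r.
Qed.
Fact loc_addN : left_inverse (frac 0 denom1) opp add.
Proof.
move=> l; rewrite -(reprK l) oppE !addE.
by apply/frac_eq; exists denom1; rewrite scalerN addNr !scaler0.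
Qed.

HB.instance Definition _ :=
  GRing.isZmodule.Build localized loc_addA loc_addC loc_add0 loc_addN.

Let frac_of (a : A) : exists x : R * denom, a * phi (sval x.2) = phi x.1.
Proof.
by case: phi_loc => _ /(_ a) [r [s [Ps rs]]] _; exists (r, mk_denom Ps).
Qed.
Let rep a : R * denom := sval (cid (frac_of a)).
Let repP a : a * phi (sval (rep a).2) = phi (rep a).1.
Proof. exact: (svalP (cid (frac_of a))). Qed.

Let scale a l := frac ((rep a).1 *: (repr l).1) (denomM (rep a).2 (repr l).2).

(** The action of [a] goes through a chosen fraction. Two fractions for [a] agree in [R] only after
    multiplication by some [v] outside [P], which the third clause of [is_localization] provides and
    the denominator absorbs. *)
Let scaleE a r q e s : a * phi (sval q) = phi r ->
  scale a (frac e s) = frac (r *: e) (denomM q s).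
Proof.
rewrite /scale => ar; move: (rep a) (repP a) => [r' q'] /= ar'.
move: (repr _) (reprK (frac e s)) => [e' s'] /frac_eq /= [u ue].
have : phi (r * sval q' - r' * sval q) = 0.
  by rewrite rmorphB !rmorphM -ar -ar'; apply/eqP; rewrite subr_eq0 mulrAC.
case: phi_loc => _ _ /[apply] -[v Pv] /eqP.
rewrite mulrBr subr_eq0 => /eqP vE.
apply/frac_eq; exists (denomM u (mk_denom Pv)) => /=; rewrite !scalerA.
transitivity ((v * (r' * sval q)) *: ((sval u * sval s) *: e')).
  by rewrite scalerA; congr (_ *: _); ring.
by rewrite ue -vE scalerA; congr (_ *: _); ring.
Qed.

Fact loc_scaleA a b l : scale a (scale b l) = scale (a * b) l.
Proof.
rewrite -(reprK l) (scaleE _ _ (repP b)) (scaleE _ _ (repP a)).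
have abE : a * b * phi (sval (denomM (rep a).2 (rep b).2))
    = phi ((rep a).1 * (rep b).1).
  by rewrite !rmorphM mulrACA !repP.
rewrite (scaleE _ _ abE).
by apply: frac_congr; rewrite /= ?scalerA ?mulrA.
Qed.
Fact loc_scale1 : left_id 1 scale.
Proof.
have one : 1 * phi (sval denom1) = phi 1 by rewrite mul1r.
move=> l; rewrite -(reprK l) (scaleE _ _ one).
by apply: frac_congr; rewrite /= ?scale1r ?mul1r.
Qed.
Fact loc_scaleDr : right_distributive scale +%R.
Proof.
move=> a l m; rewrite -(reprK l) -(reprK m) /GRing.add /= addE.
rewrite !(scaleE _ _ (repP a)) addE -(frac_cancel (rep a).2).
apply: frac_congr => /=; last by ring.
by rewrite !scalerDr !scalerA; congr (_ *: _ + _ *: _); ring.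
Qed.
Fact loc_scaleDl l : {morph scale^~ l : a b / a + b}.
Proof.
move=> a b; rewrite /= -(reprK l) (scaleE _ _ (repP a)) (scaleE _ _ (repP b)).
have abE : (a + b) * phi (sval (denomM (rep a).2 (rep b).2))
    = phi ((rep a).1 * sval (rep b).2 + (rep b).1 * sval (rep a).2).
  by rewrite mulrDl rmorphD !rmorphM mulrA repP mulrCA repP; ring.
rewrite (scaleE _ _ abE) [RHS]addE -(frac_cancel (repr l).2).
apply: frac_congr => /=; last by ring.
by rewrite scalerDl scalerDr !scalerA; congr (_ *: _ + _ *: _); ring.
Qed.

HB.instance Definition _ := GRing.Zmodule_isLmodule.Build A localized
  loc_scaleA loc_scale1 loc_scaleDr loc_scaleDl.

Lemma fracZ r e s : phi r *: frac e s = frac (r *: e) s.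
Proof.
have rE : phi r * phi (sval denom1) = phi r by rewrite rmorph1 mulr1.
by rewrite [LHS](scaleE _ _ rE); apply: frac_congr; rewrite //= mul1r.
Qed.

Lemma frac1D e f : frac e denom1 + frac f denom1 = frac (e + f) denom1.
Proof.
by rewrite [LHS]addE; apply: frac_congr; rewrite /= ?scale1r ?mul1r.
Qed.

End Construction.

Definition is_module_localization (E : lmodType R) (L : lmodType A)
    (j : E -> L) : Prop :=
  [/\ forall r e f, j (r *: e + f) = phi r *: j e + j f,
      forall l, exists2 s, s \notin (P : {pred R}) & exists e, phi s *: l = j e
    & forall e, j e = 0 -> exists2 s, s \notin (P : {pred R}) & s *: e = 0].

Lemma module_localization_exists (E : lmodType R) :
  exists (L : lmodType A) (j : E -> L), is_module_localization j.
Proof.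
exists (localized E : lmodType A), (fun e => frac e denom1); split.
- by move=> r e f; rewrite fracZ frac1D.
- move=> l; have [[e s] -> /=] := frac_surj l.
  exists (sval s); first exact: (svalP s).
  exists e; rewrite fracZ.
  by apply/frac_eq; exists denom1 => /=; rewrite scalerA; congr (_ *: _); ring.
- move=> e /frac_eq [u /= ue]; exists (sval u); first exact: (svalP u).
  by move: ue; rewrite !mulr1 scaler0.
Qed.

End ModuleLocalization.

(** * Noetherian rings and the localization of injective modules *)

Definition is_submodule (R : comNzRingType) m (M : 'rV[R]_m -> Prop) : Prop :=
  M 0 /\ forall a u v, M u -> M v -> M (a *: u + v).

Lemma noetherian_ideal (R : comNzRingType) (I : R -> Prop) : noetherian R ->
    I 0 -> (forall a x y, I x -> I y -> I (a * x + y)) ->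
  exists (n : nat) (s : 'I_n -> R),
    forall x, I x <-> exists c : 'I_n -> R, x = \sum_(i < n) c i * s i.
Proof.
move=> R_noeth I0 ID; have [||n [s sP]] := R_noeth (fun x => `[< I x >]).
- exact/asboolP.
- by move=> a x y /asboolP Ix /asboolP Iy; apply/asboolP/ID.
exists n, s => x; rewrite -sP; split; first by move=> Ix; apply/asboolP.
by move/asboolP.
Qed.

Lemma is_submodule_sum (R : comNzRingType) m (M : 'rV[R]_m -> Prop)
    q (c : 'I_q -> R) (v : 'I_q -> 'rV[R]_m) :
  is_submodule M -> (forall i, M (v i)) -> M (\sum_i c i *: v i).
Proof.
case=> M0 MD Mv; elim/big_rec: _ => // i x _ Mx; exact: MD.
Qed.

(** Induction on the number of coordinates: lifts of generators of the ideal of first coordinates,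
    together with generators of the vectors whose first coordinate is zero. *)
Lemma noetherian_submodule (R : comNzRingType) : noetherian R ->
  forall m (M : 'rV[R]_m -> Prop), is_submodule M ->
  exists (q : nat) (G : 'M[R]_(q, m)), forall v, M v <-> exists c, v = c *m G.
Proof.
move=> R_noeth; elim=> [|m IHm] M M_sub; have [M0 MD] := M_sub.
  exists 0%N, 0 => v; split=> [_|_]; first by exists 0; rewrite !thinmx0.
  by rewrite thinmx0.
pose I a := exists2 v : 'rV_(1 + m), M v & v 0 ord0 = a.
have [||n [s sP]] := @noetherian_ideal R I R_noeth.
- by exists 0 => //; rewrite mxE.
- move=> a x y [u Mu <-] [v Mv <-].
  by exists (a *: u + v); [exact: MD | rewrite !mxE].
have /choice [V VP] : forall i, exists v : 'rV_(1 + m), M v /\ v 0 ord0 = s i.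
  move=> i; have [v Mv vE] : I (s i).
    apply/sP; exists (fun j => (j == i)%:R).
    rewrite (bigD1 i) //= eqxx mul1r big1 ?addr0 // => j /negPf ->.
    by rewrite mul0r.
  by exists v.
have [|q [G GP]] := IHm (fun u => M (row_mx 0 u : 'rV_(1 + m))).
  split; first by rewrite row_mx0.
  move=> a u v Mu Mv.
  have -> : row_mx 0 (a *: u + v) = a *: row_mx 0 u + row_mx 0 v :> 'rV_(1 + m).
    by rewrite scale_row_mx add_row_mx scaler0 addr0.
  exact: MD.
exists (n + q)%N, (col_mx (\matrix_i V i) (row_mx 0 G) : 'M_(n + q, 1 + m)) => v.
have sumV (c : 'rV_n) :
    c *m (\matrix_i V i : 'M_(n, 1 + m)) = \sum_i c 0 i *: V i.
  by rewrite mulmx_sum_row; apply: eq_bigr => i _; rewrite rowK.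
have rowG (d : 'rV_q) :
    d *m (row_mx 0 G : 'M_(q, 1 + m)) = row_mx 0 (d *m G).
  by rewrite mul_mx_row mulmx0.
split=> [Mv | [c ->]].
  have /sP [c cE] : I (v 0 ord0) by exists v.
  pose c' : 'rV_n := \row_i c i.
  pose w : 'rV_(1 + m) := (v : 'rV_(1 + m)) - c' *m (\matrix_i V i).
  have Mw : M w.
    rewrite /w -[v - _]addrC -scaleN1r sumV; apply: MD => //.
    by apply: is_submodule_sum => // i; case: (VP i).
  have wE : w = row_mx 0 (rsubmx w).
    rewrite -[LHS]hsubmxK; congr row_mx; apply/rowP => i; rewrite !ord1.
    rewrite /w sumV !mxE summxE (_ : lshift m 0 = ord0); last exact/val_inj.
    rewrite cE -sumrN -big_split big1 //= => j _.
    by rewrite !mxE (VP j).2 subrr.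
  move: Mw; rewrite wE => /GP [d dE]; exists (row_mx c' d).
  rewrite [RHS]mul_row_col [X in _ + X]rowG -dE -wE.
  by rewrite /w addrCA subrr addr0.
rewrite -[c]hsubmxK [X in M X]mul_row_col [X in _ + X]rowG sumV -[X in X + _]scale1r.
apply: (MD 1); last by apply/GP; exists (rsubmx c).
by apply: is_submodule_sum => // i; case: (VP i).
Qed.

Section LocalizationInjective.
Variables (R A : comNzRingType) (P : prime_idealr R) (phi : {rmorphism R -> A}).
Hypothesis phi_loc : is_localization P phi.
Variables (E : lmodType R) (L : lmodType A) (j : E -> L).
Hypothesis j_loc : is_module_localization P phi j.

Lemma module_loc0 : j 0 = 0.
Proof.
case: j_loc => jP _ _; have := jP 1 0 0.
rewrite scaler0 addr0 rmorph1 scale1r => jD.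
by apply: (addrI (j 0)); rewrite -jD addr0.
Qed.

Lemma module_locD e f : j (e + f) = j e + j f.
Proof. by case: j_loc => jP _ _; have := jP 1 e f; rewrite rmorph1 !scale1r. Qed.

Lemma module_locZ r e : j (r *: e) = phi r *: j e.
Proof.
by case: j_loc => jP _ _; have := jP r e 0; rewrite module_loc0 !addr0.
Qed.

Lemma module_locN e : j (- e) = - j e.
Proof. by rewrite -scaleN1r module_locZ rmorphN1 scaleN1r. Qed.

Lemma module_loc_sum I (s : seq I) (F : I -> E) :
  j (\sum_(i <- s) F i) = \sum_(i <- s) j (F i).
Proof.
by elim/big_rec2: _ => [|i x y _ <-]; rewrite ?module_loc0 ?module_locD.
Qed.

Lemma denom_unit s : s \notin (P : {pred R}) -> exists b, b * phi s = 1.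
Proof. by case: phi_loc => + _ _; apply. Qed.

Lemma denom_inj s (x y : L) : s \notin (P : {pred R}) ->
  phi s *: x = phi s *: y -> x = y.
Proof.
by move=> /denom_unit [b bs] /(congr1 ( *:%R b)); rewrite !scalerA bs !scale1r.
Qed.

Lemma notin_prod q (s : 'I_q -> R) : (forall i, s i \notin (P : {pred R})) ->
  \prod_i s i \notin (P : {pred R}).
Proof.
move=> Ps; elim/big_rec: _ => [|i x _ Px]; first by rewrite idealr1.
by rewrite prime_idealrM negb_or Ps.
Qed.

Lemma common_denom q (l : 'I_q -> L) :
  exists2 s, s \notin (P : {pred R}) &
    exists e : 'I_q -> E, forall i, phi s *: l i = j (e i).
Proof.
case: j_loc => _ j_surj _.
have /choice [t tP] : forall i, exists t, t \notin (P : {pred R}) /\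
    exists e, phi t *: l i = j e.
  by move=> i; have [t Pt e] := j_surj (l i); exists t.
exists (\prod_i t i); first by apply: notin_prod => i; case: (tP i).
suff /choice : forall i, exists e, phi (\prod_i t i) *: l i = j e.
  by case=> e eE; exists e.
move=> i.
have [_ [e eE]] := tP i; exists ((\prod_(k | k != i) t k) *: e).
by rewrite (bigD1 i) //= mulrC rmorphM -scalerA eE module_locZ.
Qed.

(** The contraction of the ideal to [R] has finitely many generators [r], with syzygies generated by
    the rows of [G]. A common denominator [s] brings the values into [E], a second one [u] makes
    them respect every row of [G] there, and [E_baer] applies. *)
Lemma baer_localization : noetherian R -> finitely_baer E -> baer L.
Proof.
move=> R_noeth E_baer J psi J0 JP.
have psi0 : psi 0 = 0.
  have [_] := JP 1 _ _ J0 J0; rewrite mulr0 add0r scale1r => psiD.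
  by apply: (addrI (psi 0)); rewrite addr0 -psiD.
have psiM a x : J x -> J (a * x) /\ psi (a * x) = a *: psi x.
  by move=> Jx; have := JP a _ _ Jx J0; rewrite !addr0 psi0 addr0.
have psiS m (c x : 'I_m -> A) : (forall i, J (x i)) ->
    J (\sum_i c i * x i) /\ psi (\sum_i c i * x i) = \sum_i c i *: psi (x i).
  move=> Jx; elim/big_rec2: _ => [|i y1 y2 _ [Jy <-]]; first by rewrite psi0.
  exact: JP.
have [||m [r rP]] := @noetherian_ideal R (fun x => J (phi x)) R_noeth.
- by rewrite rmorph0.
- by move=> a x y Jx Jy; rewrite rmorphD rmorphM; case: (JP (phi a) _ _ Jx Jy).
have Jr i : J (phi (r i)).
  apply/rP; exists (fun k => (k == i)%:R).
  rewrite (bigD1 i) //= eqxx mul1r big1 ?addr0 // => k /negPf ->.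
  by rewrite mul0r.
have [s Ps [e eP]] := common_denom (fun i => psi (phi (r i))).
have [|q [G GP]] := @noetherian_submodule R R_noeth m
    (fun c => \sum_i c 0 i * r i = 0).
  split; first by rewrite big1 // => i _; rewrite mxE mul0r.
  move=> a u v u0 v0; transitivity (a * (\sum_i u 0 i * r i) + \sum_i v 0 i * r i).
    rewrite mulr_sumr -big_split; apply: eq_bigr => i _ /=.
    by rewrite !mxE mulrDl mulrA.
  by rewrite u0 v0 mulr0 addr0.
have /choice [t tP] : forall k, exists t, t \notin (P : {pred R}) /\
    t *: (\sum_i G k i *: e i) = 0.
  move=> k; have /GP G0 : exists c, row k G = c *m G.
    by exists (delta_mx 0 k); rewrite -rowE.
  case: j_loc => _ _ /(_ (\sum_i G k i *: e i)) [|t Pt tE]; last by exists t.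
  rewrite module_loc_sum; transitivity (phi s *: psi (phi (\sum_i G k i * r i))).
    rewrite rmorph_sum /=; under [in RHS]eq_bigr do rewrite rmorphM.
    have [_ ->] := psiS m (fun i => phi (G k i)) (phi \o r) Jr.
    rewrite scaler_sumr; apply: eq_bigr => i _ /=.
    by rewrite module_locZ -eP !scalerA mulrC.
  move: G0; under eq_bigr do rewrite mxE.
  by move=> ->; rewrite rmorph0 psi0 scaler0.
pose u := \prod_k t k.
have Pu : u \notin (P : {pred R}) by apply: notin_prod => k; case: (tP k).
have uG k : u *: (\sum_i G k i *: e i) = 0.
  by rewrite /u (bigD1 k) //= mulrC -scalerA (tP k).2 scaler0.
have [c c0|e0 e0P] := E_baer m r (fun i => u *: e i).
  have /GP [d dE] : \sum_i (\row_i c i) 0 i * r i = 0.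
    by under eq_bigr do rewrite mxE.
  transitivity (\sum_k d 0 k *: (u *: (\sum_i G k i *: e i))).
    under [RHS]eq_bigr do rewrite !scaler_sumr.
    rewrite exchange_big /=; apply: eq_bigr => i _.
    have -> : c i = \sum_k d 0 k * G k i.
      by move/rowP/(_ i): dE; rewrite !mxE.
    rewrite scaler_suml; apply: eq_bigr => k _.
    by rewrite !scalerA; congr (_ *: _); ring.
  by rewrite big1 // => k _; rewrite uG scaler0.
have Psu : s * u \notin (P : {pred R}) by rewrite prime_idealrM negb_or Ps.
have [b bE] := denom_unit Psu.
(* [b] undoes the two multiplications by [s] and [u] made on the values. *)
exists (b *: j e0) => a Ja.
have [_ /(_ a) [p [y [Py pyE]]] _] := phi_loc.
have /rP [c cE] : J (phi p) by rewrite -pyE mulrC; case: (psiM (phi y) a Ja).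
apply: (denom_inj Py); apply: (denom_inj Psu).
have [_ <-] := psiM (phi y) a Ja.
rewrite [phi y * a]mulrC pyE cE rmorph_sum /=; under eq_bigr do rewrite rmorphM.
have [_ ->] := psiS m (fun i => phi (c i)) (phi \o r) Jr.
have -> : phi (s * u) *: (phi y *: (a *: (b *: j e0))) = j (p *: e0).
  rewrite module_locZ -pyE !scalerA; congr (_ *: _).
  by rewrite -[RHS]mulr1 -bE; ring.
rewrite cE scaler_suml module_loc_sum scaler_sumr; apply: eq_bigr => i _ /=.
rewrite -scalerA -e0P !module_locZ -eP !scalerA -!rmorphM; congr (phi _ *: _).
by ring.
Qed.

Section LocalizedMap.
Variable X : {linear E -> E}.

(** A fraction e/s goes to (X e)/s. If [e] becomes zero in [L], some denominator kills [e], hence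
    kills [X e] as well. *)
Lemma localized_map_exists : exists XL : {linear L -> L},
  forall e, XL (j e) = j (X e).
Proof.
have j0 e : j e = 0 -> j (X e) = 0.
  case: j_loc => _ _ /(_ e) /[apply] -[s Ps se]; apply: (denom_inj Ps).
  by rewrite -module_locZ -linearZ se linear0 module_loc0 scaler0.
have jE e f : j e = j f -> j (X e) = j (X f).
  move=> ef; apply/eqP; rewrite -subr_eq0 -module_locN -module_locD -linearB.
  by apply/eqP/j0; rewrite module_locD module_locN ef subrr.
have /choice [h hP] : forall l, exists l', forall s e,
    s \notin (P : {pred R}) -> phi s *: l = j e -> phi s *: l' = j (X e).
  move=> l; case: j_loc => _ /(_ l) [s Ps [e eE]] _.
  have [b bs] := denom_unit Ps; exists (b *: j (X e)) => t f Pt fE.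
  apply: (denom_inj Ps); rewrite scalerA mulrC -scalerA.
  rewrite [phi s *: (b *: _)]scalerA [phi s * b]mulrC bs scale1r.
  rewrite -!module_locZ -!linearZ; apply: jE.
  by rewrite !module_locZ -eE -fE !scalerA mulrC.
have hD : linear h.
  case: phi_loc => _ frac_of _; case: (j_loc) => _ j_surj _ a l m.
  have [r [s [Ps ar]]] := frac_of a.
  have [t Pt [e eE]] := j_surj l; have [q Pq [f fE]] := j_surj m.
  have Pst : s * t \notin (P : {pred R}) by rewrite prime_idealrM negb_or Ps.
  have Pstq : s * t * q \notin (P : {pred R}) by rewrite prime_idealrM negb_or Pst.
  apply: (denom_inj Pstq).
  rewrite (hP _ _ ((r * q) *: e + (s * t) *: f)) //.
    rewrite linearD !linearZ /= module_locD !module_locZ.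
    rewrite -(hP l t e) // -(hP m q f) // scalerDr !scalerA !rmorphM -ar.
    by congr (_ *: _ + _ *: _); ring.
  rewrite module_locD !module_locZ -eE -fE scalerDr !scalerA !rmorphM -ar.
  by congr (_ *: _ + _ *: _); ring.
exists (mk_linear hD) => e /=.
have P1 : 1 \notin (P : {pred R}) by rewrite idealr1.
have := hP (j e) 1 e P1; rewrite rmorph1 !scale1r; exact.
Qed.

End LocalizedMap.
End LocalizationInjective.

(** * The Koszul complex of three commuting, successively surjective operators *)

Section KoszulResolution.
Variables (A : comNzRingType) (M L : lmodType A).
Variables (eta : {linear M -> L}) (X Y Z : {linear L -> L}).
Hypothesis L_injective : injective_module L.
Hypothesis eta_inj : injective eta.
Hypothesis eta_ker : forall e, [/\ X e = 0, Y e = 0 & Z e = 0] <->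
  exists m, eta m = e.
Hypothesis XY : forall e, X (Y e) = Y (X e).
Hypothesis XZ : forall e, X (Z e) = Z (X e).
Hypothesis YZ : forall e, Y (Z e) = Z (Y e).
Hypothesis X_surj : forall e, exists e', X e' = e.
Hypothesis Y_surj : forall e, X e = 0 -> exists2 e', Y e' = e & X e' = 0.
Hypothesis Z_surj : forall e, X e = 0 -> Y e = 0 ->
  exists2 e', Z e' = e & X e' = 0 /\ Y e' = 0.

Let L3 := (L * (L * L))%type.

Let koszul (i : nat) : lmodType A :=
  match i with
  | 0 => L | 1 => (L3 : lmodType A) | 2 => (L3 : lmodType A) | 3 => L
  | _ => 'rV[A]_0 : lmodType A
  end.

Fact koszul0_lin : linear (fun e => (X e, (Y e, Z e)) : L3).
Proof. by move=> a u v; rewrite !(linearP X, linearP Y, linearP Z). Qed.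

Fact koszul1_lin : linear (fun e : L3 =>
  (Y e.2.2 - Z e.2.1, (Z e.1 - X e.2.2, X e.2.1 - Y e.1)) : L3).
Proof.
move=> a u v; rewrite /= !(linearP X, linearP Y, linearP Z).
by congr (_, (_, _)); rewrite /= opprD addrACA -scalerBr.
Qed.

Fact koszul2_lin : linear (fun e : L3 => X e.1 + Y e.2.1 + Z e.2.2).
Proof.
move=> a u v; rewrite /= !(linearP X, linearP Y, linearP Z) !scalerDr.
by rewrite (addrACA (a *: X _)) [LHS]addrACA.
Qed.

Fact koszul3_lin (U V : lmodType A) : linear ((fun=> 0) : U -> V).
Proof. by move=> a u v; rewrite scaler0 addr0. Qed.

Let koszul_d i : {linear koszul i -> koszul i.+1} :=
  match i return {linear koszul i -> koszul i.+1} with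
  | 0 => mk_linear koszul0_lin
  | 1 => mk_linear koszul1_lin
  | 2 => mk_linear koszul2_lin
  | _ => mk_linear (@koszul3_lin _ _)
  end.

Let XD x y : X (x + y) = X x + X y. Proof. exact: linearD. Qed.
Let YD x y : Y (x + y) = Y x + Y y. Proof. exact: linearD. Qed.
Let ZD x y : Z (x + y) = Z x + Z y. Proof. exact: linearD. Qed.
Let XN x : X (- x) = - X x. Proof. exact: linearN. Qed.
Let YN x : Y (- x) = - Y x. Proof. exact: linearN. Qed.
Let ZN x : Z (- x) = - Z x. Proof. exact: linearN. Qed.

(** The equations are solved one at a time; each correction lies in the kernels of the operators
    already treated. *)
Lemma koszul_exact1 a b c : Y c = Z b -> Z a = X c -> X b = Y a ->
  exists e, [/\ X e = a, Y e = b & Z e = c].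
Proof.
move=> Yc Za Xb; have [e1 e1a] := X_surj a.
have [|e2 e2b Xe2] := Y_surj (e := b - Y e1).
  by rewrite XD XN XY e1a Xb subrr.
have [||e3 e3c [Xe3 Ye3]] := Z_surj (e := c - Z (e1 + e2)).
- by rewrite XD XN XZ XD e1a Xe2 addr0 Za subrr.
- by rewrite YD YN YZ YD e2b addrCA subrr addr0 Yc subrr.
exists (e1 + e2 + e3); split.
- by rewrite !XD e1a Xe2 Xe3 !addr0.
- by rewrite !YD e2b Ye3 addr0 addrCA subrr addr0.
- by rewrite ZD e3c addrCA subrr addr0.
Qed.

(** One may take [p = 0]: surjectivity of [X] gives [q] and [r], and the error left in the first
    component lies in the kernel of [X], where [Y] is surjective. *)
Lemma koszul_exact2 a b c : X a + Y b + Z c = 0 -> exists p q r,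
  [/\ a = Y r - Z q, b = Z p - X r & c = X q - Y p].
Proof.
move=> abc; have [q qc] := X_surj c; have [r rb] := X_surj (- b).
have [|r' r'E Xr'] := Y_surj (e := a - (Y r - Z q)).
  rewrite !(XD, XN, XY, XZ) qc rb YN opprD !opprK -[RHS]abc.
  by rewrite addrA.
exists 0, q, (r + r'); split.
- by rewrite YD r'E addrAC addrC subrK.
- by rewrite linear0 XD rb Xr' addr0 sub0r opprK.
- by rewrite linear0 subr0.
Qed.

Lemma koszul_finite_injective_dimension : finite_injective_dimension M.
Proof.
have L3_inj : injective_module (L3 : lmodType A).
  by do 2!apply: injective_module_prod => //.
exists 3%N, koszul, eta, koszul_d; split=> //.
- case=> [|[|[|[|i]]]] //=.
  by apply: zero_module_injective => x; rewrite thinmx0.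
- move=> e; rewrite -eta_ker /=; split=> [[-> -> ->]|[-> -> ->]] //.
- case=> [|[|[|i]]] /=.
  + move=> [a [b c]] /=; split=> [[/eqP + /eqP + /eqP]|[e [<- <- <-]]].
      rewrite !subr_eq0 => /eqP Yc /eqP Za /eqP Xb.
      by have [e [<- <- <-]] := koszul_exact1 Yc Za Xb; exists e.
    by rewrite YZ XZ XY !subrr.
  + move=> [a [b c]] /=; split=> [/koszul_exact2 [p [q [r [-> -> ->]]]]|].
      by exists (p, (q, r)).
    case=> -[p [q r]] /= [<- <- <-].
    rewrite !(XD, XN, YD, YN, ZD, ZN) XY XZ YZ.
    by rewrite [W in W + _]addrC [W in W + _]addrA subrK addrA subrK subrr.
  + move=> e; split=> // _; have [e' e'E] := X_surj e.
    by exists (e', (0, 0)); rewrite /= !linear0 !addr0.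
  + move=> e; split=> // _; exists 0; exact: esym (thinmx0 (e : 'rV[A]_0)).
- by case=> [|[|[|[|i]]]] // _ x; rewrite thinmx0.
Qed.

End KoszulResolution.

(** * Gorenstein property from a duality over a polynomial ring in three variables *)

Lemma mpoly_linear_extension (k : fieldType) n (W : lmodType k)
    (psi : 'X_{1..n} -> W) :
  exists F : {linear {mpoly k[n]} -> W}, forall m, F 'X_[m] = psi m.
Proof.
pose F (p : {mpoly k[n]}) := \sum_(m <- msupp p) p@_m *: psi m.
have FwE d p : (msize p <= d)%N ->
    F p = \sum_(m : 'X_{1..n < d}) p@_m *: psi m.
  move=> le_pd; set I : subFinType _ := 'X_{1..n < d}.
  rewrite /F (big_mksub I) ?msupp_uniq //=; first last.
    by move=> x /msize_mdeg_lt /leq_trans; apply.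
  rewrite big_rmcond //= => j /memN_msupp_eq0 ->.
  by rewrite scale0r.
have F_lin : linear F.
  move=> c p q; pose_big_enough d.
    rewrite !(FwE d) // scaler_sumr -big_split /=; apply: eq_bigr => m _.
    by rewrite linearP /= scalerDl scalerA.
  by close.
exists (mk_linear F_lin) => m /=.
by rewrite /F msuppX big_seq1 mcoeffX eqxx scale1r.
Qed.

Section DualityGorenstein.
Variables (k : fieldType) (R : comNzRingType) (N : nat).
Local Notation T := {mpoly k[3]}.
Variables (tau : {rmorphism T -> R}) (b : 'I_N -> R) (lam : R -> T).

Definition tau_linear (f : R -> T) : Prop :=
  forall t a a', f (tau t * a + a') = t * f a + f a'.

Hypothesis b_span : forall a, exists c : 'I_N -> T, a = \sum_i tau (c i) * b i.
Hypothesis b_free : forall c : 'I_N -> T,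
  \sum_i tau (c i) * b i = 0 -> forall i, c i = 0.
Hypothesis lam_linear : tau_linear lam.
Hypothesis lam_dual : forall f : R -> T, tau_linear f ->
  exists r, forall a, f a = lam (r * a).

Let kappa : {rmorphism k -> R} := tau \o @mpolyC 3 k.
Local Notation Rk := (restrict_scalars kappa).
Let E := coinduced kappa T.

Let kappaM c p : tau (c *: p) = kappa c * tau p.
Proof. by rewrite /= -mul_mpolyC rmorphM. Qed.

Lemma tau_coordinates : exists co : R -> 'I_N -> T,
  [/\ forall a, a = \sum_i tau (co a i) * b i,
      forall i, tau_linear (co^~ i)
    & forall c i, co (\sum_i tau (c i) * b i) i = c i].
Proof.
have [co coP] := choice b_span.
have coE a c : a = \sum_i tau (c i) * b i -> forall i, co a i = c i.
  move=> aE i; apply/eqP; rewrite -subr_eq0; apply/eqP.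
  apply: (b_free (c := fun i => co a i - c i)).
  under eq_bigr do rewrite rmorphB mulrBl.
  by rewrite sumrB -coP -aE subrr.
exists co; split=> // [i t a a'|c i]; last exact: coE.
apply: (coE _ (fun i => t * co a i + co a' i)).
rewrite {1}(coP a) {1}(coP a') mulr_sumr -big_split; apply: eq_bigr => l _ /=.
by rewrite rmorphD rmorphM mulrDl mulrA.
Qed.

Lemma coind_ext (f h : E) :
  (forall m i, f (tau 'X_[m] * b i : R) = h (tau 'X_[m] * b i : R)) -> f = h.
Proof.
move=> fh; apply: coindP => a; have [c ->] := b_span a.
suff: forall i, f (tau (c i) * b i : R) = h (tau (c i) * b i : R).
  move=> fhi; rewrite (_ : \sum_i _ = \sum_i (tau (c i) * b i : Rk)) //.
  by rewrite !linear_sum; apply: eq_bigr.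
move=> i; rewrite (mpolyE (c i)) rmorph_sum mulr_suml.
rewrite (_ : \sum_(m <- _) _ =
  \sum_(m <- msupp (c i)) ((c i)@_m *: (tau 'X_[m] * b i : Rk) : Rk)).
  by rewrite !linear_sum; apply: eq_bigr => m _; rewrite !linearZ /= fh.
by apply: eq_bigr => m _; rewrite kappaM -mulrA.
Qed.

(** The products [tau 'X_[m] * b i] form a [k]-basis of [R], so a functional can be prescribed
    freely on them. This freedom is what makes the operators [ad i] surjective. *)
Lemma coind_exists (psi : 'X_{1..3} -> 'I_N -> T) :
  exists f : E, forall m i, f (tau 'X_[m] * b i : R) = psi m i.
Proof.
have [co [_ co_lin coK]] := tau_coordinates.
have /choice [G GP] : forall i, exists F : {linear T -> T},
    forall m, F 'X_[m] = psi m i.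
  by move=> i; apply: mpoly_linear_extension (fun m => psi m i).
have f_lin : linear ((fun a => \sum_i G i (co a i)) : Rk -> T).
  move=> c a a'; rewrite scaler_sumr -big_split; apply: eq_bigr => i _ /=.
  by rewrite [co _ _]co_lin -linearP mul_mpolyC.
exists (Coinduced (mk_linear f_lin)) => m i /=.
have -> : tau 'X_[m] * b i = \sum_l tau (if l == i then 'X_[m] else 0) * b l.
  rewrite (bigD1 i) //= eqxx big1 ?addr0 // => l /negPf ->.
  by rewrite rmorph0 mul0r.
rewrite (bigD1 i) //= coK eqxx GP big1 ?addr0 // => l /negPf li.
by rewrite coK li linear0.
Qed.

Definition ad_fun (i : 'I_3) (f : E) (a : R) : T :=
  f (tau 'X_i * a : R) - 'X_i * f a.

Fact ad_linear i (f : E) : linear (ad_fun i f : Rk -> T).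
Proof.
move=> c a a'; rewrite /ad_fun.
have -> : tau 'X_i * (c *: (a : Rk) + a' : Rk)
    = c *: (tau 'X_i * a : Rk) + (tau 'X_i * a' : Rk) :> Rk.
  by rewrite [LHS]mulrDr; congr (_ + _); apply: mulrCA.
rewrite !linearP mulrDr opprD addrACA scalerBr; congr (_ - _ + _).
by rewrite scalerAr.
Qed.

Definition ad_coind i f : E := Coinduced (mk_linear (ad_linear i f)).

Fact ad_coind_linear i : linear (ad_coind i : (E : lmodType R) -> E).
Proof.
move=> r f h; apply: coindP => a.
rewrite coindED coindEZ /= /ad_fun !(coindED, coindEZ) mulrDr opprD addrACA.
by congr (f _ - _ + _); apply: mulrCA.
Qed.

Definition ad i : {linear E -> E} := mk_linear (@ad_coind_linear i).

Lemma adE i f a : ad i f a = f (tau 'X_i * a : R) - 'X_i * f a.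
Proof. by []. Qed.

Lemma adC i l f : ad i (ad l f) = ad l (ad i f).
Proof.
apply: coindP => a; rewrite !adE (mulrCA (tau 'X_l)).
by ring.
Qed.

(* The discrete antiderivative
   F(X_i^s m) = \sum_(j < s) X_i^(s-1-j) f(X_i^j m), for m free of X_i. *)
Lemma ad_surj i (f : E) : exists2 F : E, ad i F = f &
  forall l, l != i -> ad l f = 0 -> ad l F = 0.
Proof.
pose drop (m : 'X_{1..3}) := [multinom (if l == i then 0 else m l)%N | l < 3].
have dropE m : 'X_[m] = 'X_i ^+ m i * 'X_[drop m] :> T.
  rewrite mpolyXn -mpolyXD; congr ('X_[_]); apply/mnmP => l.
  rewrite mnmDE mulmnE mnm1E mnmE eq_sym.
  by case: eqVneq => [->|_]; rewrite ?mul1n ?addn0.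
pose psi (m : 'X_{1..3}) n : T := \sum_(j < m i) 'X_i ^+ (m i - 1 - j)
  * f (tau 'X_i ^+ j * (tau 'X_[drop m] * b n) : R).
have [F FP] := coind_exists psi; exists F => [|l li fl].
  apply: coind_ext => m n; rewrite adE mulrA -rmorphM -mpolyXD !FP /psi.
  have -> : drop (U_(i) + m)%MM = drop m.
    by apply/mnmP => l; rewrite !mnmE eq_sym; case: eqVneq.
  rewrite mnmDE mnm1E eqxx big_ord_recr /= subn1 subnn expr0 mul1r.
  rewrite [W in _ + W - _](_ : _ = f (tau 'X_[m] * b n : R)); last first.
    by rewrite (dropE m) rmorphM rmorphXn mulrA.
  rewrite addrAC mulr_sumr -sumrB big1 ?add0r // => j _.
  rewrite ['X_i * _]mulrA -exprS (_ : (m i - 1 - j).+1 = m i - j)%N ?subrr //.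
  by rewrite -subnDA add1n subnSK.
apply: coind_ext => m n; rewrite adE mulrA -rmorphM -mpolyXD !FP /psi.
rewrite mnmDE mnm1E (negPf li) add0n mulr_sumr.
apply/eqP; rewrite subr_eq0; apply/eqP/eq_bigr => j _.
rewrite [RHS]mulrCA; congr (_ * _).
have /eqP := congr1 (fun g : E => g (tau 'X_i ^+ j * (tau 'X_[drop m] * b n) : R)) fl.
rewrite adE subr_eq0 => /eqP <-; congr (f _).
rewrite [RHS]mulrCA; congr (_ * _); rewrite mulrA -rmorphM -mpolyXD.
congr (tau 'X_[_] * _); apply/mnmP => z; rewrite !mnmE.
by case: (eqVneq z i) => [->|]; rewrite ?(negPf li).
Qed.

Fact lam_coind_linear (r : R) : linear ((fun a => lam (r * a : R)) : Rk -> T).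
Proof.
move=> c a a'; rewrite /GRing.scale /= /restrict_scale /=.
have -> : r * (tau c%:MP * (a : R) + a') = tau c%:MP * (r * a) + r * a' by ring.
by rewrite lam_linear mul_mpolyC.
Qed.

Definition lam_coind r : E := Coinduced (mk_linear (lam_coind_linear r)).

Fact lam_coindD : linear (lam_coind : R^o -> E).
Proof.
move=> r a a'; apply: coindP => c; rewrite coindED coindEZ /=.
rewrite -[RHS](_ : lam (1 * (a * (r * c)) + a' * c) = _).
  by congr lam; rewrite mulrDl mul1r mulrCA mulrA.
by rewrite -(rmorph1 tau) lam_linear mul1r.
Qed.

(** Each coordinate functional of [R] is [lam (s * _)] for some [s], so all coordinates of [r]
    vanish. *)
Lemma lam_coind_inj r : lam_coind r = 0 -> r = 0.
Proof.
move=> r0; have lr a : lam (r * a) = 0.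
  by have := congr1 (fun g : E => g a) r0.
have [co [coP co_lin _]] := tau_coordinates.
rewrite (coP r) big1 // => i _.
have [s sP] := lam_dual (co_lin i).
by rewrite sP (mulrC s) lr rmorph0 mul0r.
Qed.

(** Commuting with each variable gives commuting with monomials, hence linearity over T, and
    [lam_dual] represents such a functional. *)
Lemma lam_coind_ker (e : E) :
  [/\ ad 0 e = 0, ad 1 e = 0 & ad 2 e = 0] -> exists r, e = lam_coind r.
Proof.
move=> [e0 e1 e2].
have eX i a : e (tau 'X_i * a : R) = 'X_i * e a.
  have : ad i e = 0.
    have [->|->|->] // : [\/ i = 0, i = 1 | i = 2].
    case: i => [[|[|[|//]]]] p.
    - by constructor 1; apply: val_inj.
    - by constructor 2; apply: val_inj.
    - by constructor 3; apply: val_inj.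
  by move/(congr1 (fun g : E => g a))/eqP; rewrite adE subr_eq0 => /eqP.
have eXm m a : e (tau 'X_[m] * a : R) = 'X_[m] * e a.
  rewrite mpolyXE_id rmorph_prod; elim/big_rec2: _ a => [|i t s _ IH] a.
    by rewrite !mul1r.
  rewrite -mulrA rmorphXn; elim: (m i) => [|p IHp]; first by rewrite !expr0 !mul1r.
  by rewrite !exprS -mulrA eX IHp !mulrA.
have [|r rP] := lam_dual (f := e); last first.
  by exists r; apply: coindP => a; rewrite rP.
move=> t a a'.
have -> : e (tau t * a + a' : R) = e (tau t * a : R) + e a' by exact: linearD.
congr (_ + _); rewrite {1}(mpolyE t) rmorph_sum mulr_suml.
rewrite (_ : \sum_(m <- _) _ =
  \sum_(m <- msupp t) (t@_m *: (tau 'X_[m] * a : Rk) : Rk)).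
  rewrite linear_sum [in RHS](mpolyE t) mulr_suml; apply: eq_bigr => m _.
  by rewrite linearZ /= eXm scalerAl.
by apply: eq_bigr => m _; rewrite kappaM -mulrA.
Qed.

(** The Koszul hypotheses are verified in the localization by passing to numerators in [E], where
    [ad_surj] and [lam_coind_ker] apply, and dividing again. *)
Lemma gorenstein_of_duality : noetherian R -> gorenstein R.
Proof.
move=> R_noeth; split=> // P A phi phi_loc.
have [L [j j_loc]] := module_localization_exists phi_loc (E : lmodType R).
have L_inj : injective_module L.
  apply/injective_of_baer/(baer_localization phi_loc j_loc R_noeth).
  exact: coinduced_finitely_baer.
have /choice [adL adLP] := fun i => localized_map_exists phi_loc j_loc (ad i).
have j_surj := let: And3 _ H _ := j_loc in H.
have j_ker := let: And3 _ _ H := j_loc in H.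
have loc0 := module_loc0 j_loc.
have locZ := module_locZ j_loc.
have jD := module_locD j_loc.
pose inj := denom_inj phi_loc (L := L).
have notinM s t : s \notin (P : {pred R}) -> t \notin (P : {pred R}) ->
    s * t \notin (P : {pred R}).
  by move=> Ps Pt; rewrite prime_idealrM negb_or Ps.
(* An equation true in the localization holds for the numerator after multiplication by one more
   denominator. *)
have lift_ker i s e l : s \notin (P : {pred R}) -> phi s *: l = j e ->
    adL i l = 0 -> exists u, [/\ u \notin (P : {pred R}),
      phi (u * s) *: l = j (u *: e) & ad i (u *: e) = 0].
  move=> Ps se l0; have [|u Pu uE] := j_ker (ad i e).
    by rewrite -adLP -se linearZ /= l0 scaler0.
  by exists u; rewrite (linearZ_LR (ad i)) uE rmorphM -scalerA se -locZ.
have adZ0 i u e : ad i e = 0 -> ad i (u *: e) = 0.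
  by move=> e0; rewrite linearZ_LR e0 scaler0.
pose l0 := j (lam_coind 1).
have lamZ r : lam_coind r = r *: lam_coind 1.
  have lam0 : lam_coind 0 = 0.
    by have := lam_coindD (-1) 0 0; rewrite scaler0 addr0 scaleN1r addNr.
  by have := lam_coindD r 1 0; rewrite lam0 !addr0 -[r *: 1]/(r * 1) mulr1.
have eta_lin : linear ((fun a => a *: l0) : A^o -> L).
  by move=> a b' c; rewrite scalerDl scalerA.
have ad_lam i r : ad i (lam_coind r) = 0.
  apply: coindP => a; rewrite adE /=; apply/eqP; rewrite subr_eq0; apply/eqP.
  rewrite mulrCA -[tau _ * _]addr0 lam_linear -[RHS]addr0; congr (_ + _).
  by have := lam_linear (-1) 0 0; rewrite mulr0 add0r mulN1r addNr.
(* [S] collects the operators known to annihilate [l]. Enlarging the denominator once for each makes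
   one numerator satisfy all these equations, and [ad_surj] hands them on to the preimage. *)
have surj (S : pred 'I_3) i l : ~~ S i -> (forall m, S m -> adL m l = 0) ->
    exists2 l', adL i l' = l & forall m, S m -> adL m l' = 0.
  move=> Si lS.
  have [s [Ps [e [se eS]]]] : exists s, s \notin (P : {pred R}) /\
      exists e, phi s *: l = j e /\ forall m, S m -> ad m e = 0.
    have [s0 Ps0 [e0 se0]] := j_surj l.
    suff: forall r : seq 'I_3, exists s, s \notin (P : {pred R}) /\
        exists e, phi s *: l = j e /\ forall m, m \in r -> S m -> ad m e = 0.
      move/(_ (enum 'I_3)) => [s [Ps [e [se eS]]]]; exists s; split=> //.
      by exists e; split=> // m; apply: eS; rewrite mem_enum.
    elim=> [|m r [s [Ps [e [se eS]]]]]; first by exists s0; split=> //; exists e0.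
    case Sm : (S m); last first.
      exists s; split=> //; exists e; split=> // z; rewrite inE.
      by case/orP => [/eqP ->|]; [rewrite Sm | apply: eS].
    have [u [Pu ue u0]] := lift_ker m s e l Ps se (lS m Sm).
    exists (u * s); split; first exact: notinM.
    exists (u *: e); split=> // z; rewrite inE => /orP [/eqP -> //|zr Sz].
    exact/adZ0/eS.
  have [F FE F0] := ad_surj i e; have [c cs] := denom_unit phi_loc Ps.
  exists (c *: j F) => [|m Sm]; rewrite linearZ /= adLP.
    by rewrite FE -se scalerA cs scale1r.
  rewrite F0 ?loc0 ?scaler0 //; last exact: eS.
  by apply: contraNneq Si => <-.
have adLC i m l : adL i (adL m l) = adL m (adL i l).
  have [s Ps [e se]] := j_surj l; apply: (inj s) => //.
  by rewrite -!linearZ /= se !adLP adC.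
apply: (@koszul_finite_injective_dimension A A^o L (mk_linear eta_lin)
  (adL 0) (adL 1) (adL 2)) => //.
- apply: raddf_inj => a /= al0.
  have [_ /(_ a) [r [s [Ps rs]]] r_ker] := phi_loc.
  have [|u Pu] := j_ker (lam_coind r).
    by rewrite lamZ locZ -rs mulrC -scalerA al0 scaler0.
  rewrite lamZ scalerA -lamZ => /lam_coind_inj ur0.
  have [d ds] := denom_unit phi_loc (notinM _ _ Pu Ps).
  rewrite -[a]mulr1 -ds mulrCA rmorphM [phi u * _]mulrC [a * _]mulrA rs.
  by rewrite -rmorphM [r * u]mulrC ur0 rmorph0 mulr0.
- move=> l; split=> [[l_0 l_1 l_2] | [a <- /=]]; last first.
    by split; rewrite linearZ /= adLP ad_lam loc0 scaler0.
  have [s Ps [e se]] := j_surj l.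
  have [u [Pu ue u0]] := lift_ker 0 s e l Ps se l_0.
  have [v [Pv ve v0]] := lift_ker 1 _ _ l (notinM _ _ Pu Ps) ue l_1.
  have [w [Pw we w0]] := lift_ker 2 _ _ l (notinM _ _ Pv (notinM _ _ Pu Ps)) ve l_2.
  have [|r rE] := @lam_coind_ker (w *: (v *: (u *: e))).
    by split; [exact/adZ0/adZ0 | exact/adZ0 | exact: w0].
  have [d ds] := denom_unit phi_loc (notinM _ _ Pw (notinM _ _ Pv (notinM _ _ Pu Ps))).
  exists (d * phi r) => /=.
  by rewrite -scalerA -locZ -lamZ -rE -we scalerA ds scale1r.
- by move=> l; have [||l' l'E _] := surj pred0 0 l => //; exists l'.
- move=> l l_0; have [||l' l'E l'0] := surj (pred1 0) 1 l => //.
    by move=> m /eqP ->.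
  by exists l'; rewrite // l'0 /=.
- move=> l l_0 l_1; have [||l' l'E l'0] := surj (pred2 0 1) 2 l => //.
    by move=> m /orP [] /eqP ->.
  by exists l'; rewrite // !l'0 /= ?eqxx ?orbT.
Qed.

End DualityGorenstein.

(** * Hilbert's basis theorem *)

(** Impredicative form of the ideal generated by [s]: membership is used by choosing [J], without
    handling coefficients. *)
Definition ideal_span (R : comNzRingType) (s : seq R) (x : R) : Prop :=
  forall J : R -> Prop, J 0 -> (forall a x y, J x -> J y -> J (a * x + y)) ->
  (forall y, y \in s -> J y) -> J x.

Section IdealSpan.
Variable R : comNzRingType.

Lemma ideal_span0 (s : seq R) : ideal_span s 0. Proof. by []. Qed.

Lemma ideal_spanD (s : seq R) a x y :
  ideal_span s x -> ideal_span s y -> ideal_span s (a * x + y).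
Proof.
by move=> sx sy J J0 JD Js; exact: (JD _ _ _ (sx J J0 JD Js) (sy J J0 JD Js)). Qed.

Lemma ideal_span_mem (s : seq R) x : x \in s -> ideal_span s x.
Proof. by move=> xs J J0 JD; apply. Qed.

Lemma ideal_span_sum (s : seq R) x : ideal_span s x ->
  exists c : 'I_(size s) -> R, x = \sum_i c i * s`_i.
Proof.
move/(_ (fun x => exists c : 'I_(size s) -> R, x = \sum_i c i * s`_i)).
apply; first by exists (fun=> 0); rewrite big1 // => i _; rewrite mul0r.
  move=> a _ _ [c ->] [d ->]; exists (fun i => a * c i + d i).
  by rewrite mulr_sumr -big_split; apply: eq_bigr => i _; rewrite /= mulrDl mulrA.
move=> y ys; have ilt : (index y s < size s)%N by rewrite index_mem.
exists (fun i => (i == Ordinal ilt)%:R).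
rewrite (bigD1 (Ordinal ilt)) //= eqxx mul1r nth_index // big1 ?addr0 //.
by move=> i /negPf ->; rewrite mul0r.
Qed.

Lemma noetherian_spanP : noetherian R <->
  forall I : R -> Prop, I 0 -> (forall a x y, I x -> I y -> I (a * x + y)) ->
  exists s : seq R, (forall y, y \in s -> I y) /\ forall x, I x -> ideal_span s x.
Proof.
split=> [R_noeth I I0 ID|R_fg I I0 ID].
  have [n [s sP]] := noetherian_ideal R_noeth I0 ID.
  exists [seq s i | i : 'I_n]; split=> [_ /mapP [i _ ->]|x /sP [c ->]].
    apply/sP; exists (fun k => (k == i)%:R).
    rewrite (bigD1 i) //= eqxx mul1r big1 ?addr0 // => k /negPf ->.
    by rewrite mul0r.
  elim/big_rec: _ => [|i x' _ ?]; first exact: ideal_span0.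
  by apply: ideal_spanD => //; apply: ideal_span_mem; apply: image_f.
have [|a x y Ix Iy|s [sI Is]] := R_fg (fun x => x \in I); [by [] | exact: ID |].
exists (size s), (fun i => s`_i) => x; split=> [/Is/ideal_span_sum //|[c ->]].
elim/big_rec: _ => // i x' _; apply: ID.
exact/sI/mem_nth.
Qed.

End IdealSpan.

Lemma noetherian_surjective (R S : comNzRingType) (f : {rmorphism R -> S}) :
  (forall y, exists x, f x = y) -> noetherian R -> noetherian S.
Proof.
move=> f_surj /noetherian_spanP R_fg; apply/noetherian_spanP => I I0 ID.
have [||s [sI Is]] := R_fg (fun x => I (f x)).
- by rewrite rmorph0.
- by move=> a x y; rewrite rmorphD rmorphM; apply: ID.
exists (map f s); split=> [_ /mapP [x xs ->]|y]; first exact: sI.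
have [x <-] := f_surj y => /Is xs; apply: (xs (fun x => ideal_span (map f s) (f x))).
- by rewrite rmorph0; apply: ideal_span0.
- by move=> a u v su sv; rewrite rmorphD rmorphM; apply: ideal_spanD.
- by move=> u us; exact: ideal_span_mem (map_f f us).
Qed.

Lemma field_noetherian (k : fieldType) : noetherian k.
Proof.
apply/noetherian_spanP => I I0 ID.
case: (EM (exists2 x, I x & x != 0)) => [[x Ix x0]|nI].
  exists [:: x]; split=> [y|y _]; first by rewrite inE => /eqP ->.
  rewrite -[y](mulfVK x0) -[y / x * x]addr0; apply: ideal_spanD => //.
  by apply: ideal_span_mem; rewrite inE.
exists [::]; split=> // x Ix; case: (eqVneq x 0) => [->|x0] //.
by case: nI; exists x.
Qed.

Theorem noetherian_poly (R : comNzRingType) : noetherian R -> noetherian {poly R}.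
Proof.
move=> /noetherian_spanP R_fg; apply/noetherian_spanP => I I0 ID.
have IM a p : I p -> I (a * p) by move=> Ip; rewrite -[a * p]addr0; apply: ID.
(* [a] may be zero, and [d] is only a bound on the degree of [p]; with this convention the possible
   [a] form an ideal for each [d]. *)
pose lift d a p := [/\ I p, (size p <= d.+1)%N & p`_d = a].
have lift0 d : lift d 0 0 by split; rewrite ?size_poly0 ?coef0.
have liftD d a x y p q : lift d x p -> lift d y q ->
    lift d (a * x + y) (a%:P * p + q).
  move=> [Ip sp <-] [Iq sq <-]; split; first exact: ID.
    rewrite (leq_trans (size_polyD _ _)) // geq_max sq andbT.
    by rewrite mul_polyC (leq_trans (size_scale_leq _ _)).
  by rewrite coefD coefCM.
have liftX d e a p : lift d a p -> lift (e + d)%N a ('X^e * p).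
  move=> [Ip sp <-]; split; first exact: IM.
    have [->|p0] := eqVneq p 0; first by rewrite mulr0 size_poly0.
    by rewrite mulrC size_mulXn // -addnS leq_add2l.
  by rewrite coefXnM ltnNge leq_addr addKn.
have /choice [s sP] : forall d, exists s : seq R,
    (forall a, a \in s -> exists p, lift d a p) /\
    forall a p, lift d a p -> ideal_span s a.
  move=> d; have [||s [sI Is]] := R_fg (fun a => exists p, lift d a p).
  - by exists 0.
  - by move=> a x y [p xp] [q yq]; exists (a%:P * p + q); apply: liftD.
  by exists s; split=> // a p ap; apply: Is; exists p.
have [||s' [s'I Is']] := R_fg (fun a => exists d p, lift d a p).
- by exists 0%N, 0.
- move=> a x y [d [p xp]] [e [q yq]].
  exists (e + d)%N, (a%:P * ('X^e * p) + 'X^d * q).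
  by apply: liftD; [apply: liftX | rewrite addnC; apply: liftX].
have /choice [P PP] : forall da : nat * R, exists p, forall q,
    lift da.1 da.2 q -> lift da.1 da.2 p.
  move=> [d a]; case: (EM (exists p, lift d a p)) => [[p ap]|na].
    by exists p.
  by exists 0 => q aq; case: na; exists q.
have {}PP d a q : lift d a q -> lift d a (P (d, a)) by move/(PP (d, a)).
have /choice [e eP] : forall a, exists d, forall d' p, lift d' a p ->
    exists q, lift d a q.
  move=> a; case: (EM (exists d p, lift d a p)) => [[d [p ap]]|na].
    by exists d => _ _ _; exists p.
  by exists 0%N => d p ap; case: na; exists d, p.
(* From degree [D] on, shifts of finitely many polynomials realize all leading coefficients; each of
   the finitely many smaller degrees contributes its own generators. *)
pose D := \max_(a <- s') e a.
pose G := [seq P (e a, a) | a <- s'] ++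
  flatten [seq [seq P (d, a) | a <- s d] | d <- iota 0 D].
have GI p : p \in G -> I p.
  rewrite mem_cat => /orP [/mapP [a /s'I [d [q aq]] ->]|].
    by have [q' /PP []] := eP _ _ _ aq.
  case/flattenP => _ /mapP [d _ ->] /mapP [a ad ->].
  by have [/(_ a ad) [q /PP []]] := sP d.
have top d a p : lift d a p -> exists q, ideal_span G q /\ lift d a q.
  move=> ap; pose J c := exists q, ideal_span G q /\ lift d c q.
  have J0 : J 0 by exists 0; split; [exact: ideal_span0 | exact: lift0].
  have JD c x y : J x -> J y -> J (c * x + y).
    move=> [q [Gq xq]] [r [Gr yr]]; exists (c%:P * q + r).
    by split; [exact: ideal_spanD | exact: liftD].
  case: (ltnP d D) => dD.
    have [sI sG] := sP d.
    apply: (sG a p ap J) => //; move=> c cs; have [q /PP cP] := sI c cs;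
      exists (P (d, c)); split=> //.
    apply: ideal_span_mem; rewrite mem_cat; apply/orP; right.
    apply/flattenP; exists [seq P (d, a) | a <- s d]; last by apply/mapP; exists c.
    by apply/mapP; exists d; rewrite // mem_iota.
  apply: (Is' a (ex_intro _ d (ex_intro _ p ap)) J) => //; move=> c cs;
    have [d' [q cq]] := s'I c cs.
  have [q' /PP cP] := eP _ _ _ cq.
  have ecd : (e c <= d)%N by rewrite (leq_trans _ dD) // leq_bigmax_seq.
  exists ('X^(d - e c) * P (e c, c)); split; last first.
    by have := liftX _ (d - e c)%N _ _ cP; rewrite subnK.
  rewrite -[_ * _]addr0; apply: ideal_spanD; last exact: ideal_span0.
  apply: ideal_span_mem; rewrite mem_cat; apply/orP; left.
  by apply/mapP; exists c.
exists G; split=> // p.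
have [n] := ubnP (size p); elim: n p => // n IHn p; rewrite ltnS => sp Ip.
have [->|p0] := eqVneq p 0; first exact: ideal_span0.
have [|q [Gq [Iq sq qp]]] := top (size p).-1 (lead_coef p) p.
  by split=> //; rewrite prednK // size_poly_gt0.
have : ideal_span G (p - q).
  apply: IHn; last by rewrite -[p - q]addrC -mulN1r; apply: ID.
  apply: leq_trans sp; rewrite ltnNge; apply/negP => spq.
  move: sq qp; rewrite prednK ?size_poly_gt0 // => sq qp.
  have s_le : (size (p - q)%R <= size p)%N.
    by rewrite (leq_trans (size_polyD _ _)) // size_polyN geq_max leqnn.
  have : lead_coef (p - q) = 0.
    have sE : size (p - q) = size p by apply/eqP; rewrite eqn_leq s_le.
    by rewrite lead_coefE sE coefB qp lead_coefE subrr.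
  move/eqP; rewrite lead_coef_eq0 -size_poly_eq0 => /eqP s0.
  by move: spq; rewrite s0 leqn0 size_poly_eq0 (negPf p0).
move=> Gpq; rewrite -[p](subrK q) -[p - q]mul1r.
exact: ideal_spanD.
Qed.

Lemma mpoly_ring_ind (R : comNzRingType) n (Q : {mpoly R[n]} -> Prop) :
    (forall c, Q c%:MP) -> (forall i, Q 'X_i) ->
    (forall p q, Q p -> Q q -> Q (p + q)) ->
    (forall p q, Q p -> Q q -> Q (p * q)) ->
  forall p, Q p.
Proof.
move=> QC QX QD QM p; rewrite (mpolyE p).
elim/big_rec: _ => [|m x _ Qx]; first by rewrite -mpolyC0.
apply: (QD) => //; rewrite -mul_mpolyC; apply: (QM) => //.
rewrite mpolyXE_id; elim/big_rec: _ => [|i y _ Qy]; first by rewrite -mpolyC1.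
apply: (QM) => //; elim: (m i) => [|e IHe]; first by rewrite expr0 -mpolyC1.
by rewrite exprS; apply: (QM).
Qed.

Theorem noetherian_mpoly (R : comNzRingType) n :
  noetherian R -> noetherian {mpoly R[n]}.
Proof.
move=> R_noeth; elim: n => [|n IHn].
  apply: (noetherian_surjective (f := @mpolyC 0 R)) R_noeth => p.
  exists p@_0; apply/mpolyP => m; rewrite mcoeffC.
  have -> : m = 0%MM by apply/mnmP => -[].
  by rewrite eqxx mulr1.
have cX : commr_rmorph (@mwiden n R) 'X_ord_max by move=> p; apply: mulrC.
apply: (noetherian_surjective (f := horner_morph cX)); last exact: noetherian_poly.
move=> p; elim/mpoly_ring_ind: p => [c|i|p q [p' <-] [q' <-]|p q [p' <-] [q' <-]].
- exists (c%:MP)%:P; rewrite /= horner_morphC; exact: mwidenC.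
- case: (unliftP ord_max i) => [l ->|->]; last first.
    by exists 'X; rewrite /= horner_morphX.
  exists ('X_l)%:P; rewrite /= horner_morphC [LHS]mwidenX mnmwiden1.
  by congr 'X_[U_(_)]; apply: val_inj; rewrite /= /bump leqNgt ltn_ord.
- by exists (p' + q'); rewrite rmorphD.
- by exists (p' * q'); rewrite rmorphM.
Qed.

(** * Homogeneous components in integer degrees *)

Section HomogeneousDegree.
Variables (k : fieldType) (n : nat).
Local Notation S := {mpoly k[n]}.

Lemma in_hdegree0 (d : int) : in_hdegree d (0 : S).
Proof. by case: d => [m|m] /=; rewrite ?eqxx ?dhomog0. Qed.

Lemma in_hdegreeD (d : int) (p q : S) :
  in_hdegree d p -> in_hdegree d q -> in_hdegree d (p + q).
Proof.
case: d => [m|m] /=; first exact: dhomogD.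
by move=> /eqP -> /eqP ->; rewrite addr0.
Qed.

Lemma in_hdegreeN (d : int) (p : S) : in_hdegree d p -> in_hdegree d (- p).
Proof.
by case: d => [m|m] /=; rewrite ?oppr_eq0 // dhomogN.
Qed.

Lemma in_hdegreeM (d e : int) (p q : S) :
  in_hdegree d p -> in_hdegree e q -> in_hdegree (d + e) (p * q).
Proof.
case: d => [d|d] /=; last by move=> /eqP ->; rewrite mul0r in_hdegree0.
case: e => [e|e] /=; last by move=> _ /eqP ->; rewrite mulr0 in_hdegree0.
exact: dhomogM.
Qed.

Lemma in_hdegree_sum (d : int) I (s : seq I) (F : I -> S) :
  (forall i, in_hdegree d (F i)) -> in_hdegree d (\sum_(i <- s) F i).
Proof.
move=> Fd; elim/big_rec: _ => [|i x _ xd]; first exact: in_hdegree0.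
exact: in_hdegreeD.
Qed.

(** Defined for every integer degree, with value zero in negative ones, so that shifts by degrees of
    generators need no case distinction. *)
Definition hproj (d : int) (p : S) : S := if d is Posz m then pihomog mdeg m p else 0.

Lemma hprojP d p : in_hdegree d (hproj d p).
Proof. by case: d => m //=; apply: pihomogP. Qed.

Lemma hproj_id d p : in_hdegree d p -> hproj d p = p.
Proof. by case: d => m /=; [apply: pihomog_dE | move/eqP ->]. Qed.

Lemma hprojD d p q : hproj d (p + q) = hproj d p + hproj d q.
Proof. by case: d => m /=; rewrite ?linearD ?addr0. Qed.

Lemma hprojN d p : hproj d (- p) = - hproj d p.
Proof. by case: d => m /=; rewrite ?linearN ?oppr0. Qed.

Lemma hproj0 d : hproj d 0 = 0.
Proof. by case: d => m /=; rewrite ?linear0. Qed.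

Lemma hproj_sum d I (s : seq I) (F : I -> S) :
  hproj d (\sum_(i <- s) F i) = \sum_(i <- s) hproj d (F i).
Proof.
by elim/big_rec2: _ => [|i x y _ <-]; rewrite ?hproj0 ?hprojD.
Qed.

Lemma hproj_neq (d e : int) p : in_hdegree d p -> d != e -> hproj e p = 0.
Proof.
case: e => [e|e] //=; case: d => [d|d] /= => [pd de|/eqP -> _]; last exact: linear0.
by rewrite (pihomog_ne0 _ pd).
Qed.

Lemma mpoly_homog_decomp (p : S) : p = \sum_(d < msize p) hproj d p.
Proof. exact: (pihomog_partitionE (leqnn (msize p))). Qed.

Lemma hprojM (d e : int) p q : in_hdegree d p ->
  hproj (d + e) (p * q) = p * hproj e q.
Proof.
move=> pd; rewrite {1}(mpoly_homog_decomp q) mulr_sumr hproj_sum.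
have [[m em]|ne] : (exists m : nat, e = m) \/ hproj e q = 0.
- by case: (e) => m; [left; exists m | right].
- rewrite em; transitivity (\sum_(i < msize q) if i == m :> nat then p * hproj m q else 0).
    apply: eq_bigr => i _; have piq := in_hdegreeM pd (hprojP i q).
    case: eqP => [<-|/eqP im]; first by rewrite hproj_id.
    by rewrite (hproj_neq piq) // (inj_eq (addrI d)).
  case: (ltnP m (msize q)) => mq.
    by rewrite -big_mkcond (big_pred1 (Ordinal mq)).
  rewrite big1 => [|i _]; last first.
    by case: eqP => // im; move: (ltn_ord i); rewrite im ltnNge mq.
  rewrite /= pihomogE big1_seq ?mulr0 // => mm /andP[/eqP mmE] /msize_mdeg_lt.
  by rewrite mmE ltnNge mq.
- rewrite ne mulr0; apply: big1 => i _; have piq := in_hdegreeM pd (hprojP i q).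
  case: (eqVneq (i : int) e) => [ie|ie]; last first.
    by rewrite (hproj_neq piq) // (inj_eq (addrI d)).
  by rewrite ie ne mulr0 hproj0.
Qed.

End HomogeneousDegree.

(** * Regularity from the reduction modulo linear forms *)

Section RegularityOfResolution.
Variables (k : fieldType) (n : nat) (R : comNzRingType).
Local Notation S := {mpoly k[n]}.
Variable pi : {rmorphism S -> R}.
(* [rho m] is a homogeneous ring endomorphism whose kernel is generated by the
   regular sequence l_0, ..., l_(m-1) of linear forms. *)
Variables (l : nat -> S) (rho : nat -> {rmorphism S -> S}).
Hypothesis l_linear : forall m, (m < n)%N -> l m \is 1.-homog.
Hypothesis rho_homog : forall m d p, p \is d.-homog -> rho m p \is d.-homog.
Hypothesis rho_0 : forall p, rho 0 p = 0 -> p = 0.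
Hypothesis rho_S : forall m p, rho m p = 0 -> rho m.+1 p = 0.
Hypothesis rho_l : forall m, (m < n)%N -> rho m.+1 (l m) = 0.
Hypothesis rho_div : forall m p, (m < n)%N -> rho m.+1 p = 0 ->
  exists w, rho m (p - l m * w) = 0.
Hypothesis rho_regular : forall m p, (m < n)%N -> rho m (l m * p) = 0 -> rho m p = 0.
Hypothesis rho_n : forall p, rho n p = 0 <-> p@_0 = 0.

(** The ideal of [R] generated by the images of the first [m] linear forms. *)
Let J m (r : R) : Prop := exists2 p, pi p = r & rho m p = 0.
Hypothesis J_regular : forall m r, (m < 3)%N -> J m (pi (l m) * r) -> J m r.
Hypothesis n_ge3 : (3 <= n)%N.
Hypothesis J_degree : forall d p, (4 <= d)%N -> p \is d.-homog -> J 3 (pi p).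

Let JD m a r s : J m r -> J m s -> J m (pi a * r + s).
Proof.
move=> [p <- p0] [q <- q0]; exists (a * p + q); first by rewrite rmorphD rmorphM.
by rewrite rmorphD rmorphM p0 q0 mulr0 addr0.
Qed.

Let J0 m : J m 0. Proof. by exists 0; rewrite rmorph0. Qed.

Let JN m r : J m r -> J m (- r).
Proof. by move=> /(JD (-1)) /(_ (J0 m)); rewrite rmorphN1 mulN1r addr0. Qed.

Section FixedResolution.
Variable F : graded_free_resolution pi.

Let vec i := 'rV[S]_(grank F i).
Let del i (v : vec i.+1) : vec i := v *m gdiff F i.
Let hv i (d : int) (v : vec i) : Prop := forall a, in_hdegree (d - gdeg a) (v 0 a).
Let vproj i (d : int) (v : vec i) : vec i := \row_a hproj (d - gdeg a) (v 0 a).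
(** Expresses that [v] is zero in F_i / (l_0, ..., l_(m-1)) F_i; homology of the reduced complexes
    is treated through lifts to F_i, without quotient modules. *)
Let vanish m i (v : vec i) : Prop := forall a, rho m (v 0 a) = 0.
Let aug (v : vec 0) : R := (map_mx pi v *m gaug F) 0 0.

Let delD i (v w : vec i.+1) : del (v + w) = del v + del w.
Proof. exact: mulmxDl. Qed.
Let delN i (v : vec i.+1) : del (- v) = - del v.
Proof. exact: mulNmx. Qed.
Let delB i (v w : vec i.+1) : del (v - w) = del v - del w.
Proof. by rewrite delD delN. Qed.
Let delZ i (p : S) (v : vec i.+1) : del (p *: v) = p *: del v.
Proof. by rewrite /del -scalemxAl. Qed.
Let del_del i (v : vec i.+2) : del (del v) = 0.
Proof. by apply/gexact; exists v. Qed.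
Let aug_del (v : vec 1) : aug (del v) = 0.
Proof. by rewrite /aug (_ : _ *m _ = 0) ?mxE //; apply/gexact0; exists v. Qed.

Let augE v : aug v = \sum_a pi (v 0 a) * gaug F a 0.
Proof. by rewrite /aug mxE; apply: eq_bigr => a _; rewrite mxE. Qed.

Let augD v w : aug (v + w) = aug v + aug w.
Proof. by rewrite /aug map_mxD mulmxDl mxE. Qed.
Let augZ p v : aug (p *: v) = pi p * aug v.
Proof. by rewrite /aug map_mxZ -scalemxAl mxE. Qed.
Let augN v : aug (- v) = - aug v.
Proof. by rewrite -scaleN1r augZ rmorphN1 mulN1r. Qed.

Let vanishD m i (v w : vec i) : vanish m v -> vanish m w -> vanish m (v + w).
Proof. by move=> v0 w0 a; rewrite mxE rmorphD v0 w0 addr0. Qed.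
Let vanishN m i (v : vec i) : vanish m v -> vanish m (- v).
Proof. by move=> v0 a; rewrite mxE rmorphN v0 oppr0. Qed.
Let vanishZ m i p (v : vec i) : vanish m v -> vanish m (p *: v).
Proof. by move=> v0 a; rewrite mxE rmorphM v0 mulr0. Qed.
Let vanishB m i (v w : vec i) : vanish m v -> vanish m w -> vanish m (v - w).
Proof. by move=> v0 w0; apply/vanishD/vanishN. Qed.
Let vanish_del m i (v : vec i.+1) : vanish m v -> vanish m (del v).
Proof.
move=> v0 a; rewrite mxE rmorph_sum big1 // => b _.
by rewrite rmorphM v0 mul0r.
Qed.
Let vanishS m i (v : vec i) : vanish m v -> vanish m.+1 v.
Proof. by move=> v0 a; apply: rho_S. Qed.
Let vanish_l m i (v : vec i) : (m < n)%N -> vanish m.+1 (l m *: v).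
Proof. by move=> mn a; rewrite mxE rmorphM rho_l // mul0r. Qed.
Let vanish_regular m i (v : vec i) : (m < n)%N -> vanish m (l m *: v) -> vanish m v.
Proof. by move=> mn v0 a; apply: rho_regular => //; have := v0 a; rewrite mxE. Qed.
Let vanish_div m i (v : vec i) : (m < n)%N -> vanish m.+1 v ->
  exists w : vec i, vanish m (v - l m *: w).
Proof.
move=> mn v0.
have /choice [w wP] a : exists w, rho m (v 0 a - l m * w) = 0 by apply: rho_div.
by exists (\row_a w a) => a; rewrite !mxE.
Qed.
Let vanish_aug m v : vanish m v -> J m (aug v).
Proof.
move=> v0; rewrite augE; elim/big_rec: _ => [|a x _ Jx]; first exact: J0.
by rewrite mulrC; have [p _ <-] := gaug_homog a; apply: JD => //; exists (v 0 a).
Qed.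

Let rho_hproj m d p : rho m (hproj d p) = hproj d (rho m p).
Proof.
rewrite {2}(mpoly_homog_decomp p) rmorph_sum hproj_sum.
have hr (i : nat) : in_hdegree i (rho m (hproj i p)).
  exact/rho_homog/(hprojP i p).
case: d => [d|d] /=; last by rewrite rmorph0 big1.
case: (ltnP d (msize p)) => dp.
  rewrite (bigD1 (Ordinal dp)) //= [pihomog _ d (rho m _)]pihomog_dE; last exact: hr.
  rewrite big1 ?addr0 // => i id.
  exact: (hproj_neq (e := d) (hr i)).
rewrite big1 => [|i _]; last first.
  apply: (hproj_neq (e := d) (hr i)); rewrite eqz_nat;
    apply: contraTneq (ltn_ord i) => ->.
  by rewrite -leqNgt.
rewrite pihomogE big1_seq ?rmorph0 // => mm /andP[/eqP mmE] /msize_mdeg_lt.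
by rewrite mmE ltnNge dp.
Qed.

Let hvB i d (v w : vec i) : hv d v -> hv d w -> hv d (v - w).
Proof. by move=> hvv hvw a; rewrite !mxE; apply/in_hdegreeD/in_hdegreeN. Qed.
Let hv_l m i (d : int) (v : vec i) : (m < n)%N -> hv d v -> hv (d + 1) (l m *: v).
Proof.
move=> mn hvv a; rewrite mxE [d + 1]addrC -addrA; apply: in_hdegreeM => //.
exact: l_linear.
Qed.
Let hv_del i d (v : vec i.+1) : hv d v -> hv d (del v).
Proof.
move=> hvv a; rewrite mxE; apply: in_hdegree_sum => b.
by rewrite -[d - _](subrKA (gdeg b)); apply: in_hdegreeM => //; apply: gdiff_homog.
Qed.
Let vprojP i d (v : vec i) : hv d (vproj d v).
Proof. by move=> a; rewrite mxE; apply: hprojP. Qed.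
Let vproj_id i d (v : vec i) : hv d v -> vproj d v = v.
Proof. by move=> hvv; apply/rowP => a; rewrite mxE hproj_id. Qed.
Let vproj_del i d (v : vec i.+1) : vproj d (del v) = del (vproj d v).
Proof.
apply/rowP => a; rewrite !mxE hproj_sum; apply: eq_bigr => b _.
rewrite mxE mulrC [RHS]mulrC -[d - _](subrKA (gdeg b)) addrC hprojM //.
exact: gdiff_homog.
Qed.
Let vprojB i d (v w : vec i) : vproj d (v - w) = vproj d v - vproj d w.
Proof. by apply/rowP => a; rewrite !mxE hprojD hprojN. Qed.
Let vproj_l m i (d : int) (v : vec i) : (m < n)%N ->
  vproj (d + 1) (l m *: v) = l m *: vproj d v.
Proof.
move=> mn; apply/rowP => a; rewrite !mxE [d + 1]addrC -addrA hprojM //.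
exact: l_linear.
Qed.
Let vanish_vproj m i d (v : vec i) : vanish m v -> vanish m (vproj d v).
Proof. by move=> v0 a; rewrite mxE rho_hproj v0 hproj0. Qed.

Let cycle m i : vec i -> Prop :=
  match i with 0 => fun=> True | i'.+1 => fun v => vanish m (del v) end.

(** With [u] lifting 1, the vectors [v] and [p *: u] have the same image in [R], so they differ by a
    boundary, and [p *: u] vanishes modulo the forms. *)
Lemma lift_boundary0 m (v : vec 0) : J m (aug v) -> exists y, vanish m (v - del y).
Proof.
case=> p pE p0; have [u uE] := gaug_surj F 1.
have augu : aug u = 1 by rewrite /aug uE mxE.
have : map_mx pi (v - p *: u) *m gaug F = 0.
  apply/matrixP => i j; rewrite !ord1 [RHS]mxE -/(aug _).
  by rewrite augD augN augZ augu mulr1 pE subrr.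
move/gexact0 => [y yE]; exists y; rewrite /del yE opprB addrC subrK => a.
by rewrite mxE rmorphM p0 mul0r.
Qed.

(** Write [del v] as l_m w modulo the earlier forms. Regularity makes [w] a cycle, or puts its
    augmentation into [J m] when [w] lies in F_0, so [w] is the boundary of some [y]; then v - l_m y
    is a cycle modulo [m] forms, where induction applies. *)
Lemma exact_mod_regular m : (m <= 3)%N -> forall i (v : vec i.+1),
  vanish m (del v) -> exists y, vanish m (v - del y).
Proof.
elim: m => [|m IHm] m3 i v v0.
  have /gexact [y yE] : del v = 0.
    by apply/rowP => a; rewrite [RHS]mxE; apply: rho_0 (v0 a).
  by exists y; rewrite /del yE subrr => a; rewrite mxE rmorph0.
have mn : (m < n)%N := leq_trans m3 n_ge3.
have [w wP] := vanish_div mn v0.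
have [y yP] : exists y, vanish m (w - del y).
  case: i v w v0 wP => [|i] v w v0 wP.
    apply/lift_boundary0/J_regular => //; rewrite -augZ.
    have /JN := vanish_aug wP.
    by rewrite augD augN aug_del sub0r opprK.
  apply: (IHm (ltnW m3)).
  apply: vanish_regular mn _; have /vanishN := vanish_del wP.
  by rewrite delB del_del sub0r opprK delZ.
have [|y' y'P] := IHm (ltnW m3) i (v - l m *: y).
  rewrite delB delZ.
  have -> : del v - l m *: del y = (del v - l m *: w) + l m *: (w - del y).
    by rewrite scalerBr addrA subrK.
  exact/vanishD/vanishZ.
exists y'; have -> : v - del y' = (v - l m *: y - del y') + l m *: y.
  by rewrite [RHS]addrAC subrK.
by apply/vanishD/vanish_l => //; apply: vanishS.
Qed.

(** In the exact sequence of multiplication by l_m, homology modulo m+1 forms at (i, d) sits between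
    homology modulo m forms at (i, d) and at (i-1, d-1); the inequality i + 3 < d passes to both. *)
Lemma upper_bound m : (3 <= m <= n)%N -> forall i (d : int) (v : vec i),
  (i%:Z + 3 < d)%R -> hv d v -> cycle m v ->
  exists2 y, hv d y & vanish m (v - del y).
Proof.
elim: m => // m IHm /andP[m3 mn] i d v id hvv v0.
have proj (w : vec i) m' : hv d w -> (exists y, vanish m' (w - del y)) ->
    exists2 y, hv d y & vanish m' (w - del y).
  move=> hw [y yP]; exists (vproj d y); first exact: vprojP.
  by rewrite -vproj_del -(vproj_id hw) -vprojB; apply: vanish_vproj.
case: (ltnP 2 m) => m2; last first.
  (* The base of the induction, with three forms: the reduced complex resolves a quotient of [R]
     that is zero from degree 4 on. *)
  have m2E : m = 2 by apply/eqP; rewrite eqn_leq m2.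
  apply: proj => //; rewrite m2E in v0 *; case: i v id hvv v0 => [|i] v id hvv v0.
    apply: lift_boundary0.
    case: d id hvv => // d id hvv.
    have [p pP] := choice (fun a => let: ex_intro2 p pd pE := gaug_homog a in
       ex_intro (fun p => in_hdegree (gdeg a) p /\ pi p = gaug F a 0) p (conj pd pE)).
    have -> : aug v = pi (\sum_a v 0 a * p a).
      by rewrite augE rmorph_sum; apply: eq_bigr => a _; rewrite rmorphM (pP a).2.
    apply: (J_degree (d := d)) => //.
    have : in_hdegree d (\sum_a v 0 a * p a).
      apply: in_hdegree_sum => a; rewrite -[d : int](subrK (gdeg a)).
      by apply: in_hdegreeM => //; case: (pP a).
    by [].
  exact: exact_mod_regular v0.
have {}IHm := IHm (introT andP (conj m2 (ltnW mn))).
case: i v id hvv v0 proj => [|i] v id hvv v0 proj.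
  have [y hy yP] := IHm 0%N d v id hvv I.
  by exists y => //; apply: vanishS.
have [w0 w0P] := vanish_div mn v0.
pose w := vproj (d - 1) w0.
have wP : vanish m (del v - l m *: w).
  rewrite /w -vproj_l // subrK -[del v](vproj_id (d := d)); last exact: hv_del.
  by rewrite -vprojB; apply: vanish_vproj.
have [||y hy yP] := IHm i (d - 1) w _ (vprojP _ _).
- by rewrite ltrBrDr -addrA [3 + 1]addrC addrA -[i%:Z + 1]/(i + 1)%:Z addn1.
- case: i v w0 w id hvv v0 proj w0P wP => [|i] v w0 w id hvv v0 proj w0P wP //=.
  apply: vanish_regular mn _; have /vanishN := vanish_del wP.
  by rewrite delB del_del sub0r opprK delZ.
have [||y' hy' y'P] := IHm i.+1 d (v - l m *: y) id.
- by apply: hvB => //; rewrite -[d](subrK 1); apply: hv_l.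
- rewrite /= delB delZ.
  have -> : del v - l m *: del y = (del v - l m *: w) + l m *: (w - del y).
    by rewrite scalerBr addrA subrK.
  exact/vanishD/vanishZ.
exists y' => //; have -> : v - del y' = (v - l m *: y - del y') + l m *: y.
  by rewrite [RHS]addrAC subrK.
by apply/vanishD/vanish_l => //; apply: vanishS.
Qed.

(** Vanishing of homology modulo [m] forms in the extreme degrees i + 3, the last ones that
    [upper_bound] leaves open. *)
Definition no_syzygy_in_regularity m : Prop :=
  forall i (v : vec i), hv (i%:Z + 3) v -> cycle m v ->
  exists y, vanish m (v - del y).

(** By [upper_bound], l_m v is the boundary of some [y] modulo [m] forms. Modulo one more form [y]
    is a cycle of index i+1 in its own extreme degree, so it equals del w + l_m u; cancelling l_m
    exhibits [v] as the boundary of [u]. *)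
Lemma descend_regularity m : (3 <= m < n)%N ->
  no_syzygy_in_regularity m.+1 -> no_syzygy_in_regularity m.
Proof.
move=> /andP[m3 mn] Z i v hvv v0.
have [||||y hy yP] := @upper_bound m _ i (i%:Z + 3 + 1) (l m *: v).
- by rewrite m3 ltnW.
- by rewrite ltrDl.
- exact: hv_l.
- by case: i v hvv v0 => [|i] v hvv v0 //=; rewrite delZ; apply: vanishZ.
have [||w wP] := Z i.+1 y.
- have -> : i.+1%:Z + 3 = i%:Z + 3 + 1 by rewrite -addn1 PoszD addrAC.
  exact: hy.
- rewrite /=; have -> : del y = l m *: v - (l m *: v - del y) by rewrite opprB addrC subrK.
  by apply/vanishB/vanishS => //; apply: vanish_l.
have [u uP] := vanish_div mn wP.
exists u; apply: vanish_regular mn _.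
have -> : l m *: (v - del u) = (l m *: v - del y) + del (y - del w - l m *: u).
  by rewrite !delB del_del subr0 delZ addrA subrK scalerBr.
by apply/vanishD/vanish_del.
Qed.

Let const i (v : 'rV[k]_(grank F i)) : vec i := map_mx (@mpolyC n k) v.
Let at0 i (v : vec i) : 'rV[k]_(grank F i) := map_mx (mcoeff 0%MM) v.

Let hv_const i d (v : 'rV[k]_(grank F i)) : in_degree d v -> hv d (const v).
Proof.
move=> vd a; rewrite mxE; have [->|/vd ->] := eqVneq (v 0 a) 0.
  by rewrite mpolyC0 in_hdegree0.
by rewrite subrr -[_%:MP]mulr1 mul_mpolyC; apply/dhomogZ/dhomog1.
Qed.

Let in_degree_at0 i d (v : vec i) : hv d v -> in_degree d (at0 v).
Proof.
move=> hvv a; rewrite mxE => va0; have := hvv a; case dE : (d - gdeg a) => [e|e] /=.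
  move/dhomogP => /(_ 0%MM); rewrite mcoeff_msupp va0 => /(_ isT); rewrite mf0 => e0.
  by apply/eqP; rewrite eq_sym -subr_eq0 dE -e0.
by move=> /eqP va; rewrite va mcoeff0 eqxx in va0.
Qed.

Let vanish_n i (v : vec i) : vanish n v <-> at0 v = 0.
Proof.
split=> [v0|/rowP v0 a]; last by apply/rho_n; have := v0 a; rewrite !mxE.
by apply/rowP => a; rewrite !mxE; apply/rho_n.
Qed.

Let at0_const i (v : 'rV[k]_(grank F i)) : at0 (const v) = v.
Proof. by apply/rowP => a; rewrite !mxE mcoeffC eqxx mulr1. Qed.

Let at0_del i (v : vec i.+1) : at0 (del v) = at0 v *m tdiff F i.
Proof.
apply/rowP => a; rewrite !mxE rmorph_sum; apply: eq_bigr => b _.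
by rewrite rmorphM !mxE.
Qed.

Let at0B i (v w : vec i) : at0 (v - w) = at0 v - at0 w.
Proof. by apply/rowP => a; rewrite !mxE rmorphB. Qed.

Lemma tor_class_degree i (d : int) (v : 'rV[k]_(grank F i)) :
  in_degree d v -> tcycle v -> ~ tboundary d v -> (d <= i%:Z + 3)%R.
Proof.
move=> vd vcyc nbd; rewrite leNgt; apply/negP => id; apply: nbd.
have [||y hy /vanish_n yP] := @upper_bound n _ i d (const v) id (hv_const vd).
- by rewrite n_ge3 /=.
- case: i v vd vcyc id => [|i] v vd vcyc id //=.
  by apply/vanish_n; rewrite at0_del at0_const.
exists (at0 y); first exact: in_degree_at0.
by apply/eqP; rewrite -subr_eq0 -at0_del -[v in v - _]at0_const -at0B yP.
Qed.

Hypothesis pi_graded : forall p d, pi p = 0 -> pi (hproj d p) = 0.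

(** Without such a class the extreme homology vanishes modulo all [n] forms, where the complex is F
    tensored with [k]; the vanishing descends to three forms, and in index 0 it puts [pi p] into
    [J 3]. *)
Lemma tor_top_class p : p \is 3.-homog -> ~ J 3 (pi p) ->
  exists i (v : 'rV[k]_(grank F i)),
    [/\ in_degree (i%:Z + 3) v, tcycle v & ~ tboundary (i%:Z + 3) v].
Proof.
move=> p3 np; apply: contrapT => ntor; apply: np.
have Zn : no_syzygy_in_regularity n.
  move=> i v hvv v0.
  have vcyc : tcycle (at0 v).
    by case: i v hvv v0 => [|i] v hvv //= /vanish_n; rewrite at0_del.
  have [w wd wE] : tboundary (i%:Z + 3) (at0 v).
    apply: contrapT => nbd; apply: ntor; exists i, (at0 v); split=> //.
    exact: in_degree_at0.
  exists (const w); apply/vanish_n.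
  by rewrite at0B at0_del at0_const -wE subrr.
have Z3 : no_syzygy_in_regularity 3.
  suff Zm j : (j <= n - 3)%N -> no_syzygy_in_regularity (n - j).
    by have := Zm (n - 3)%N (leqnn _); rewrite subKn.
  elim: j => [|j IHj] jn; first by rewrite subn0.
  have jn' : (j < n)%N by rewrite (leq_trans jn) // leq_subr.
  apply: descend_regularity; first last.
    by rewrite subnSK //; apply: IHj; apply: ltnW.
  by move: jn n_ge3; lia.
have [u uE] := gaug_surj F 1; have augu : aug u = 1 by rewrite /aug uE mxE.
have [q qP] := choice (fun a => let: ex_intro2 p pd pE := gaug_homog a in
  ex_intro (fun p => in_hdegree (gdeg a) p /\ pi p = gaug F a 0) p (conj pd pE)).
(* The lift [u] of 1 may be inhomogeneous. The component of degree 3 of [p *: u] still maps to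
   [pi p], because the degree 0 component of [s] maps to 1. *)
have [y yP] := Z3 0%N (vproj 3 (p *: u)) (vprojP _ _) I.
have := vanish_aug yP; rewrite augD augN aug_del subr0.
suff -> : aug (vproj 3 (p *: u)) = pi p by [].
have augq v : aug v = pi (\sum_a v 0 a * q a).
  by rewrite augE rmorph_sum; apply: eq_bigr => a _; rewrite rmorphM (qP a).2.
pose s := \sum_a u 0 a * q a.
have s1 : pi (hproj 0 s) = 1.
  have : pi (hproj 0 (s - 1)) = 0 by apply: pi_graded;
    rewrite rmorphB -augq augu rmorph1 subrr.
  rewrite hprojD hprojN [hproj 0 1]hproj_id; last exact: dhomog1.
  by rewrite rmorphB rmorph1 => /eqP; rewrite subr_eq0 => /eqP.
transitivity (pi (p * hproj 0 s)); last by rewrite rmorphM s1 mulr1.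
rewrite augq -(hprojM (d := 3)) // addr0 /s mulr_sumr hproj_sum.
congr (pi _); apply: eq_bigr => a _.
have := hprojM (3 - gdeg a) (p * u 0 a) (proj1 (qP a)).
rewrite [gdeg a + _]addrC subrK !mxE [RHS]mulrC => <-.
by congr (hproj _ _); ring.
Qed.

End FixedResolution.

Hypothesis pi_graded : forall p d, pi p = 0 -> pi (hproj d p) = 0.

Lemma regularity_of_reduction p : inhabited (graded_free_resolution pi) ->
  p \is 3.-homog -> ~ J 3 (pi p) -> is_regularity pi 3.
Proof.
move=> [F] p3 np; split.
  have [i [v vP]] := tor_top_class F pi_graded p3 np.
  by exists i, F, v.
move=> i j [F' [v [vd vc vb]]].
by have := tor_class_degree vd vc vb; rewrite lerD2l.
Qed.

End RegularityOfResolution.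

(** * Existence of a graded free resolution *)

Section ResolutionExists.
Variables (k : fieldType) (n : nat).
Local Notation S := {mpoly k[n]}.

Definition row_hproj r (deg : 'I_r -> nat) (d : int) (v : 'rV[S]_r) : 'rV[S]_r :=
  \row_a hproj (d - (deg a)%:Z) (v 0 a).

Lemma row_hproj_decomp r (deg : 'I_r -> nat) (v : 'rV[S]_r) D :
  (forall a, (deg a + msize (v 0%R a) <= D)%N) ->
  v = \sum_(d < D) row_hproj deg d v.
Proof.
move=> vD; apply/rowP => a; rewrite summxE.
have aD : (deg a <= D)%N := leq_trans (leq_addr _ _) (vD a).
under eq_bigr do rewrite mxE.
rewrite -(big_mkord xpredT (fun d : nat => hproj (d%:Z - (deg a)%:Z) (v 0 a))).
rewrite (big_cat_nat (leq0n (deg a)) aD) /=.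
rewrite big_nat_cond big1 => [|d /andP[/andP[_ da] _]]; last first.
  case dE : (d%:Z - (deg a)%:Z) => [e|e] //=.
  by move: dE da; lia.
rewrite add0r -{1}[deg a]add0n big_addn.
under eq_bigr do rewrite PoszD addrK.
rewrite big_mkord.
by apply: pihomog_partitionE; rewrite leq_subRL.
Qed.

(** Rank, shifts and submodule are bundled so that passing to relations is an operation on a single
    type, which can be iterated. *)
Record graded_submodule := GradedSubmodule {
  gs_rank : nat;
  gs_deg : 'I_gs_rank -> nat;
  gs_mem : 'rV[S]_gs_rank -> Prop;
  gs_submodule : is_submodule gs_mem;
  gs_graded : forall d v, gs_mem v -> gs_mem (row_hproj gs_deg d v) }.

Record homogeneous_generators (M : graded_submodule) := HomogeneousGenerators {
  hg_rank : nat;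
  hg_deg : 'I_hg_rank -> nat;
  hg_mx : 'M[S]_(hg_rank, gs_rank M);
  hg_homog : forall a b,
    in_hdegree ((hg_deg a)%:Z - (gs_deg b)%:Z) (hg_mx a b);
  hg_gen : forall v, gs_mem v <-> exists w, w *m hg_mx = v }.

(** Finitely many generators exist because polynomial rings are Noetherian; their homogeneous
    components stay in the submodule and replace them. *)
Lemma homogeneous_generators_exist (M : graded_submodule) :
  inhabited (homogeneous_generators M).
Proof.
have S_noeth := @noetherian_mpoly k n (@field_noetherian k).
have [q [G GP]] := noetherian_submodule S_noeth (gs_submodule M).
pose D := (\sum_i \sum_a (gs_deg a + msize (G i a)))%N.
have GD i : row i G = \sum_(d < D) row_hproj (@gs_deg M) d (row i G).
  apply: row_hproj_decomp => a; rewrite mxE /D (bigD1 i) //= (bigD1 a) //=.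
  by rewrite -addnA leq_addr.
pose I := ('I_q * 'I_D)%type.
pose deg (j : 'I_#|{: I}|) : nat := (enum_val j).2.
pose gen (x : I) := row_hproj (@gs_deg M) x.2 (row x.1 G).
pose H : 'M_(#|{: I}|, gs_rank M) := \matrix_j gen (enum_val j).
constructor; apply: (@HomogeneousGenerators M _ deg H) => [a b|v].
  by rewrite !mxE; apply: hprojP.
split=> [/GP [c ->]|[w <-]]; last first.
  rewrite mulmx_sum_row; apply: is_submodule_sum => [|j].
    exact: gs_submodule.
  rewrite rowK; apply: gs_graded; apply/GP.
  by exists (delta_mx 0 (enum_val j).1); rewrite -rowE.
exists (\row_j c 0 (enum_val j).1).
rewrite [LHS]mulmx_sum_row [RHS]mulmx_sum_row; apply/esym.
transitivity (\sum_i \sum_d c 0 i *: gen (i, d)).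
  by apply: eq_bigr => i _; rewrite -scaler_sumr /gen /= -GD.
rewrite pair_bigA (reindex (@enum_val _ {: I})) /=; last exact/onW_bij/enum_val_bij.
by apply: eq_bigr => j _; rewrite rowK mxE; case: (enum_val j).
Qed.

Definition generators M : homogeneous_generators M :=
  inhabited_witness (homogeneous_generators_exist M).

Fact relations_submodule M : is_submodule (fun w => w *m hg_mx (generators M) = 0).
Proof.
split=> [|a u v u0 v0]; first by rewrite mul0mx.
by rewrite mulmxDl -scalemxAl u0 v0 scaler0 addr0.
Qed.

Fact relations_graded M d w : w *m hg_mx (generators M) = 0 ->
  row_hproj (@hg_deg _ (generators M)) d w *m hg_mx (generators M) = 0.
Proof.
move=> w0; apply/rowP => b.
transitivity (hproj (d - (gs_deg b)%:Z) ((w *m hg_mx (generators M)) 0 b)).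
  rewrite !mxE hproj_sum; apply: eq_bigr => a _; rewrite mxE mulrC [w 0 a * _]mulrC.
  rewrite -(hprojM _ _ (hg_homog a b)); congr (hproj _ _); ring.
by rewrite w0 !mxE hproj0.
Qed.

Definition relations M : graded_submodule :=
  GradedSubmodule (relations_submodule M) (@relations_graded M).

Variables (R : comNzRingType) (pi : {rmorphism S -> R}).
Hypothesis pi_surj : forall r, exists p, pi p = r.
Hypothesis pi_graded : forall p d, pi p = 0 -> pi (hproj d p) = 0.

Fact kernel_submodule : is_submodule (fun v : 'rV[S]_1 => pi (v 0 0) = 0).
Proof.
split=> [|a u v u0 v0]; first by rewrite mxE rmorph0.
by rewrite !mxE rmorphD rmorphM u0 v0 mulr0 addr0.
Qed.

Fact kernel_graded d (v : 'rV[S]_1) : pi (v 0 0) = 0 ->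
  pi (row_hproj (fun=> 0%N) d v 0 0) = 0.
Proof. by move=> v0; rewrite mxE; apply: pi_graded. Qed.

Definition kernel := GradedSubmodule kernel_submodule kernel_graded.

Definition syzygies i := iter i relations kernel.

(** Term i is the free module containing the i-th syzygies, and differential i is the matrix of
    their generators; F_0 is S itself, augmented by 1. *)
Lemma graded_free_resolution_exists : inhabited (graded_free_resolution pi).
Proof.
constructor.
apply: (@GradedFreeResolution k n R pi (fun i => gs_rank (syzygies i))
  (fun i a => (gs_deg a)%:Z) (fun i => hg_mx (generators (syzygies i)))
  (const_mx 1)).
- by move=> i a b; apply: hg_homog.
- by move=> a; exists 1; rewrite ?mxE ?rmorph1 //; apply: dhomog1.
- move=> r; have [p pr] := pi_surj r; exists (const_mx p).
  apply/matrixP => i j; rewrite !ord1 !mxE big_ord_recl big_ord0 !mxE.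
  by rewrite pr mulr1 addr0.
- move=> v; rewrite -hg_gen /=; split=> [/matrixP /(_ 0 0)|v0].
    by rewrite !mxE big_ord_recl big_ord0 !mxE mulr1 addr0.
  apply/matrixP => i j; rewrite !ord1 !mxE big_ord_recl big_ord0 !mxE.
  by rewrite mulr1 addr0.
- by move=> i v; rewrite -(hg_gen (generators (syzygies i.+1))).
Qed.

End ResolutionExists.

Lemma comp_mpoly_homog (k : fieldType) m n (h : n.-tuple {mpoly k[m]}) :
    (forall i, tnth h i \is 1.-homog) ->
  forall d p, p \is d.-homog -> comp_mpoly h p \is d.-homog.
Proof.
move=> h1 d p /dhomogP pd; rewrite (mpolyE p) rmorph_sum big_seq.
apply: rpred_sum => e ep; rewrite /= comp_mpolyZ dhomogZ //.
rewrite comp_mpolyX -(pd e ep) /= mdegE.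
elim/big_rec2: _ => [|i a q _ qa]; first exact: dhomog1.
apply: dhomogM => //.
by have := dhomogMn (e i) (h1 i); rewrite mul1n.
Qed.

(** * Linear forms that are coordinates after a linear change of variables *)

Section KillVariables.
Variables (k : fieldType) (n : nat) (pos : 'I_n -> nat).
Local Notation S := {mpoly k[n]}.

Definition kills_variables (kill : nat -> {rmorphism S -> S}) :=
  [/\ forall m i, kill m 'X_i = if (pos i < m)%N then 0 else 'X_i,
      forall m c, kill m c%:MP = c%:MP
    & forall m d p, p \is d.-homog -> kill m p \is d.-homog].

Lemma killing_maps_exist : exists kill, kills_variables kill.
Proof.
exists (fun m => comp_mpoly [tuple (if (pos i < m)%N then 0 else 'X_i : S) | i < n]).
split=> [m i|m c|m d p].
- by rewrite /= /comp_mpoly mmapX mmap1U tnth_mktuple.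
- exact: comp_mpolyC.
- apply: comp_mpoly_homog => i; rewrite tnth_mktuple.
  by case: ifP => _; [exact: dhomog0 | rewrite dhomogX /= mdeg1].
Qed.

Variable kill : nat -> {rmorphism S -> S}.
Hypothesis killP : kills_variables kill.

Let kill_X m i : kill m 'X_i = if (pos i < m)%N then 0 else 'X_i.
Proof. by case: killP. Qed.

Let kill_C m c : kill m c%:MP = c%:MP.
Proof. by case: killP. Qed.

Lemma kill_0 p : kill 0 p = p.
Proof.
elim/mpoly_ring_ind: p => [c|i|p q pE qE|p q pE qE].
- exact: kill_C.
- exact: kill_X.
- by rewrite (rmorphD (kill _)) pE qE.
- by rewrite (rmorphM (kill _)) pE qE.
Qed.

Lemma kill_kill m m' p : (m <= m')%N -> kill m' (kill m p) = kill m' p.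
Proof.
move=> mm; elim/mpoly_ring_ind: p => [c|i|p q pE qE|p q pE qE].
- by rewrite !kill_C.
- rewrite !kill_X; case: ltnP => im; last by rewrite kill_X.
  by rewrite rmorph0 (leq_trans im).
- by rewrite (rmorphD (kill m) p q) (rmorphD (kill m')) pE qE -rmorphD.
- by rewrite (rmorphM (kill m) p q) (rmorphM (kill m')) pE qE -rmorphM.
Qed.

Lemma kill_all m p : (forall i, pos i < m)%N -> kill m p = (p@_0)%:MP.
Proof.
move=> posm; elim/mpoly_ring_ind: p => [c|i|p q pE qE|p q pE qE].
- by rewrite kill_C mcoeffC eqxx mulr1.
- rewrite kill_X posm mcoeffX (_ : _ == _ = false) ?mpolyC0 //.
  by apply/eqP => /(congr1 (fun e : 'X_{1..n} => e i)); rewrite mnm1E eqxx mnm0E.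
- by rewrite rmorphD pE qE mcoeffD mpolyCD.
- by rewrite rmorphM pE qE (rmorphM (mcoeff 0%MM)) mpolyCM.
Qed.

Hypothesis pos_inj : injective pos.

Lemma kill_S m i p : pos i = m -> exists w, kill m p = kill m.+1 p + 'X_i * w.
Proof.
move=> im; elim/mpoly_ring_ind: p => [c|j|p q [a pE] [b qE]|p q [a pE] [b qE]].
- by exists 0; rewrite !kill_C mulr0 addr0.
- have [->|ji] := eqVneq j i.
    by exists 1; rewrite !kill_X im ltnn ltnSn mulr1 add0r.
  exists 0; rewrite !kill_X mulr0 addr0 (_ : (pos j < m.+1) = (pos j < m))%N //.
  by rewrite ltnS leq_eqVlt -im (inj_eq pos_inj) (negPf ji).
- exists (a + b); rewrite (rmorphD (kill m) p q) (rmorphD (kill m.+1) p q) pE qE.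
  by rewrite mulrDr addrACA.
- exists (kill m.+1 p * b + a * kill m q).
  rewrite (rmorphM (kill m) p q) (rmorphM (kill m.+1) p q) pE.
  rewrite mulrDl {1}qE; move: (kill m.+1 p) (kill m.+1 q) (kill m q) 'X_i => x y z e.
  by ring.
Qed.

Lemma kill_div m i p : pos i = m -> kill m.+1 p = 0 ->
  exists w, kill m (p - 'X_i * w) = 0.
Proof.
move=> im p0; have [w wE] := kill_S p im.
exists w; rewrite (rmorphB (kill _)) (rmorphM (kill _)) kill_X im ltnn.
rewrite -(kill_kill p (leqnn m)) wE p0 add0r.
by rewrite (rmorphM (kill _)) kill_X im ltnn subrr.
Qed.

Lemma kill_regular m i p : pos i = m -> kill m ('X_i * p) = 0 -> kill m p = 0.
Proof.
move=> im; rewrite rmorphM kill_X im ltnn => /eqP; rewrite mulf_eq0 => /orP [|/eqP //].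
move=> /eqP /(congr1 (mcoeff U_(i)%MM)) /eqP.
by rewrite mcoeffXU eqxx mcoeff0 oner_eq0.
Qed.

End KillVariables.

Section CoordinateSequence.
Variables (k : fieldType) (n : nat) (pos : 'I_n -> nat) (var : nat -> 'I_n).
Local Notation S := {mpoly k[n]}.
Hypothesis pos_inj : injective pos.
Hypothesis pos_lt : forall i, (pos i < n)%N.
Hypothesis pos_var : forall m, (m < n)%N -> pos (var m) = m.
Variables phi psi : {rmorphism S -> S}.
Hypothesis psiK : cancel psi phi.
Hypothesis phiK : cancel phi psi.
Hypothesis phi_homog : forall d p, p \is d.-homog -> phi p \is d.-homog.
Hypothesis psi_homog : forall d p, p \is d.-homog -> psi p \is d.-homog.
Hypothesis phi_at0 : forall p, (phi p)@_0 = p@_0.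

(** The conditions that the regularity argument imposes on its linear forms, met below by a change
    of coordinates followed by setting variables to zero. *)
Definition is_coordinate_sequence (l : nat -> S) (rho : nat -> {rmorphism S -> S}) :=
  [/\ forall m, (m < n)%N -> l m \is 1.-homog,
      forall m d p, p \is d.-homog -> rho m p \is d.-homog,
      forall p, rho 0 p = 0 -> p = 0
    & forall m p, rho m p = 0 -> rho m.+1 p = 0] /\
  [/\ forall m, (m < n)%N -> rho m.+1 (l m) = 0,
      forall m p, (m < n)%N -> rho m.+1 p = 0 -> exists w, rho m (p - l m * w) = 0,
      forall m p, (m < n)%N -> rho m (l m * p) = 0 -> rho m p = 0
    & forall p, rho n p = 0 <-> p@_0 = 0].

Lemma coordinate_sequence_exists :
  exists rho, is_coordinate_sequence (fun m => psi 'X_(var m)) rho.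
Proof.
have [kill killP] := killing_maps_exist k pos.
have [kill_X kill_C kill_homog] := killP.
pose r m p := kill m (phi p).
have r_S m p : r m p = 0 -> r m.+1 p = 0.
  by move=> p0; rewrite /r -(kill_kill killP _ (leqnSn m)) -/(r m p) p0 rmorph0.
have r_l m p : r m (psi 'X_(var m) * p) = kill m ('X_(var m) * phi p).
  by rewrite /r (rmorphM phi) psiK.
exists (fun m => kill m \o phi); split; split.
- by move=> m _; apply: psi_homog; rewrite dhomogX /= mdeg1.
- by move=> m d p pd; apply/kill_homog/phi_homog.
- by move=> p; rewrite -[LHS]/(r 0%N p) /r (kill_0 killP) => p0;
    rewrite -[p]phiK p0 rmorph0.
- exact: r_S.
- by move=> m mn; rewrite -[LHS]/(r m.+1 _) /r psiK kill_X pos_var // ltnSn.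
- move=> m p mn /(kill_div killP pos_inj (pos_var mn)) [w wE].
  by exists (psi w); rewrite -[LHS]/(r m _) /r (rmorphB phi) (rmorphM phi) !psiK.
- move=> m p mn; rewrite -[LHS]/(r m _) r_l => /(kill_regular killP (pos_var mn)) p0;
    exact: p0.
- move=> p; rewrite -[X in X = 0 <-> _]/(r n p) /r (kill_all killP _ pos_lt) phi_at0.
  split=> [/eqP|->]; last by rewrite mpolyC0.
  by rewrite mpolyC_eq0 => /eqP.
Qed.

End CoordinateSequence.

Section Shear.
Variables (k : fieldType) (n : nat) (i0 j0 : 'I_n).
Local Notation S := {mpoly k[n]}.

(** The third parameter is z_1 plus a multiple of z_G', not a coordinate; a shear makes it one. *)
Definition is_shear (a : k) (psi : {rmorphism S -> S}) :=
  [/\ forall i, psi 'X_i = 'X_i + (if i == i0 then a%:MP * 'X_j0 else 0),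
      forall c, psi c%:MP = c%:MP
    & forall d p, p \is d.-homog -> psi p \is d.-homog].

Lemma shear_exists a : exists psi, is_shear a psi.
Proof.
exists (comp_mpoly
  [tuple ('X_i + (if i == i0 then a%:MP * 'X_j0 else 0) : S) | i < n]).
split=> [i|c|d p].
- by rewrite /= /comp_mpoly mmapX mmap1U tnth_mktuple.
- exact: comp_mpolyC.
- apply: comp_mpoly_homog => i; rewrite tnth_mktuple; apply: dhomogD.
    by rewrite dhomogX /= mdeg1.
  case: ifP => _; last exact: dhomog0.
  by rewrite mul_mpolyC dhomogZ // dhomogX /= mdeg1.
Qed.

Hypothesis ij0 : j0 != i0.

Lemma shearK a psi phi : is_shear a psi -> is_shear (- a) phi -> cancel psi phi.
Proof.
case=> psi_X psi_C _ [phi_X phi_C _].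
elim/mpoly_ring_ind => [c|i|p p' pE pE'|p p' pE pE'].
- by rewrite psi_C phi_C.
- rewrite psi_X rmorphD phi_X; case: eqP => _.
    by rewrite rmorphM phi_C phi_X (negPf ij0) addr0 mpolyCN mulNr subrK.
  by rewrite rmorph0 !addr0.
- by rewrite !rmorphD pE pE'.
- by rewrite !rmorphM pE pE'.
Qed.

Lemma shear_at0 a phi p : is_shear a phi -> (phi p)@_0 = p@_0.
Proof.
case=> phi_X phi_C _.
have X0 (i : 'I_n) : ('X_i : S)@_0 = 0.
  rewrite mcoeffX (_ : _ == _ = false) //.
  by apply/eqP => /(congr1 (fun e : 'X_{1..n} => e i)); rewrite mnm1E eqxx mnm0E.
elim/mpoly_ring_ind: p => [c|i|p p' pE pE'|p p' pE pE'].
- by rewrite phi_C.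
- rewrite phi_X mcoeffD !X0; case: eqP => _; rewrite ?mcoeff0 ?addr0 //.
  by rewrite (rmorphM (mcoeff 0%MM)) /= X0 mulr0 addr0.
- by rewrite rmorphD !mcoeffD pE pE'.
- by rewrite rmorphM !(rmorphM (mcoeff 0%MM)) /= pE pE'.
Qed.

Lemma sheared_coordinate_sequence (pos : 'I_n -> nat) (var : nat -> 'I_n) (a : k) :
    injective pos -> (forall i, (pos i < n)%N) ->
    (forall m, (m < n)%N -> pos (var m) = m) ->
  exists l rho, is_coordinate_sequence l rho /\
    forall m, l m = 'X_(var m) + (if var m == i0 then a%:MP * 'X_j0 else 0).
Proof.
move=> pos_inj pos_lt pos_var.
have [psi psiP] := shear_exists a; have [phi phiP] := shear_exists (- a).
have psiP' : is_shear (- - a) psi by rewrite opprK.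
have [rho rhoP] : exists rho, is_coordinate_sequence (fun m => psi 'X_(var m)) rho.
  apply: (@coordinate_sequence_exists _ _ pos var _ _ _ phi psi) => //.
  - exact: shearK psiP phiP.
  - exact: shearK phiP psiP'.
  - by case: phiP.
  - by case: psiP.
  - by move=> p; apply: shear_at0 phiP.
by exists (fun m => psi 'X_(var m)), rho; split=> // m; case: psiP => ->.
Qed.

End Shear.

(* Naming a composite by an equation keeps unification from unfolding it. *)
Lemma rmorphism_comp2 (A B C : nzRingType) (f : {rmorphism B -> C})
    (h : {rmorphism A -> B}) :
  exists th : {rmorphism A -> C}, forall p, th p = f (h p).
Proof. by exists (f \o h). Qed.

Lemma rmorphism_comp3 (A B C D : nzRingType) (f : {rmorphism C -> D})
    (h : {rmorphism B -> C}) (l : {rmorphism A -> B}) :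
  exists th : {rmorphism A -> D}, forall p, th p = f (h (l p)).
Proof. by exists (f \o (h \o l)). Qed.

(** * Products of the generators inside k[t, u, v] *)

Section TangentialVariety.
Variables (k : fieldType) (g : nat).
Hypothesis g_ge3 : (3 <= g)%N.
Local Notation S := {mpoly k[g.+1]}.
Local Notation P := {mpoly k[3]}.
Local Notation t := (Xt k).
Local Notation u := (Xu k).
Local Notation v := (Xv k).
Local Notation Phi := (tangent_map k g).

Definition zvar (j : nat) : S := 'X_(inord j).
Definition Ez (j : nat) : P := u * t ^+ j + j%:R * (v * t ^+ j.-1).
(** The index is shifted so that it adds under products: E_i E_j involves [quad (i + j)], and E_i
    [quad m] involves [cubic (i + m)]. Indices below 2 and 3 respectively are truncated and not
    meant. *)
Definition quad (m : nat) : P := v ^+ 2 * t ^+ (m - 2).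
Definition cubic (m : nat) : P := v ^+ 3 * t ^+ (m - 3).

Lemma Phi_z j : (j <= g)%N -> Phi (zvar j) = Ez j.
Proof.
move=> jg; rewrite /= /zvar /comp_mpoly mmapX mmap1U tnth_mktuple inordK ?ltnS //.
by rewrite /Ez mulr_natl.
Qed.

Lemma E_E i j : Ez i * Ez j = u ^+ 2 * t ^+ (i + j)
  + (i + j)%N%:R * (u * v * t ^+ (i + j).-1) + (i * j)%N%:R * (v ^+ 2 * t ^+ (i + j - 2)).
Proof.
rewrite /Ez; case: i => [|i]; first by ring.
case: j => [|j]; first by rewrite addn0; ring.
rewrite addSn addnS /= subn2 /= !exprS exprD.
move: (t ^+ i) (t ^+ j) => a b; ring.
Qed.

(** The first two terms of [E_E] depend only on the sum of the indices, so they cancel. *)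
Lemma E_E_sub i j a b : (i + j = a + b)%N ->
  Ez i * Ez j - Ez a * Ez b = ((i * j)%N%:R - (a * b)%N%:R) * quad (i + j).
Proof. by move=> ijab; rewrite !E_E -ijab /quad; ring. Qed.

Lemma E_q i m : (2 <= m)%N ->
  Ez i * quad m = u * v ^+ 2 * t ^+ (i + m - 2) + i%:R * cubic (i + m).
Proof.
case: m => [|[|m]] // _; rewrite /Ez /quad /cubic; case: i => [|i]; first by ring.
rewrite !addSn !addnS !subSS !subn0 /= !exprS exprD.
move: (t ^+ i) (t ^+ m) => a b; ring.
Qed.

Lemma E_q_sub i m j n : (i + m = j + n)%N -> (2 <= m)%N -> (2 <= n)%N ->
  Ez i * quad m - Ez j * quad n = (i%:R - j%:R) * cubic (i + m).
Proof. by move=> ij m2 n2; rewrite !E_q // -ij; ring. Qed.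

Lemma q_q m n : (2 <= m)%N -> (2 <= n)%N -> quad m * quad n = v ^+ 4 * t ^+ (m + n - 4).
Proof.
case: m => [|[|m]] //; case: n => [|[|n]] // _ _.
by rewrite /quad !addSn !addnS !subSS !subn0 exprD; ring.
Qed.

(** The graded piece of degree [d] of [R], seen inside k[t, u, v]. *)
Definition Rg (d : nat) (F : P) : Prop := exists2 p, p \is d.-homog & Phi p = F.

Lemma Rg0 d : Rg d 0.
Proof. by exists 0; [exact: dhomog0 | rewrite rmorph0]. Qed.

Lemma RgD d F H : Rg d F -> Rg d H -> Rg d (F + H).
Proof.
by move=> [p pd <-] [p' pd' <-]; exists (p + p'); rewrite ?rmorphD ?dhomogD.
Qed.

Lemma RgM d e F H : Rg d F -> Rg e H -> Rg (d + e) (F * H).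
Proof.
by move=> [p pd <-] [p' pd' <-]; exists (p * p'); rewrite ?rmorphM ?dhomogM.
Qed.

Lemma Phi_C a : Phi a%:MP = a%:MP. Proof. exact: comp_mpolyC. Qed.

Local Opaque tangent_map.

Lemma RgC a : Rg 0 a%:MP.
Proof.
exists a%:MP; last exact: Phi_C.
by rewrite -[a%:MP]mulr1 mul_mpolyC; apply/dhomogZ/dhomog1.
Qed.

Lemma Rg_nat m : Rg 0 m%:R.
Proof. by rewrite -(rmorph_nat (@mpolyC 3 k)); apply: RgC. Qed.

Lemma RgN d F : Rg d F -> Rg d (- F).
Proof. by move=> [p pd <-]; exists (- p); rewrite ?rmorphN ?dhomogN. Qed.

Lemma RgB d F H : Rg d F -> Rg d H -> Rg d (F - H).
Proof. by move=> FR HR; apply/RgD/RgN. Qed.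

Lemma Rg_E j : (j <= g)%N -> Rg 1 (Ez j).
Proof.
by move=> jg; exists (zvar j); [rewrite dhomogX /= mdeg1 | apply: Phi_z].
Qed.

Hypothesis char_k : 2%N \notin [pchar k].

Lemma two_neq0 : 2%:R != 0 :> k.
Proof. by apply: contra char_k => two0; rewrite inE /= two0. Qed.

(** E_i^2 - E_(i-1) E_(i+1) is q_(2i), and E_i E_(i+1) - E_(i-1) E_(i+2) is twice q_(2i+1); the odd
    case divides by 2. *)
Lemma Rg_q m : (2 <= m <= 2 * g - 2)%N -> Rg 2 (quad m).
Proof.
move=> /andP[m2 mg].
have EE i j : (i <= g)%N -> (j <= g)%N -> Rg 2 (Ez i * Ez j).
  by move=> ig jg; apply: (RgM (Rg_E ig) (Rg_E jg)).
have mE := odd_double_half m; move: m2 mg; rewrite -mE -addnn.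
case: (odd m); rewrite /= ?add1n ?add0n; move: m./2 => i i1 ig.
  have -> : quad (i + i).+1 = (2%:R^-1)%:MP * (Ez i * Ez i.+1 - Ez i.-1 * Ez i.+2).
    rewrite E_E_sub ?addnS; last by lia.
    case: i i1 ig => [|i] // _ _.
    rewrite (_ : (i.+1 * i.+2)%N%:R - (i.+1.-1 * i.+3)%N%:R = 2%:R :> P); last by ring.
    by rewrite -(rmorph_nat (@mpolyC 3 k)) mulrA -rmorphM mulVf ?two_neq0 // mul1r.
  by apply: (RgM (RgC _)); apply: RgB; apply: EE; lia.
have -> : quad (i + i) = Ez i * Ez i - Ez i.-1 * Ez i.+1.
  rewrite E_E_sub; last by lia.
  case: i i1 ig => [|i] // _ _.
  by rewrite (_ : (_ - _)%R = 1 :> P) ?mul1r //=; ring.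
by apply: RgB; apply: EE; lia.
Qed.

(** * Congruences modulo the three linear parameters *)

Variables (G G' : nat).
Hypothesis G_bounds :
  [/\ (g.-1 <= G <= g)%N, (g.-1 <= G' <= g)%N & (G + G' = 2 * g - 1)%N].
Hypothesis G_neq0 : G%:R != 0 :> k.

(** A sign, 1 or -1, as [G] and [G'] are consecutive. *)
Definition eps : P := G'%:R - G%:R.

Lemma eps_sqr : eps * eps = 1.
Proof.
case: G_bounds => GB GB' GG; rewrite /eps.
have [->|->] : (G' = G.+1 \/ G = G'.+1)%N by lia.
  by ring.
by ring.
Qed.

Definition zlast : P := Ez 1 + eps * Ez G'.

(* The degree [d] part of the ideal (x, y, z) R; congruences modulo this ideal
   are written as [JJ d (F - H)]. *)
Definition JJ (d : nat) (F : P) : Prop :=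
  match d with
  | 0 => F = 0
  | d'.+1 => exists a b e, [/\ Rg d' a, Rg d' b, Rg d' e
                            & F = Ez 0 * a + Ez G * b + zlast * e]
  end.

Lemma JJ0 d : JJ d 0.
Proof.
case: d => [|d] //=; exists 0, 0, 0; split; try exact: Rg0.
by rewrite !mulr0 !addr0.
Qed.

Lemma JJD d F H : JJ d F -> JJ d H -> JJ d (F + H).
Proof.
case: d => [|d] /=; first by move=> -> ->; rewrite addr0.
move=> [a [b [e [aR bR eR ->]]]] [a' [b' [e' [aR' bR' eR' ->]]]].
by exists (a + a'), (b + b'), (e + e'); split; [exact: RgD.. | ring].
Qed.

Lemma JJM d e F H : Rg d F -> JJ e H -> JJ (d + e) (F * H).
Proof.
case: e => [|e] FR /=; first by move=> ->; rewrite mulr0; apply: JJ0.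
move=> [a [b [e' [aR bR eR ->]]]]; rewrite addnS /=.
by exists (F * a), (F * b), (F * e'); split; [exact: RgM.. | ring].
Qed.

Lemma JJN d F : JJ d F -> JJ d (- F).
Proof.
move=> FJ; have := JJM (RgC (-1)) FJ.
by rewrite mpolyCN mpolyC1 mulN1r.
Qed.

Lemma JJB d F H : JJ d F -> JJ d H -> JJ d (F - H).
Proof. by move=> FJ HJ; apply/JJD/JJN. Qed.

Lemma JJ_nat d m F : JJ d F -> JJ d (m%:R * F).
Proof. exact: (JJM (Rg_nat m)). Qed.

Lemma JJ_eps d F : JJ d F -> JJ d (eps * F).
Proof. exact: (JJM (RgB (Rg_nat _) (Rg_nat _))). Qed.

Lemma JJ_x d F : Rg d F -> JJ d.+1 (Ez 0 * F).
Proof.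
by move=> FR; exists F, 0, 0; split; rewrite ?mulr0 ?addr0 //; exact: Rg0.
Qed.

Lemma JJ_y d F : Rg d F -> JJ d.+1 (Ez G * F).
Proof.
by move=> FR; exists 0, F, 0; split; rewrite ?mulr0 ?addr0 ?add0r //; exact: Rg0.
Qed.

Lemma JJ_z d F : Rg d F -> JJ d.+1 (zlast * F).
Proof.
by move=> FR; exists 0, 0, F; split; rewrite ?mulr0 ?addr0 ?add0r //; exact: Rg0.
Qed.

Lemma JJ_EE_low i j : (i + j <= g)%N ->
  JJ 2 (Ez i * Ez j - (i * j)%N%:R * quad (i + j)).
Proof.
move=> ijg; have -> : Ez i * Ez j - (i * j)%N%:R * quad (i + j) = Ez 0 * Ez (i + j).
  rewrite -[Ez i * Ez j](subrK (Ez 0 * Ez (i + j))).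
  by rewrite (E_E_sub (esym (add0n _))) mul0n; ring.
exact/JJ_x/Rg_E.
Qed.

(** Comparison with E_G E_(i+j-G), using i j - G (i + j - G) = (G - i)(G - j); the low case compares
    with E_0 E_(i+j). *)
Lemma JJ_EE_high i j : (G <= i + j <= G + g)%N ->
  JJ 2 (Ez i * Ez j - (G%:R - i%:R) * (G%:R - j%:R) * quad (i + j)).
Proof.
move=> /andP[Gij ijg]; have ijE : (i + j = G + (i + j - G))%N by rewrite subnKC.
have -> : Ez i * Ez j - (G%:R - i%:R) * (G%:R - j%:R) * quad (i + j)
    = Ez G * Ez (i + j - G).
  rewrite -[Ez i * Ez j](subrK (Ez G * Ez (i + j - G))) (E_E_sub ijE).
  by rewrite !natrM natrB // natrD; ring.
by apply/JJ_y/Rg_E; lia.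
Qed.

Lemma JJ_C d a F : JJ d F -> JJ d (a%:MP * F).
Proof. exact: (JJM (RgC a)). Qed.

(* Modulo (x, y, z), [i q_(2g-1-i) = (G - i) q_(G+1-i)], so that the two are the
   multiples [G - i] and [i] of one element. *)
Definition quadh i : P := (G%:R^-1)%:MP * (quad (G + 1 - i) + quad (2 * g - 1 - i)).

Lemma G_inv : (G%:R^-1)%:MP * G%:R = 1 :> P.
Proof. by rewrite -(rmorph_nat (@mpolyC 3 k)) -rmorphM mulVf. Qed.

Lemma G_invK (F : P) : F = (G%:R^-1)%:MP * G%:R * F.
Proof. by rewrite G_inv mul1r. Qed.

(** Expansion of z E_(G-i): the product with E_1 is reduced through E_0, the one with E_G' through
    E_G, and the two signs [eps] multiply to 1. *)
Lemma JJ_q_relation i : (1 <= i <= g - 2)%N ->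
  JJ 2 ((G%:R - i%:R) * quad (G + 1 - i) - i%:R * quad (2 * g - 1 - i)).
Proof.
move=> /andP[i1 ig]; case: G_bounds => GB GB' GG.
have Gi : (G - i <= g)%N by lia.
have a1 : JJ 2 (Ez 1 * Ez (G - i) - (1 * (G - i))%N%:R * quad (1 + (G - i))).
  by apply: JJ_EE_low; lia.
have a2 : JJ 2 (Ez G' * Ez (G - i)
    - (G%:R - G'%:R) * (G%:R - (G - i)%N%:R) * quad (G' + (G - i))).
  by apply: JJ_EE_high; lia.
have a3 : JJ 2 (zlast * Ez (G - i)) by apply/JJ_z/Rg_E.
have := JJB (JJB a3 a1) (JJ_eps a2).
rewrite (_ : G' + (G - i) = 2 * g - 1 - i)%N; last by lia.
rewrite (_ : 1 + (G - i) = G + 1 - i)%N; last by lia.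
rewrite mul1n natrB; last by lia.
congr (JJ _ _).
transitivity
  ((G%:R - i%:R) * quad (G + 1 - i) - (eps * eps) * i%:R * quad (2 * g - 1 - i)).
  by rewrite /zlast /eps; ring.
by rewrite eps_sqr mul1r.
Qed.

Lemma JJ_q_low i : (1 <= i <= g - 2)%N -> JJ 2 (quad (G + 1 - i) - i%:R * quadh i).
Proof.
move=> ig; have := JJ_C (G%:R^-1) (JJ_q_relation ig).
congr (JJ _ _); rewrite {2}(G_invK (quad (G + 1 - i))) /quadh; ring.
Qed.

Lemma JJ_q_high i : (1 <= i <= g - 2)%N ->
  JJ 2 (quad (2 * g - 1 - i) - (G%:R - i%:R) * quadh i).
Proof.
move=> ig; have := JJN (JJ_C (G%:R^-1) (JJ_q_relation ig)).
congr (JJ _ _); rewrite {2}(G_invK (quad (2 * g - 1 - i))) /quadh; ring.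
Qed.

(** For G = g-1 the quadric q_g escapes both ranges of [quadh]. E_1 E_G is congruent to [G] times
    it, and [G] is invertible. *)
Lemma JJ_q_mid : (G.+1 = g)%N -> JJ 2 (quad g).
Proof.
move=> Gg; have a1 : JJ 2 (Ez 1 * Ez G - (1 * G)%N%:R * quad (1 + G)).
  by apply: JJ_EE_low; lia.
have a2 : JJ 2 (Ez 1 * Ez G) by rewrite mulrC; apply/JJ_y/Rg_E; lia.
have := JJ_C (G%:R^-1) (JJB a2 a1); rewrite mul1n add1n Gg.
by congr (JJ _ _); rewrite {2}(G_invK (quad g)); ring.
Qed.

(** For G = g the quadric outside both ranges of [quadh] is q_2; z E_1 relates it to q_g. *)
Lemma JJ_q_two : (G = g)%N -> JJ 2 (quad 2 - (g - 1)%N%:R * quad g).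
Proof.
move=> Gg; case: G_bounds => GB GB' GG.
have a1 : JJ 2 (Ez 1 * Ez 1 - (1 * 1)%N%:R * quad (1 + 1)) by apply: JJ_EE_low; lia.
have a2 : JJ 2 (Ez G' * Ez 1 - (G' * 1)%N%:R * quad (G' + 1)) by apply: JJ_EE_low; lia.
have a3 : JJ 2 (zlast * Ez 1) by apply/JJ_z/Rg_E; lia.
have := JJB (JJB a3 a1) (JJ_eps a2); rewrite /zlast /eps.
rewrite (_ : G' + 1 = g)%N; last by lia.
rewrite (_ : G = G'.+1); last by lia.
rewrite (_ : g - 1 = G')%N; last by lia.
by congr (JJ _ _); ring.
Qed.

(** * The basis spans over T *)

Definition socle : P := cubic (G + 1).

(** The order makes the reversal i -> 2g-3-i, which is [rev_ord], exchange 1 with [socle] and E_i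
    with [quadh i]: these are the dual pairs. *)
Definition basis (i : nat) : P :=
  if (i == 0)%N then 1 else if (i <= g - 2)%N then Ez i
  else if (i <= 2 * g - 4)%N then quadh (2 * g - 3 - i) else socle.

Definition basis_deg (i : nat) : nat :=
  if (i == 0)%N then 0 else if (i <= g - 2)%N then 1
  else if (i <= 2 * g - 4)%N then 2 else 3.

Local Notation N := (2 * g - 2)%N.

Definition Sp (d : nat) (F : P) : Prop :=
  exists2 a : 'I_N -> k, forall i : 'I_N, basis_deg i != d -> a i = 0
    & JJ d (F - \sum_i (a i)%:MP * basis i).

Lemma SpD d F H : Sp d F -> Sp d H -> Sp d (F + H).
Proof.
move=> [a a0 FJ] [b b0 HJ]; exists (fun i => a i + b i).
  by move=> i di; rewrite a0 ?b0 ?addr0.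
have := JJD FJ HJ; congr (JJ _ _); rewrite addrACA -opprD -big_split.
by congr (_ - _); apply: eq_bigr => i _; rewrite /= mpolyCD mulrDl.
Qed.

Lemma SpC d s F : Sp d F -> Sp d (s%:MP * F).
Proof.
move=> [a a0 FJ]; exists (fun i => s * a i).
  by move=> i di; rewrite a0 ?mulr0.
have := JJ_C s FJ; congr (JJ _ _); rewrite mulrBr mulr_sumr.
by congr (_ - _); apply: eq_bigr => i _; rewrite mpolyCM mulrA.
Qed.

Lemma SpJ d F : JJ d F -> Sp d F.
Proof.
move=> FJ; exists (fun=> 0) => //; rewrite big1 ?subr0 // => i _.
by rewrite mpolyC0 mul0r.
Qed.

Lemma Sp_B (i : 'I_N) : Sp (basis_deg i) (basis i).
Proof.
exists (fun j => (j == i)%:R).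
  by move=> j; case: (eqVneq j i) => [->|//]; rewrite eqxx.
rewrite (bigD1 i) //= eqxx mul1r big1 ?addr0 ?subrr; first exact: JJ0.
by move=> j /negPf ->; rewrite mpolyC0 mul0r.
Qed.

Lemma Sp_cong d F H : JJ d (F - H) -> Sp d H -> Sp d F.
Proof. by move=> FH HS; rewrite -[F](subrK H); apply/SpD/HS/SpJ. Qed.

Lemma SpN d F : Sp d F -> Sp d (- F).
Proof. by move=> FS; rewrite -mulN1r -mpolyC1 -mpolyCN; apply: SpC. Qed.

Lemma Sp_nat d m F : Sp d F -> Sp d (m%:R * F).
Proof. by move=> FS; rewrite -(rmorph_nat (@mpolyC 3 k)); apply: SpC. Qed.

Lemma Sp_natB d m n F : Sp d F -> Sp d ((m%:R - n%:R) * F).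
Proof. by move=> FS; rewrite mulrBl; apply: SpD; [|apply: SpN]; apply: Sp_nat. Qed.

Lemma Sp_E i : (1 <= i <= g - 2)%N -> Sp 1 (Ez i).
Proof.
move=> /andP[i1 ig]; have iN : (i < N)%N by lia.
have := Sp_B (Ordinal iN); rewrite /basis /basis_deg /= ig.
by case: eqP => // i0; move: i1; rewrite i0.
Qed.

Lemma Sp_qh i : (1 <= i <= g - 2)%N -> Sp 2 (quadh i).
Proof.
move=> /andP[i1 ig]; have iN : (2 * g - 3 - i < N)%N by lia.
have := Sp_B (Ordinal iN); rewrite /basis /basis_deg /= subKn; last by lia.
case: eqP => i0; first by lia.
by case: leqP => i2; [lia | case: leqP => i3 //; lia].
Qed.

Lemma Sp_w : Sp 3 socle.
Proof.
have iN : (2 * g - 3 < N)%N by lia.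
have := Sp_B (Ordinal iN); rewrite /basis /basis_deg /=.
case: eqP => i0; first by lia.
by case: leqP => i2; [lia | case: leqP => i3 //; lia].
Qed.

Lemma Sp_q m : (2 <= m <= 2 * g - 2)%N -> Sp 2 (quad m).
Proof.
move=> /andP[m2 mg]; case: G_bounds => GB GB' GG.
have low i : (1 <= i <= g - 2)%N -> Sp 2 (quad (G + 1 - i)).
  by move=> ig; apply: Sp_cong (JJ_q_low ig) _; apply/Sp_nat/Sp_qh.
have high i : (1 <= i <= g - 2)%N -> Sp 2 (quad (2 * g - 1 - i)).
  by move=> ig; apply: Sp_cong (JJ_q_high ig) _; apply/Sp_natB/Sp_qh.
case: (leqP m G) => mG; last first.
  case: (ltnP g m) => gm.
    by have := high (2 * g - 1 - m)%N; rewrite subKn; [apply; lia | lia].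
  have [-> Gg] : (m = g /\ G.+1 = g)%N by lia.
  exact/SpJ/JJ_q_mid.
case: (leqP (G + 3 - g) m) => mG3.
  by have := low (G + 1 - m)%N; rewrite subKn; [apply; lia | lia].
have [-> Gg] : (m = 2 /\ G = g)%N by lia.
apply: Sp_cong (JJ_q_two Gg) _; apply: Sp_nat.
by have := low 1%N; rewrite addnK Gg; apply; lia.
Qed.

Lemma JJ_EG' d F : Rg d F -> JJ d.+1 (Ez G' * F + eps * (Ez 1 * F)).
Proof.
move=> FR; have := JJ_eps (JJ_z FR); congr (JJ _ _).
transitivity (eps * eps * (Ez G' * F) + eps * (Ez 1 * F));
  first by rewrite /zlast; ring.
by rewrite eps_sqr mul1r.
Qed.

Lemma Sp_eps d F : Sp d F -> Sp d (eps * F). Proof. exact: Sp_natB. Qed.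

(** Modulo the parameters E_0 and E_G vanish and E_G' is a multiple of E_1, which leaves the inner
    indices 1 to g-2. *)
Lemma Sp_mulE d F : Rg d F ->
  (forall j, (1 <= j <= g - 2)%N -> Sp d.+1 (Ez j * F)) ->
  forall j, (j <= g)%N -> Sp d.+1 (Ez j * F).
Proof.
case: G_bounds => GB GB' GG FR FS j jg.
have [->|j0] := eqVneq j 0%N; first exact/SpJ/JJ_x.
have [->|jG] := eqVneq j G; first exact/SpJ/JJ_y.
have [->|jG'] := eqVneq j G'; last by apply: FS; lia.
apply: (Sp_cong (H := - (eps * (Ez 1 * F)))); first by rewrite opprK; apply: JJ_EG'.
by apply/SpN/Sp_eps/FS; lia.
Qed.

Lemma Sp_EE i j : (1 <= i <= g - 2)%N -> (j <= g)%N -> Sp 2 (Ez j * Ez i).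
Proof.
move=> /andP[i1 ig]; case: G_bounds => GB GB' GG.
apply: Sp_mulE j => [|j /andP[j1 jg]]; first by apply: Rg_E; lia.
case: (leqP (j + i) g) => jig.
  by apply: Sp_cong (JJ_EE_low jig) _; apply/Sp_nat/Sp_q; lia.
apply: Sp_cong (JJ_EE_high _) _; first by lia.
by rewrite -mulrA; apply/Sp_natB/Sp_natB/Sp_q; lia.
Qed.

Lemma Rg_qh i : (1 <= i <= g - 2)%N -> Rg 2 (quadh i).
Proof.
move=> /andP[i1 ig]; case: G_bounds => GB GB' GG.
by apply: (RgM (RgC _)); apply: RgD; apply: Rg_q; lia.
Qed.

Lemma JJ_Eq0 m : (2 <= m <= 2 * g - 2)%N -> JJ 3 (Ez 0 * quad m).
Proof. by move=> /Rg_q /JJ_x. Qed.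

Lemma JJ_EqG m : (2 <= m <= 2 * g - 2)%N -> JJ 3 (Ez G * quad m).
Proof. by move=> /Rg_q /JJ_y. Qed.

(** E_0 q_m - E_G q_(m-G) is -G times the cubic, and both products lie in the ideal. *)
Lemma JJ_c_mid m : (G + 2 <= m <= 2 * g - 2)%N -> JJ 3 (cubic m).
Proof.
move=> /andP[mG mg]; case: G_bounds => GB GB' GG.
have a1 : JJ 3 (Ez 0 * quad m) by apply: JJ_Eq0; lia.
have a2 : JJ 3 (Ez G * quad (m - G)) by apply: JJ_EqG; lia.
have := JJ_C (G%:R^-1) (JJB a2 a1); rewrite E_q_sub; try by lia.
by rewrite subnKC; [rewrite {2}(G_invK (cubic m)); congr (JJ _ _); ring | lia].
Qed.

Lemma JJ_Eq_mid i m : (2 <= m)%N -> (G + 2 <= i + m <= 2 * g - 2)%N ->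
  JJ 3 (Ez i * quad m).
Proof.
move=> m2 imB; have a1 : JJ 3 (Ez 0 * quad (i + m)) by apply: JJ_Eq0; lia.
rewrite -[Ez i * quad m](subrK (Ez 0 * quad (i + m))) E_q_sub; try by lia.
by apply: JJD a1; rewrite subr0; apply/JJ_nat/JJ_c_mid.
Qed.

Lemma JJ_Eq_w i m : (2 <= m)%N -> (i + m = G + 1)%N ->
  JJ 3 (Ez i * quad m - i%:R * socle).
Proof.
move=> m2 imE; case: G_bounds => GB GB' GG.
have -> : Ez i * quad m - i%:R * socle = Ez 0 * quad (G + 1).
  rewrite -[Ez i * quad m](subrK (Ez 0 * quad (G + 1))) E_q_sub; try by lia.
  by rewrite imE /socle; ring.
by apply: JJ_Eq0; lia.
Qed.

Lemma Rg_w : Rg 3 socle.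
Proof.
case: G_bounds => GB GB' GG.
have <- : Ez 1 * quad G - Ez 0 * quad (G + 1) = socle.
  by rewrite E_q_sub; [rewrite subr0 mul1r addnC | lia..].
by apply: RgB; apply: (@RgM 1 2); first [apply: Rg_E; lia | apply: Rg_q; lia].
Qed.

(** Obtained from z q_G: the part E_1 q_G gives [socle], and E_G' q_G, compared with E_G q_G', gives
    the cubic of index G + G' = 2g-1. *)
Lemma JJ_c_w : JJ 3 (cubic (2 * g - 1) + socle).
Proof.
case: G_bounds => GB GB' GG.
have a1 : JJ 3 (zlast * quad G) by apply/JJ_z/Rg_q; lia.
have a2 : JJ 3 (Ez 1 * quad G - 1%:R * socle) by apply: JJ_Eq_w; lia.
have a3 : JJ 3 (Ez G * quad G') by apply: JJ_EqG; lia.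
have e : Ez G' * quad G = eps * cubic (2 * g - 1) + Ez G * quad G'.
  rewrite -[Ez G' * quad G](subrK (Ez G * quad G')) E_q_sub; try by lia.
  by rewrite (_ : G' + G = 2 * g - 1)%N //; lia.
have := JJB (JJB a1 a2) (JJ_eps a3); congr (JJ _ _).
rewrite /zlast mulrDl -mulrA e.
transitivity (eps * eps * cubic (2 * g - 1) + socle); first by ring.
by rewrite eps_sqr mul1r.
Qed.

Lemma JJ_Eq_top i m : (2 <= m)%N -> (i + m = 2 * g - 1)%N ->
  JJ 3 (Ez i * quad m - (G%:R - i%:R) * socle).
Proof.
move=> m2 imE; case: G_bounds => GB GB' GG.
have a3 : JJ 3 (Ez G * quad G') by apply: JJ_EqG; lia.
have a4 : JJ 3 ((i%:R - G%:R) * (cubic (2 * g - 1) + socle)).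
  by rewrite mulrBl; apply: JJB; apply/JJ_nat/JJ_c_w.
have := JJD a3 a4; congr (JJ _ _).
rewrite -[Ez i * quad m](subrK (Ez G * quad G')) E_q_sub; try by lia.
by rewrite imE; ring.
Qed.

(** The parameter z trades E_1 q_(m-1) for E_G' q_(m-1), whose index G' + m - 1 falls in the range
    where cubics already vanish. [JJ_c_high] makes the opposite trade. *)
Lemma JJ_c_low m : (3 <= m <= G)%N -> (G + 3 <= m + G')%N -> JJ 3 (cubic m).
Proof.
move=> /andP[m3 mG] mG'; case: G_bounds => GB GB' GG.
have a1 : JJ 3 (zlast * quad (m - 1)) by apply/JJ_z/Rg_q; lia.
have a2 : JJ 3 (Ez 0 * quad m) by apply: JJ_Eq0; lia.
have a3 : JJ 3 (Ez G' * quad (m - 1)) by apply: JJ_Eq_mid; lia.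
have := JJB (JJB a1 (JJ_eps a3)) a2; congr (JJ _ _).
have -> : zlast * quad (m - 1) - eps * (Ez G' * quad (m - 1)) = Ez 1 * quad (m - 1).
  by rewrite /zlast; ring.
by rewrite E_q_sub; [rewrite subr0 mul1r; congr cubic; lia | lia..].
Qed.

Lemma JJ_Eq_low i m : (2 <= m)%N -> (3 <= i + m <= G)%N -> (G + 3 <= i + m + G')%N ->
  JJ 3 (Ez i * quad m).
Proof.
move=> m2 imB imG; case: G_bounds => GB GB' GG.
have a1 : JJ 3 (Ez 0 * quad (i + m)) by apply: JJ_Eq0; lia.
rewrite -[Ez i * quad m](subrK (Ez 0 * quad (i + m))) E_q_sub; try by lia.
by apply: JJD a1; rewrite subr0; apply/JJ_nat/JJ_c_low.
Qed.

Lemma JJ_c_high m : (2 * g <= m <= 3 * g - 4)%N -> JJ 3 (cubic m).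
Proof.
move=> /andP[mg mg']; case: G_bounds => GB GB' GG.
have a1 : JJ 3 (zlast * quad (m - G')) by apply/JJ_z/Rg_q; lia.
have a2 : JJ 3 (Ez 1 * quad (m - G')) by apply: JJ_Eq_mid; lia.
have a3 : JJ 3 (Ez G * quad (m - G)) by apply: JJ_EqG; lia.
have e : Ez G' * quad (m - G') = eps * cubic m + Ez G * quad (m - G).
  rewrite -[Ez G' * quad _](subrK (Ez G * quad (m - G))) E_q_sub; try by lia.
  by rewrite subnKC //; lia.
have := JJB (JJB a1 a2) (JJ_eps a3); congr (JJ _ _).
rewrite /zlast mulrDl -mulrA e.
transitivity (eps * eps * cubic m); first by ring.
by rewrite eps_sqr mul1r.
Qed.

Lemma JJ_Eq_high i m : (2 <= m)%N -> (2 * g <= i + m <= 3 * g - 4)%N ->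
  JJ 3 (Ez i * quad m).
Proof.
move=> m2 imB; case: G_bounds => GB GB' GG.
have a1 : JJ 3 (Ez G * quad (i + m - G)) by apply: JJ_EqG; lia.
rewrite -[Ez i * quad m](subrK (Ez G * quad (i + m - G))) E_q_sub; try by lia.
by apply: JJD a1; rewrite mulrBl; apply: JJB; apply/JJ_nat/JJ_c_high.
Qed.

(** On the diagonal the two summands give i and G - i times [socle], and the factor 1/G of [quadh]
    normalizes the sum. Off the diagonal both index sums avoid G+1 and 2g-1, the only indices in
    play whose cubics survive. *)
Lemma JJ_E_qh i j : (1 <= i <= g - 2)%N -> (1 <= j <= g - 2)%N ->
  JJ 3 (Ez i * quadh j - (i == j)%:R * socle).
Proof.
move=> /andP[i1 ig] /andP[j1 jg]; case: G_bounds => GB GB' GG.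
have e : Ez i * quadh j =
   (G%:R^-1)%:MP * (Ez i * quad (G + 1 - j) + Ez i * quad (2 * g - 1 - j)).
  by rewrite /quadh mulrCA mulrDr.
have [ij|ij] := eqVneq i j.
  have a1 : JJ 3 (Ez i * quad (G + 1 - j) - i%:R * socle) by apply: JJ_Eq_w; lia.
  have a2 : JJ 3 (Ez i * quad (2 * g - 1 - j) - (G%:R - i%:R) * socle).
    by apply: JJ_Eq_top; lia.
  have := JJ_C (G%:R^-1) (JJD a1 a2); congr (JJ _ _).
  by rewrite e mul1r {3}(G_invK socle); ring.
rewrite mul0r subr0 e; apply/JJ_C/JJD.
  have [iG|iG] := leqP (i + (G + 1 - j)) G; first by apply: JJ_Eq_low; lia.
  by apply: JJ_Eq_mid; lia.
have [ig2|ig2] := leqP (i + (2 * g - 1 - j)) (2 * g - 2).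
  by apply: JJ_Eq_mid; lia.
by apply: JJ_Eq_high; lia.
Qed.

Lemma Sp_E_qh i j : (1 <= i <= g - 2)%N -> (j <= g)%N -> Sp 3 (Ez j * quadh i).
Proof.
move=> iB; move: j; apply: Sp_mulE; first exact: Rg_qh.
move=> j jB; apply: Sp_cong (JJ_E_qh jB iB) _.
exact/Sp_nat/Sp_w.
Qed.

(** For g = 3 there is one inner index, so the exchange used in [JJ_E_w] has no partner. Instead E_1
    w is congruent to q_2 q_G, and q_2 q_4 = q_3^2 is confronted with the linear relations among the
    quadrics. *)
Lemma JJ_E1_w_cubic : (g = 3)%N -> JJ 4 (Ez 1 * socle).
Proof.
move=> g3; case: G_bounds => GB GB' GG.
have q2 : Rg 2 (quad 2) by apply: Rg_q; rewrite g3.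
have q3 : Rg 2 (quad 3) by apply: Rg_q; rewrite g3.
have rel : JJ 2 ((G%:R - 1%:R) * quad (G + 1 - 1) - 1%:R * quad (2 * g - 1 - 1)).
  by apply: JJ_q_relation; rewrite g3.
rewrite addnK (_ : 2 * g - 1 - 1 = 4)%N in rel; last by lia.
have q24 : quad 2 * quad 4 = quad 3 * quad 3 by rewrite !q_q.
have E1w : JJ 4 (Ez 1 * (Ez 1 * quad G - 1%:R * socle)).
  by apply: (JJM (Rg_E _)); [lia | apply: JJ_Eq_w; lia].
have E11 : JJ 4 (quad G * (Ez 1 * Ez 1 - (1 * 1)%N%:R * quad (1 + 1))).
  by apply: (@JJM 2 2); [apply: Rg_q; lia | apply: JJ_EE_low; lia].
suff qq : JJ 4 (quad 2 * quad G).
  have := JJB (JJD E11 qq) E1w; congr (JJ _ _).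
  by rewrite add1n; ring.
have [G2|G3] : (G = 2 \/ G = 3)%N by lia.
  (* Here q_3 = 0 and q_4 = q_2 modulo the ideal, so q_2^2 = q_2 q_4 = q_3^2 = 0. *)
  have q3J : JJ 2 (quad 3) by rewrite -g3; apply: JJ_q_mid; rewrite G2 g3.
  have := JJD (@JJM 2 2 _ _ q2 rel) (@JJM 2 2 _ _ q3 q3J).
  by congr (JJ _ _); rewrite -q24 G2; ring.
(* Here q_2 = 2 q_3 and q_4 = 2 q_3, so q_3^2 = 4 q_3^2; as 3 = G is invertible, q_3^2 = 0. *)
have q2J : JJ 2 (quad 2 - 2%:R * quad 3).
  by have := JJ_q_two (etrans G3 (esym g3)); rewrite g3.
have q33 : JJ 4 (quad 3 * quad 3).
  have a1 := @JJM 2 2 _ _ q3 q2J.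
  have q4 : Rg 2 (quad 4) by apply: Rg_q; rewrite g3.
  have a2 := @JJM 2 2 _ _ q4 q2J.
  have a3 := @JJM 2 2 _ _ q3 rel.
  have := JJ_C (G%:R^-1) (JJN (JJD a2 (JJN (JJ_nat 2 a3)))).
  rewrite (G_invK (quad 3 * quad 3)) G3; congr (JJ _ _).
  have -> : quad 4 * (quad 2 - 2%:R * quad 3) = quad 3 * quad 3 - 2%:R * (quad 3 * quad 4).
    by rewrite -q24; ring.
  by ring.
have := JJD (@JJM 2 2 _ _ q3 q2J) (JJ_nat 2 q33).
by congr (JJ _ _); rewrite G3; ring.
Qed.

(** For an inner index l different from i, E_i w = E_i E_l qh_l = E_l (E_i qh_l) = 0 modulo the
    ideal. *)
Lemma JJ_E_w j : (j <= g)%N -> JJ 4 (Ez j * socle).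
Proof.
case: G_bounds => GB GB' GG.
have inner i : (1 <= i <= g - 2)%N -> JJ 4 (Ez i * socle).
  move=> iB; have [g3|g3] := eqVneq g 3.
    have -> : i = 1%N by lia.
    exact: JJ_E1_w_cubic.
  pose l := if i == 1%N then 2%N else 1%N.
  have [lB il] : (1 <= l <= g - 2)%N /\ (i == l) = false.
    by rewrite /l; case: eqP => [->|]; split; lia.
  have a1 : JJ 4 (Ez i * (Ez l * quadh l - (l == l)%:R * socle)).
    by apply: (@JJM 1 3); [apply: Rg_E; lia | apply: JJ_E_qh].
  have a2 : JJ 4 (Ez l * (Ez i * quadh l - (i == l)%:R * socle)).
    by apply: (@JJM 1 3); [apply: Rg_E; lia | apply: JJ_E_qh].
  have := JJB a2 a1; rewrite il eqxx mulr0n mulr1n; congr (JJ _ _); ring.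
move=> jg; have [->|j0] := eqVneq j 0%N; first exact/JJ_x/Rg_w.
have [->|jG] := eqVneq j G; first exact/JJ_y/Rg_w.
have [->|jG'] := eqVneq j G'; last by apply: inner; lia.
rewrite -[Ez G' * socle](addrK (eps * (Ez 1 * socle))).
by apply: JJB; [exact/JJ_EG'/Rg_w | apply/JJ_eps/inner; lia].
Qed.

Lemma Sp_E_B (j : nat) (i : 'I_N) : (j <= g)%N -> Sp (basis_deg i).+1 (Ez j * basis i).
Proof.
move=> jg; rewrite /basis /basis_deg; case: eqVneq => [_|i0]; last case: leqP => ig.
- rewrite mulr1 -[Ez j]mulr1; apply: Sp_mulE jg; first by rewrite -mpolyC1; apply: RgC.
  by move=> l lB; rewrite mulr1; apply: Sp_E.
- by apply: Sp_EE => //; rewrite lt0n i0.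
- case: leqP => ig2; last exact/SpJ/JJ_E_w.
  by apply: Sp_E_qh => //; move: (ltn_ord i); lia.
Qed.

Lemma JJ_E d j F : (j <= g)%N -> JJ d F -> JJ d.+1 (Ez j * F).
Proof. by move=> jg; apply: (@JJM 1 d); apply: Rg_E. Qed.

Lemma Sp_E_Sp d j F : (j <= g)%N -> Sp d F -> Sp d.+1 (Ez j * F).
Proof.
move=> jg [a a0 FJ]; rewrite -[F](subrK (\sum_i (a i)%:MP * basis i)) mulrDr.
apply: SpD; first exact/SpJ/JJ_E.
rewrite mulr_sumr; elim/big_rec: _ => [|i x _ xS]; first exact/SpJ/JJ0.
apply: SpD => //; rewrite mulrCA.
have [di|/a0 ->] := eqVneq (basis_deg i) d.
  by apply: SpC; rewrite -di; apply: Sp_E_B.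
by rewrite mpolyC0 mul0r; apply/SpJ/JJ0.
Qed.

Lemma Sp_homog d p : p \is d.-homog -> Sp d (Phi p).
Proof.
have mono m : Sp (mdeg m) (Phi 'X_[m]).
  have [e] := ubnP (mdeg m); elim: e m => // e IHe m; rewrite ltnS => me.
  case: (pickP (fun i => m i != 0%N)) => [i mi|m0]; last first.
    have -> : m = 0%MM.
      by apply/mnmP => i; rewrite mnm0E; apply/eqP; have /negbFE := m0 i.
    rewrite mdeg0 mpolyX0 rmorph1.
    have N0 : (0 < N)%N by lia.
    exact: (Sp_B (Ordinal N0)).
  have mE : m = (U_(i) + (m - U_(i)))%MM by rewrite addmC submK // lep1mP.
  rewrite mE mpolyXD rmorphM mdegD mdeg1 add1n.
  have -> : Phi 'X_i = Ez i.
    have ig : (i <= g)%N by rewrite -ltnS.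
    by rewrite -(Phi_z ig) /zvar inord_val.
  apply: Sp_E_Sp; first by rewrite -ltnS.
  by apply: IHe; move: me; rewrite {1}mE mdegD mdeg1 add1n.
move=> /dhomogP pd; rewrite (mpolyE p) rmorph_sum big_seq.
elim/big_rec: _ => [|m x mp xS]; first exact/SpJ/JJ0.
apply: SpD => //; rewrite -mul_mpolyC rmorphM Phi_C.
by apply: SpC; rewrite -(pd m mp); apply: mono.
Qed.

Definition tau : {rmorphism P -> S} :=
  comp_mpoly [tuple zvar 0; zvar G; zvar 1 + (G'%:R - G%:R) * zvar G'].

Lemma tau_X (i : 'I_3) : tau 'X_i =
  tnth [tuple zvar 0; zvar G; zvar 1 + (G'%:R - G%:R) * zvar G'] i.
Proof. by rewrite /= /comp_mpoly mmapX mmap1U. Qed.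

Lemma tau_C a : tau a%:MP = a%:MP. Proof. exact: comp_mpolyC. Qed.

Local Opaque tau.

Lemma Phi_tau0 : Phi (tau 'X_0) = Ez 0.
Proof. by rewrite tau_X Phi_z. Qed.

Lemma Phi_tau1 : Phi (tau 'X_1) = Ez G.
Proof. by case: G_bounds => GB GB' GG; rewrite tau_X Phi_z //; lia. Qed.

Lemma Phi_tau2 : Phi (tau 'X_2) = zlast.
Proof.
case: G_bounds => GB GB' GG; rewrite tau_X rmorphD rmorphM rmorphB !rmorph_nat.
by rewrite !Phi_z //; lia.
Qed.

(** Graded Nakayama, by induction on the degree. The vanishing clause says that a coefficient of
    negative degree is zero; it later makes the [socle] coordinate vanish in degrees below 3. *)
Lemma Rg_span d F : Rg d F -> exists2 a : 'I_N -> P,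
  forall i : 'I_N, (d < basis_deg i)%N ->
    a i = 0 & F = \sum_i Phi (tau (a i)) * basis i.
Proof.
elim: d F => [|d IHd] F [p pd <-]; have [a a0 FJ] := Sp_homog pd.
  exists (fun i => (a i)%:MP) => [i|].
    by case: eqVneq (a0 i) => [-> //|_ -> //]; rewrite mpolyC0.
  rewrite -[LHS](subrK (\sum_i (a i)%:MP * basis i)) FJ add0r.
  by apply: eq_bigr => i _; rewrite tau_C Phi_C.
case: FJ => b0 [b1 [b2 [/IHd [a0' a00 b0E] /IHd [a1 a10 b1E] /IHd [a2 a20 b2E] pE]]].
exists (fun i => 'X_0 * a0' i + 'X_1 * a1 i + 'X_2 * a2 i + (a i)%:MP) => [i di|].
  rewrite a00 ?a10 ?a20 ?a0 ?mpolyC0 ?mulr0 ?addr0 //; try by apply: ltnW.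
  by rewrite neq_ltn di orbT.
rewrite -[LHS](subrK (\sum_i (a i)%:MP * basis i)) pE b0E b1E b2E !mulr_sumr -!big_split.
apply: eq_bigr => i _ /=.
rewrite !(rmorphD tau) !(rmorphM tau) !(rmorphD Phi) !(rmorphM Phi).
rewrite Phi_tau0 Phi_tau1 Phi_tau2 tau_C Phi_C.
move: (Phi _) (Phi _) (Phi _) (basis i) (Ez 0) (Ez G) zlast => r0 r1 r2 r3 r4 r5 r6.
by ring.
Qed.

(** * Independence of the basis over T *)

Section PowersOfT.
Local Notation A := {poly P}.
(* With [f] and [h] as polynomials in t, E_G = u f + v f' and
   E_1 + (G' - G) E_G' = u h + v h'.  Since f' and h' generate the unit ideal, the
   substitution u := x, v := [V] inverts [tau] modulo [W], whose degree 2g-2 in t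
   exceeds that of the powers of t considered. *)
Let x : A := ('X_0)%:P.
Let y : A := ('X_1)%:P.
Let z' : A := ('X_2)%:P.
Let e : A := G'%:R - G%:R.
Let Gi : A := ((G%:R^-1)%:MP)%:P.
Let f : A := 'X^G.
Let f1 : A := G%:R * 'X^(G.-1).
Let h : A := 'X + e * 'X^G'.
Let h1 : A := 1 + e * G'%:R * 'X^(G'.-1).
Let al : A := Gi * G'%:R ^+ 2 * 'X^(2 * G' - 1 - G).
Let be : A := 1 - e * G'%:R * 'X^(G'.-1).
Let V : A := al * (y - x * f) + be * (z' - x * h).
(** The determinant that eliminates v from y = x f + v f' and z = x h + v h'. *)
Let W : A := f1 * (z' - x * h) - h1 * (y - x * f).

Let e_sqr : e * e = 1.
Proof.
case: G_bounds => GB GB' GG; rewrite /e.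
have [->|->] : (G' = G.+1 \/ G = G'.+1)%N by lia.
  by ring.
by ring.
Qed.

(** [be * h1] is 1 minus the square of G' t^(G'-1), and [al] is chosen so that [al * f1] is that
    square. The exponent 2G'-1-G is nonnegative because g >= 3. *)
Lemma bezout_derivatives : al * f1 + be * h1 = 1.
Proof.
case: G_bounds => GB GB' GG.
have -> : al * f1 = (Gi * G%:R) * G'%:R ^+ 2 * ('X^(G'.-1) * 'X^(G'.-1)).
  rewrite -exprD (_ : G'.-1 + G'.-1 = 2 * G' - 1 - G + G.-1)%N; last by lia.
  by rewrite exprD /al /f1; ring.
have -> : Gi * G%:R = 1.
  by rewrite /Gi -(rmorph_nat (@polyC P)) -rmorphM G_inv.
transitivity (1 + G'%:R ^+ 2 * ('X^(G'.-1) * 'X^(G'.-1)) * (1 - e * e) : A).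
  by rewrite /be /h1; ring.
by rewrite e_sqr subrr mulr0 addr0.
Qed.

Let Psi : {rmorphism P -> A} := mmap (polyC \o @mpolyC 3 k)
  (fun i : 'I_3 => tnth [tuple 'X; x; V] i).

Let Psi_t : Psi t = 'X.
Proof. by rewrite /= mmapX mmap1U (tnth_nth 0) inordK. Qed.
Let Psi_u : Psi u = x.
Proof. by rewrite /= mmapX mmap1U (tnth_nth 0) inordK. Qed.
Let Psi_v : Psi v = V.
Proof. by rewrite /= mmapX mmap1U (tnth_nth 0) inordK. Qed.

Let Psi_E j : Psi (Ez j) = x * 'X^j + j%:R * (V * 'X^(j.-1)).
Proof.
by rewrite /Ez rmorphD !rmorphM !rmorphXn rmorph_nat Psi_t Psi_u Psi_v.
Qed.

(** Sums and products preserve the property, so only variables matter; for y and z the Bezout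
    identity gives the quotients [- be] and [al]. *)
Lemma Psi_tau_mod (a : P) : exists Q, a%:P - Psi (Phi (tau a)) = W * Q.
Proof.
have [th thE] : exists th : {rmorphism P -> A}, forall p, th p = Psi (Phi (tau p)).
  exact: rmorphism_comp3.
rewrite -thE.
elim/mpoly_ring_ind: a => [a|i|a b [Q aE] [Q' bE]|a b [Q aE] [Q' bE]].
- exists 0; rewrite mulr0; apply/eqP; rewrite subr_eq0; apply/eqP.
  by rewrite thE tau_C Phi_C /= mmapC.
- have [->|->|->] : [\/ i = 0, i = 1 | i = 2].
    case: i => [[|[|[|//]]]] p.
    - by constructor 1; apply: val_inj.
    - by constructor 2; apply: val_inj.
    - by constructor 3; apply: val_inj.
  + exists 0; rewrite thE Phi_tau0 Psi_E -/x expr0 mulr1 mulr0 mul0r addr0.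
    exact: subrr.
  + exists (- be); rewrite thE Phi_tau1 Psi_E -/y.
    transitivity ((al * f1 + be * h1) * (y - x * f) - V * f1).
      by rewrite bezout_derivatives /f1 /f; ring.
    rewrite /V /W; move: al be f1 h1 x y z' f h => *; ring.
  + exists al; rewrite thE Phi_tau2 /zlast rmorphD rmorphM !Psi_E.
    rewrite rmorphB !rmorph_nat -/z' -/e.
    transitivity ((al * f1 + be * h1) * (z' - x * h) - V * h1).
      by rewrite bezout_derivatives /h1 /h /=; ring.
    rewrite /V /W; move: al be f1 h1 x y z' f h => *; ring.
- exists (Q + Q'); rewrite !rmorphD mulrDr -aE -bE /=; ring.
- exists (Q * b%:P + th a * Q'); rewrite !rmorphM mulrDr mulrA -aE.
  by rewrite [W * (_ * Q')]mulrCA -bE; ring.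
Qed.

(** The two products of top degree in t contribute e (G' - G) = e^2 = 1 times x. *)
Lemma W_coef : W`_(2 * g - 2) = 'X_0.
Proof.
case: G_bounds => GB GB' GG.
have -> : W = x * 'X^(2 * g - 2) + (G%:R * 'X_2)%:P * 'X^(G.-1)
    + ((1 - G%:R) * 'X_0)%:P * 'X^G - ('X_1)%:P
    - ((G'%:R - G%:R) * G'%:R * 'X_1)%:P * 'X^(G'.-1).
  have e1 : ('X^(2 * g - 2) : A) = 'X^(G.-1) * 'X^G'.
    by rewrite -exprD; congr ('X^_); lia.
  have e2 : ('X^(2 * g - 2) : A) = 'X^(G'.-1) * 'X^G.
    by rewrite -exprD; congr ('X^_); lia.
  have e3 : ('X^G : A) = 'X^(G.-1) * 'X by rewrite -exprSr prednK //; lia.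
  transitivity (f1 * z' - G%:R * x * ('X^(G.-1) * 'X) - G%:R * e * x * ('X^(G.-1) * 'X^G')
     - y + x * 'X^G - e * G'%:R * y * 'X^(G'.-1) + e * G'%:R * x * ('X^(G'.-1) * 'X^G)).
    by rewrite /W /f1 /h1 /h /f; ring.
  rewrite -e1 -e2 -e3 /f1 !rmorphM !rmorphB !rmorph_nat !rmorph1 -/x -/y -/z'.
  transitivity (e * e * x * 'X^(2 * g - 2) + G%:R * z' * 'X^(G.-1)
    + ((1 - G%:R) * x) * 'X^G - y - (e * G'%:R * y) * 'X^(G'.-1)).
    by rewrite /e; ring.
  by rewrite e_sqr mul1r.
rewrite !coefB !coefD !coefCM !coefXn coefC eqxx mulr1.
rewrite !(gtn_eqF (n := 2 * g - 2)) ?mulr0 ?addr0 ?subr0 //; lia.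
Qed.

(** A relation makes the polynomial with coefficients [a i] divisible by [W], whose degree is too
    large. *)
Lemma powers_of_t_free (a : 'I_N -> P) :
  \sum_i Phi (tau (a i)) * t ^+ i = 0 -> forall i, a i = 0.
Proof.
move=> a0; pose p : A := \sum_i (a i)%:P * 'X^i.
have [Q QP] := choice (fun i => Psi_tau_mod (a i)).
have pE : p = W * \sum_i Q i * 'X^i.
  rewrite mulr_sumr; under [RHS]eq_bigr do rewrite mulrA -QP mulrBl.
  rewrite sumrB [X in _ - X](_ : _ = 0) ?subr0 //.
  transitivity (Psi (\sum_i Phi (tau (a i)) * t ^+ i)); last by rewrite a0 rmorph0.
  by rewrite rmorph_sum; apply: eq_bigr => i _; rewrite rmorphM rmorphXn Psi_t.
have sp : (size p <= 2 * g - 2)%N.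
  apply: leq_trans (size_sum _ _ _) _; apply/bigmax_leqP => i _.
  by rewrite mul_polyC (leq_trans (size_scale_leq _ _)) // size_polyXn.
have sW : (2 * g - 2 < size W)%N.
  rewrite ltnNge; apply/negP => /leq_sizeP /(_ _ (leqnn _)).
  rewrite W_coef => /(congr1 (mcoeff (U_((0%R : 'I_3)))%MM)) /eqP.
  by rewrite mcoeffXU eqxx mcoeff0 oner_eq0.
have p0 : p = 0.
  apply/eqP; apply: contraTT (sp) => pn0; rewrite -ltnNge pE.
  have : W * \sum_i Q i * 'X^i != 0 by rewrite -pE.
  rewrite mulf_eq0 negb_or => /andP[W0 Q0].
  rewrite size_mul // -subn1.
  rewrite -size_poly_gt0 in Q0; move: sW Q0.
  by move: (size W) (size _) => m n; lia.
move=> i; have := congr1 (fun r : A => r`_i) p0; rewrite coef0 /p coef_sum.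
rewrite (bigD1 i) //= coefCM coefXn eqxx mulr1 big1 ?addr0 // => j ji.
rewrite coefCM coefXn; case: eqP => [ij|_]; last by rewrite mulr0.
by rewrite (val_inj ij) eqxx in ji.
Qed.

End PowersOfT.

(** E_0 q_(j+2) serves up to j = 2g-4. For j = 2g-3 the cubic terms cancel in 2 E_1 q_(2g-2) - E_2
    q_(2g-3). *)
Lemma Rg_uvt j : (j < N)%N -> Rg 3 (u * v ^+ 2 * t ^+ j).
Proof.
move=> jN; have [j2|j2] := ltnP j (2 * g - 3).
  have -> : u * v ^+ 2 * t ^+ j = Ez 0 * quad (j + 2).
    by rewrite E_q ?add0n ?addnK ?mul0r ?addr0 //; lia.
  by apply: (@RgM 1 2); [apply: Rg_E | apply: Rg_q; lia].
have -> : u * v ^+ 2 * t ^+ j = 2%:R * (Ez 1 * quad (2 * g - 2)) - Ez 2 * quad (2 * g - 3).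
  rewrite !E_q; try by lia.
  have -> : (1 + (2 * g - 2) - 2 = j)%N by lia.
  have -> : (2 + (2 * g - 3) - 2 = j)%N by lia.
  have -> : (2 + (2 * g - 3) = 1 + (2 * g - 2))%N by lia.
  by ring.
apply: RgB; first apply: (RgM (Rg_nat 2)).
  by apply: (@RgM 1 2); [apply: Rg_E; lia | apply: Rg_q; lia].
by apply: (@RgM 1 2); [apply: Rg_E; lia | apply: Rg_q; lia].
Qed.

(** The independent elements u v^2 t^j are combinations of equally many basis elements, so the
    transition matrix [m] has nonzero determinant; its adjugate turns a relation among basis
    elements into one among powers of t. *)
Lemma B_free (a : 'I_N -> P) :
  \sum_i Phi (tau (a i)) * basis i = 0 -> forall i, a i = 0.
Proof.
have [th thE] := rmorphism_comp2 Phi tau.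
move=> a0.
have /choice [M MP] (j : 'I_N) : exists b : 'I_N -> P,
    u * v ^+ 2 * t ^+ j = \sum_i th (b i) * basis i.
  have [b _ bE] := Rg_span (Rg_uvt (ltn_ord j)).
  by exists b; rewrite bE; apply: eq_bigr => i _; rewrite thE.
pose m : 'M[P]_N := \matrix_(j, i) M j i.
pose Bc : 'cV[P]_N := \col_i basis i.
pose Tc : 'cV[P]_N := \col_(i < N) (u * v ^+ 2 * t ^+ i).
have mB : map_mx th m *m Bc = Tc.
  apply/colP => j; rewrite !mxE MP; apply: eq_bigr => i _.
  by rewrite !mxE.
have uv0 : u * v ^+ 2 != 0.
  rewrite mulf_neq0 ?expf_neq0 //; apply/eqP => /(congr1 (fun p => p.@[fun=> 1])) /eqP;
    by rewrite mevalXU meval0 oner_eq0.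
have Tfree (d : 'rV[P]_N) : map_mx th d *m Tc = 0 -> d = 0.
  move=> /matrixP /(_ 0 0); rewrite !mxE => d0.
  apply/rowP => i; rewrite mxE; apply: (powers_of_t_free (a := d 0)).
  apply: (mulfI uv0); rewrite mulr0 -[RHS]d0 mulr_sumr; apply: eq_bigr => j _.
  by rewrite !mxE -thE; ring.
have det0 : \det m != 0.
  apply/negP => /det0P [d d0 dm]; case/negP: d0; apply/eqP/Tfree.
  by rewrite -mB mulmxA -map_mxM dm map_mx0 mul0mx.
pose ar : 'rV[P]_N := \row_i a i.
have arB : map_mx th ar *m Bc = 0.
  apply/matrixP => i j; rewrite !ord1 !mxE -[RHS]a0; apply: eq_bigr => l _.
  by rewrite !mxE thE.
have : ar *m \adj m = 0.
  apply: Tfree; rewrite -mB mulmxA -map_mxM -mulmxA mul_adj_mx.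
  by rewrite mul_mx_scalar map_mxZ -scalemxAl arB scaler0.
move/(congr1 (mulmx^~ m)); rewrite mul0mx -mulmxA mul_adj_mx mul_mx_scalar.
move=> ar0 i; have /rowP /(_ i) := ar0; rewrite !mxE => /eqP.
by rewrite mulf_eq0 (negPf det0) => /eqP.
Qed.

Local Notation R := (tangential_ring k g).
Local Notation pi := (tangential_proj k g).

Lemma proj_eq p p' : pi p = pi p' <-> Phi p = Phi p'.
Proof.
have BE := Quotient.idealrBE (tangential_ideal (k:=k) (g:=g)) p p'.
split=> [pp|pp].
  have : p - p' \in tangential_ideal (k:=k) (g:=g) by rewrite BE; apply/eqP.
  by rewrite unfold_in /tangential_ideal rmorphB subr_eq0 => /eqP.
apply/eqP; move: BE => /= <-.
by rewrite unfold_in /tangential_ideal rmorphB pp subrr.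
Qed.

Lemma proj_surj (r : R) : exists p, pi p = r.
Proof. by exists (repr r); apply: reprK. Qed.

Lemma dg_le3 i : (basis_deg i <= 3)%N.
Proof. by rewrite /basis_deg; case: ifP => // _; case: ifP => // _; case: ifP. Qed.

Lemma Rg_B (i : 'I_N) : Rg (basis_deg i) (basis i).
Proof.
rewrite /basis /basis_deg; case: eqVneq => [_|i0].
  by rewrite -mpolyC1; apply: RgC.
case: leqP => ig; first by apply: Rg_E; lia.
case: leqP => ig2; last exact: Rg_w.
by apply: Rg_qh; move: (ltn_ord i); lia.
Qed.

Lemma JJ_BB (i j : 'I_N) : (basis_deg i + basis_deg j = 3)%N ->
  JJ 3 (basis i * basis j - (i + j == 2 * g - 3)%N%:R * socle).
Proof.
have half (i' j' : 'I_N) : (basis_deg i' + basis_deg j' = 3)%N ->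
  (basis_deg i' <= 1)%N ->
    JJ 3 (basis i' * basis j' - (i' + j' == 2 * g - 3)%N%:R * socle).
  move: (ltn_ord i') (ltn_ord j') => iN jN.
  rewrite /basis /basis_deg; case: eqVneq => [->|i0].
    move=> dij _; move: dij.
    case: eqVneq => // j0; case: leqP => // j1; case: leqP => // j2 _.
    have -> : (0 + j' == 2 * g - 3)%N by lia.
    by rewrite !mul1r subrr; apply: JJ0.
  case: leqP => ig; last by case: leqP.
  move=> dij _; move: dij.
  case: eqVneq => // j0; case: leqP => // j1; case: leqP => // j2 _.
  have -> : (i' + j' == 2 * g - 3)%N = (i' == 2 * g - 3 - j' :> nat)%N by lia.
  by apply: JJ_E_qh; lia.
move=> dij; have [di|di] := leqP (basis_deg i) 1; first exact: half.
rewrite mulrC addnC; apply: half; first by rewrite addnC.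
by move: dij; lia.
Qed.

Lemma B_lifts : exists b : 'I_N -> S,
  forall i, b i \is (basis_deg i).-homog /\ Phi (b i) = basis i.
Proof.
have /choice [b bP] (i : 'I_N) : exists p : S, p \is (basis_deg i).-homog /\ Phi p = basis i.
  by have [p pd pE] := Rg_B i; exists p.
by exists b.
Qed.

(** * Coordinates over T and the perfect pairing *)

Section Coordinates.
Variable b : 'I_N -> S.
Hypothesis bP : forall i, b i \is (basis_deg i).-homog /\ Phi (b i) = basis i.

Let tauR : {rmorphism P -> R} := pi \o tau.
Let bR (i : 'I_N) : R := pi (b i).

Lemma proj_sum (a : 'I_N -> P) :
  \sum_i tauR (a i) * bR i = pi (\sum_i tau (a i) * b i).
Proof. by rewrite rmorph_sum; apply: eq_bigr => i _; rewrite rmorphM. Qed.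

Lemma Phi_sum (a : 'I_N -> P) :
  Phi (\sum_i tau (a i) * b i) = \sum_i Phi (tau (a i)) * basis i.
Proof.
by rewrite rmorph_sum; apply: eq_bigr => i _; rewrite rmorphM (bP i).2.
Qed.

Lemma R_span_homog d p : p \is d.-homog -> exists2 a : 'I_N -> P,
  forall i : 'I_N, (d < basis_deg i)%N -> a i = 0 & pi p = \sum_i tauR (a i) * bR i.
Proof.
move=> pd; have [|a a0 aE] := @Rg_span d (Phi p); first by exists p.
by exists a => //; rewrite proj_sum; apply/proj_eq; rewrite Phi_sum.
Qed.

Lemma R_span (r : R) : exists a : 'I_N -> P, r = \sum_i tauR (a i) * bR i.
Proof.
have [p <-] := proj_surj r.
rewrite (mpoly_homog_decomp p) rmorph_sum; elim/big_rec: _ => [|d x _ [a ->]].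
  by exists (fun=> 0); rewrite big1 // => i _; rewrite rmorph0 mul0r.
have [a' _ ->] := R_span_homog (hprojP (d : nat) p).
exists (fun i => a' i + a i); rewrite -big_split; apply: eq_bigr => i _.
by rewrite rmorphD mulrDl.
Qed.

Lemma R_free (a : 'I_N -> P) :
  \sum_i tauR (a i) * bR i = 0 -> forall i, a i = 0.
Proof.
move=> a0; apply: B_free; rewrite -Phi_sum -(rmorph0 Phi); apply/proj_eq.
by rewrite -proj_sum a0 rmorph0.
Qed.

Variable co : R -> 'I_N -> P.
Hypothesis coP : forall r, r = \sum_i tauR (co r i) * bR i.
Hypothesis co_lin : forall i, tau_linear tauR (co^~ i).
Hypothesis coK : forall a i, co (\sum_i tauR (a i) * bR i) i = a i.

Lemma co0 i : co 0 i = 0.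
Proof. by have := co_lin i (-1) 0 0; rewrite mulr0 addr0 mulN1r addNr. Qed.

Lemma coD r s i : co (r + s) i = co r i + co s i.
Proof. by have := co_lin i 1 r s; rewrite rmorph1 !mul1r. Qed.

Lemma coZ a r i : co (tauR a * r) i = a * co r i.
Proof. by have := co_lin i a r 0; rewrite !addr0 co0 addr0. Qed.

Lemma co_low d p (i : 'I_N) : p \is d.-homog -> (d < basis_deg i)%N -> co (pi p) i = 0.
Proof. by move=> /R_span_homog [a a0 ->] di; rewrite coK a0. Qed.

Lemma co_b (i j : 'I_N) : co (bR j) i = (i == j)%:R.
Proof.
rewrite -(coK (fun i => (i == j)%:R) i); congr co.
rewrite (bigD1 j) // (eqxx j) rmorph1 mul1r big1 => [|l /negPf ->]; last first.
  by rewrite rmorph0 mul0r.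
exact/esym/addr0.
Qed.

Fact top_subproof : (2 * g - 3 < N)%N. Proof. by lia. Qed.
Definition top : 'I_N := Ordinal top_subproof.

Lemma dg_top : basis_deg top = 3.
Proof.
rewrite /basis_deg /=; case: eqP => [|_]; first by lia.
by case: leqP => [|_]; [lia | case: leqP => //; lia].
Qed.

Lemma B_top : basis top = socle.
Proof.
rewrite /basis /=; case: eqP => [|_]; first by lia.
by case: leqP => [|_]; [lia | case: leqP => //; lia].
Qed.

(** The cofactors of x, y, z have degree 2, below that of [top], so their top coordinates vanish and
    only the [socle] term is seen. *)
Lemma co_JJ p a : JJ 3 (Phi p - a%:MP * socle) -> co (pi p) top = a%:MP.
Proof.
move=> [_ [_ [_ [[p0 p0d <-] [p1 p1d <-] [p2 p2d <-] pE]]]].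
have -> : pi p = tauR 'X_0 * pi p0 + (tauR 'X_1 * pi p1 +
    (tauR 'X_2 * pi p2 + tauR a%:MP * bR top)).
  rewrite /tauR /bR /= -!rmorphM -!rmorphD; apply/proj_eq.
  rewrite -[LHS](subrK (a%:MP * socle)) pE !rmorphD !rmorphM.
  rewrite Phi_tau0 Phi_tau1 Phi_tau2 (bP top).2 B_top.
  have -> : Phi (tau a%:MP) = a%:MP by rewrite tau_C Phi_C.
  move: (Ez 0 * _) (Ez G * _) (zlast * _) (_ * socle) => e0 e1 e2 e3; by rewrite !addrA.
have low e : e \is 2.-homog -> co (pi e) top = 0.
  by move=> e2; apply: (co_low e2); rewrite dg_top.
by rewrite !coD !coZ (low p0) ?(low p1) ?(low p2) // !mulr0 !add0r co_b eqxx mulr1.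
Qed.

Let lam (r : R) : P := co r top.

Lemma lam_low (i j : 'I_N) : (basis_deg i + basis_deg j < 3)%N -> lam (bR i * bR j) = 0.
Proof.
move=> dij; rewrite /lam /bR -rmorphM.
by apply: (co_low (dhomogM (bP i).1 (bP j).1)); rewrite dg_top.
Qed.

Lemma lam_pairing (i j : 'I_N) : (basis_deg i + basis_deg j = 3)%N ->
  lam (bR i * bR j) = (i + j == 2 * g - 3)%N%:R.
Proof.
move=> dij; rewrite /lam /bR -rmorphM.
rewrite (co_JJ (a := (i + j == 2 * g - 3)%N%:R)) ?rmorph_nat //.
rewrite rmorphM (bP i).2 (bP j).2.
exact: JJ_BB.
Qed.

Lemma dg_rev (i : 'I_N) : (basis_deg (rev_ord i) + basis_deg i = 3)%N.
Proof.
have dg1 j : (1 <= j <= g - 2)%N -> basis_deg j = 1.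
  by move=> /andP[j1 jg]; rewrite /basis_deg jg; case: eqP => // j0; rewrite j0 in j1.
have dg2 j : (g - 1 <= j <= 2 * g - 4)%N -> basis_deg j = 2.
  move=> /andP[j1 jg]; rewrite /basis_deg jg; case: eqP => [j0|_]; first by lia.
  by case: leqP => // j2; lia.
have dg3 j : (2 * g - 3 <= j)%N -> basis_deg j = 3.
  move=> j1; rewrite /basis_deg; case: eqP => [j0|_]; first by lia.
  by case: leqP => [j2|_]; [lia | case: leqP => // j2; lia].
move: (ltn_ord i); rewrite /=; move: (i : nat) => j jN.
have [j0|j0] := posnP j; first by rewrite (dg3 (2 * g - 2 - j.+1)%N) ?j0 //; lia.
have [jg|jg] := leqP j (g - 2).
  by rewrite (dg2 (2 * g - 2 - j.+1)%N) ?(dg1 j) //; lia.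
have [jg2|jg2] := leqP j (2 * g - 4).
  by rewrite (dg1 (2 * g - 2 - j.+1)%N) ?(dg2 j) //; lia.
have -> : (2 * g - 2 - j.+1 = 0)%N by lia.
by rewrite (dg3 j) //; lia.
Qed.

(** The pairing is triangular for the degree: agreement in degrees below [s] is extended to [s] by
    adding multiples of dual elements, of degree 3 - s, which pair to zero with basis elements of
    degree below [s]. *)
Lemma lam_dual (f : R -> P) : tau_linear tauR f ->
  exists r, forall a, f a = lam (r * a).
Proof.
move=> f_lin.
have lin0 (h : R -> P) : tau_linear tauR h -> h 0 = 0.
  by move=> h_lin; have := h_lin (-1) 0 0; rewrite mulr0 addr0 mulN1r addNr.
have linS (h : R -> P) : tau_linear tauR h -> forall a : 'I_N -> P,
    h (\sum_i tauR (a i) * bR i) = \sum_i a i * h (bR i).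
  move=> h_lin a; elim/big_rec2: _ => [|i y1 y2 _ <-]; [exact: lin0 | exact: h_lin].
have lam_lin r : tau_linear tauR (fun a => lam (r * a)).
  move=> a s s'; rewrite /lam -coZ -coD; congr co; ring.
suff [r rP] : exists r, forall j : 'I_N, (basis_deg j < 4)%N ->
  f (bR j) = lam (r * bR j).
  exists r => a; rewrite (coP a) linS // (linS (fun a => lam (r * a))) //.
  by apply: eq_bigr => i _; rewrite rP // ltnS dg_le3.
elim: 4%N => [|s [r rP]]; first by exists 0.
pose x j := f (bR j) - lam (r * bR j).
exists (r + \sum_(j : 'I_N | basis_deg j == s) tauR (x j) * bR (rev_ord j)) => i.
have lamD r1 r2 : lam (r1 + r2) = lam r1 + lam r2 by apply: coD.
have lamZ a r1 : lam (tauR a * r1) = a * lam r1 by apply: coZ.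
have lam_sum (I : finType) (Q : pred I) (F : I -> R) :
    lam (\sum_(j | Q j) F j) = \sum_(j | Q j) lam (F j).
  by elim/big_rec2: _ => [|j y1 y2 _ <-]; [apply: co0 | apply: coD].
rewrite ltnS leq_eqVlt mulrDl lamD mulr_suml lam_sum => /orP [/eqP di|di].
  rewrite (bigD1 i) ?di ?eqxx //= big1 => [|j /andP[/eqP dj ji]].
    rewrite addr0 -mulrA lamZ lam_pairing ?dg_rev //=.
    have -> : (2 * g - 2 - i.+1 + i == 2 * g - 3)%N by move: (ltn_ord i); lia.
    by rewrite mulr1 /x addrC subrK.
  rewrite -mulrA lamZ lam_pairing /=; last by rewrite di -dj dg_rev.
  case: eqP => [E1|]; last by rewrite mulr0.
  case/eqP: ji; apply: val_inj; move: (ltn_ord i) (ltn_ord j) E1 => /=; lia.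
rewrite rP // -[LHS]addr0; congr (_ + _).
rewrite big1 // => j /eqP dj; rewrite -mulrA lamZ lam_low ?mulr0 //.
by have := dg_rev j; move: di; rewrite dj; lia.
Qed.

(** * The parameters as a coordinate sequence, and the end of the regularity argument *)

(** The parameters x, y, z occupy the first three places, index 1 standing for z, which is the
    sheared coordinate; the others complete them to all coordinates of the ambient space. *)
Definition killing_order : seq nat := [:: 0%N; G; 1%N; G'] ++ iota 2 (g - 3).

Lemma size_killing_order : size killing_order = g.+1.
Proof. by rewrite /killing_order size_cat size_iota /=; lia. Qed.

Lemma uniq_killing_order : uniq killing_order.
Proof.
case: G_bounds => GB GB' GG.
rewrite /killing_order /= !inE !mem_iota iota_uniq andbT.
by rewrite !negb_or; lia.
Qed.

Lemma mem_killing_order (i : 'I_g.+1) : (i : nat) \in killing_order.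
Proof.
case: G_bounds => GB GB' GG; move: (ltn_ord i) => ig.
by rewrite /killing_order /= !inE mem_iota; lia.
Qed.

Definition pos (i : 'I_g.+1) : nat := index (i : nat) killing_order.

Lemma pos_inj : injective pos.
Proof.
move=> i j ij; apply: val_inj.
by rewrite /= -(nth_index 0%N (mem_killing_order i)) -/(pos i) ij nth_index //;
  apply: mem_killing_order.
Qed.

Definition var (m : nat) : 'I_g.+1 := inord (nth 0%N killing_order m).

Lemma killing_order_le m : (nth 0 killing_order m <= g)%N.
Proof.
case: G_bounds => GB GB' GG; case: (ltnP m (size killing_order)) => mo; last first.
  by rewrite nth_default.
have := mem_nth 0%N mo; move: (nth _ _ _) => i.
by rewrite /killing_order /= !inE mem_iota; lia.
Qed.

Lemma pos_var m : (m < g.+1)%N -> pos (var m) = m.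
Proof.
move=> mg; rewrite /pos /var inordK ?ltnS ?killing_order_le //.
by rewrite index_uniq ?uniq_killing_order ?size_killing_order.
Qed.

Lemma pos_lt i : (pos i < g.+1)%N.
Proof. by rewrite -size_killing_order index_mem mem_killing_order. Qed.

Lemma reduction_sequence_exists :
  exists l rho, is_coordinate_sequence l rho /\ forall m : 'I_3, l m = tau 'X_m.
Proof.
case: G_bounds => GB GB' GG.
have G'1 : inord G' != inord 1 :> 'I_g.+1.
  by rewrite -(inj_eq val_inj) /= !inordK; lia.
have [l [rho [lP lE]]] :=
  sheared_coordinate_sequence G'1 (G'%:R - G%:R : k) pos_inj pos_lt pos_var.
exists l, rho; split=> // m; rewrite lE tau_X rmorphB !rmorph_nat /var /zvar.
case: m => [[|[|[|//]]]] p; rewrite (tnth_nth 0) /= -(inj_eq val_inj) /= !inordK;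
  try lia.
- by rewrite addr0.
- by case: eqP => [G1|_]; [lia | rewrite addr0].
- by [].
Qed.

(** [sg] multiplies u and v by a new variable, hence the image of a form of degree e by its e-th
    power; the components then separate as coefficients. *)
Lemma Phi_graded p d : Phi p = 0 -> Phi (hproj d p) = 0.
Proof.
pose sg : {rmorphism P -> {poly P}} := mmap (polyC \o @mpolyC 3 k)
  (fun i : 'I_3 => tnth [tuple t%:P; u%:P * 'X; v%:P * 'X] i).
have sg_X i : sg 'X_i = [:: t%:P; u%:P * 'X; v%:P * 'X]`_i.
  by rewrite /= mmapX mmap1U (tnth_nth 0).
have [sg_t sg_u sg_v] : [/\ sg t = t%:P, sg u = u%:P * 'X & sg v = v%:P * 'X].
  by split; rewrite sg_X inordK.
have sg_E j : sg (Ez j) = (Ez j)%:P * 'X.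
  rewrite /Ez !(rmorphD, rmorphM, rmorphXn, rmorph_nat) sg_t sg_u sg_v /=.
  by ring.
have sg_mono m : sg (Phi 'X_[m]) = (Phi 'X_[m])%:P * 'X^(mdeg m).
  rewrite mpolyXE_id !rmorph_prod mdegE.
  elim/big_rec3: _ => [|i x y e _ ->]; first by rewrite mul1r.
  have -> : Phi ('X_i ^+ m i) = Ez i ^+ m i.
    have ig : (i <= g)%N by rewrite -ltnS.
    by rewrite rmorphXn -(Phi_z ig) /zvar inord_val.
  rewrite [sg _]rmorphXn sg_E exprMn exprD mulrACA; congr (_ * _ * _).
  exact/esym/rmorphXn.
have sg_homog e r : r \is e.-homog -> sg (Phi r) = (Phi r)%:P * 'X^e.
  move=> /dhomogP re.
  have -> : Phi r = \sum_(m <- msupp r) (r@_m)%:MP * Phi 'X_[m].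
    rewrite {1}(mpolyE r) (rmorph_sum Phi); apply: eq_bigr => m _.
    by rewrite -mul_mpolyC (rmorphM Phi) Phi_C.
  rewrite (rmorph_sum sg) (rmorph_sum (@polyC P)) mulr_suml big_seq [RHS]big_seq.
  apply: eq_bigr => m mr; rewrite (rmorphM sg) (rmorphM (@polyC P)) sg_mono mulrA.
  by rewrite [sg _%:MP]mmapC; congr (_ * _ * 'X^_); apply: re.
move=> p0; case: d => [d|d]; last exact: rmorph0.
have: \sum_(i < msize p) (Phi (hproj (i : nat) p))%:P * 'X^i = 0.
  transitivity (sg (Phi p)); last by rewrite p0 rmorph0.
  rewrite [in RHS](mpoly_homog_decomp p) (rmorph_sum Phi) (rmorph_sum sg).
  by apply: eq_bigr => i _; rewrite (sg_homog i _ (hprojP (i : nat) p)).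
move/(congr1 (fun r : {poly P} => r`_d)); rewrite coef0 coef_sum.
case: (ltnP d (msize p)) => dp.
  rewrite (bigD1 (Ordinal dp)) //= coefCM coefXn eqxx mulr1 big1 ?addr0 //.
  by move=> i /negPf id;
    rewrite coefCM coefXn eq_sym -[d]/(val (Ordinal dp)) (inj_eq val_inj) id mulr0.
move=> _; rewrite /= pihomogE big1_seq ?rmorph0 // => mm /andP[/eqP mmE] /msize_mdeg_lt.
by rewrite mmE ltnNge dp.
Qed.

Lemma proj_graded p d : pi p = 0 -> pi (hproj d p) = 0.
Proof.
rewrite -(rmorph0 pi) => /proj_eq; rewrite (rmorph0 Phi) => p0.
by apply/proj_eq; rewrite (rmorph0 Phi) Phi_graded.
Qed.

Section Reduction.
Variables (l : nat -> S) (rho : nat -> {rmorphism S -> S}).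
Hypothesis rhoP : is_coordinate_sequence l rho.
Hypothesis l_tau : forall m : 'I_3, l m = tau 'X_m.
Variable kill : nat -> {rmorphism P -> P}.
Hypothesis killP : kills_variables (fun i : 'I_3 => i : nat) kill.

Local Notation J := (fun m (r : R) => exists2 p, pi p = r & rho m p = 0).

(** As [R] is free over T, the ideal generated by the first [m] parameters is tested on coordinates;
    regularity of x, y, z on [R] becomes that of the variables of T. *)
Lemma J_coordinates m r : (m <= 3)%N ->
  J m r <-> forall i, kill m (co r i) = 0.
Proof.
case: rhoP => -[_ _ rho_0 rho_S] [rho_l rho_div _ _].
have [kill_X _ _] := killP.
move=> m3; split.
  case=> p <- p0 i; elim: m m3 p p0 => [|m IHm] m3 p p0.
    by rewrite (kill_0 killP) (rho_0 _ p0) rmorph0 co0.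
  have mg : (m < g.+1)%N by lia.
  have [e eE] := rho_div m p mg p0.
  have pE : pi p = tauR 'X_(Ordinal m3) * pi e + pi (p - l m * e).
    by rewrite (rmorphB pi) (rmorphM pi) (l_tau (Ordinal m3)) addrC subrK.
  rewrite pE coD coZ (rmorphD (kill m.+1)) (rmorphM (kill m.+1)) kill_X ltnSn.
  rewrite mul0r add0r.
  by rewrite -(kill_kill killP _ (leqnSn m)) IHm ?rmorph0 // ltnW.
rewrite {2}(coP r); move: (co r) => a; elim: m m3 a => [|m IHm] m3 a a0.
  exists 0; last exact: (rmorph0 (rho 0%N)); rewrite (rmorph0 pi) big1 // => i _.
  by rewrite -(kill_0 killP (a i)) a0 rmorph0 mul0r.
have /choice [e eE] : forall i, exists e, kill m (a i - 'X_(Ordinal m3) * e) = 0.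
  by move=> i; apply: (kill_div killP) (a0 i) => //; apply: val_inj.
have [p pE p0] := IHm (ltnW m3) _ eE.
have mg : (m < g.+1)%N by lia.
exists (p + l m * \sum_i tau (e i) * b i); last first.
  by rewrite (rmorphD (rho _)) (rmorphM (rho _)) (rho_l m mg) mul0r addr0; apply: rho_S.
rewrite (rmorphD pi) pE (rmorphM pi) (l_tau (Ordinal m3)) -proj_sum mulr_sumr.
rewrite -big_split.
apply: eq_bigr => i _ /=; rewrite -[pi (tau _)]/(tauR _).
by rewrite (rmorphB tauR) (rmorphM tauR) mulrBl -mulrA subrK.
Qed.

Lemma J_regular m r : (m < 3)%N -> J m (pi (l m) * r) -> J m r.
Proof.
move=> m3 /(J_coordinates _ (ltnW m3)) H; apply/(J_coordinates _ (ltnW m3)) => i.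
apply: (kill_regular killP (i := Ordinal m3)) => //.
by have := H i; rewrite (l_tau (Ordinal m3)) coZ.
Qed.

(** No basis element has degree above 3, so spanning modulo the parameters means lying in their
    ideal. *)
Lemma J_degree d p : (4 <= d)%N -> p \is d.-homog -> J 3 (pi p).
Proof.
case: rhoP => -[_ _ _ rho_S] [rho_l _ _ _].
case: d => // d d3 pd; have [a a0] := Sp_homog pd.
rewrite big1 => [|i _]; last first.
  by rewrite a0 ?mpolyC0 ?mul0r //; have := dg_le3 i; lia.
rewrite subr0 => -[_ [_ [_ [[p0 _ <-] [p1 _ <-] [p2 _ <-] pE]]]].
have [l0 [l1 l2]] := (l_tau 0, (l_tau 1, l_tau 2)).
exists (l 0 * p0 + l 1 * p1 + l 2 * p2).
  apply/proj_eq; rewrite pE !rmorphD !rmorphM l0 l1 l2.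
  by rewrite Phi_tau0 Phi_tau1 Phi_tau2.
have r0 : rho 3 (l 0) = 0 by apply/rho_S/rho_S/rho_l.
have r1 : rho 3 (l 1) = 0 by apply/rho_S/rho_l; lia.
have r2 : rho 3 (l 2) = 0 by apply: rho_l; lia.
by rewrite !(rmorphD (rho 3)) !(rmorphM (rho 3)) r0 r1 r2 !mul0r !addr0.
Qed.

Lemma socle_notin_J : ~ J 3 (pi (b top)).
Proof.
move=> /(J_coordinates _ (leqnn 3)) /(_ top) /eqP.
by rewrite co_b eqxx rmorph1 oner_eq0.
Qed.

End Reduction.

Lemma tangential_gorenstein_regularity : gorenstein R /\ is_regularity pi 3.
Proof.
split.
  apply: (gorenstein_of_duality (tau := tauR) (b := bR) (lam := lam)).
  - exact: R_span.
  - exact: R_free.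
  - exact: co_lin.
  - exact: lam_dual.
  - apply: (@noetherian_surjective _ _ pi proj_surj).
    exact: (@noetherian_mpoly _ _ (@field_noetherian k)).
have [kill killP] := killing_maps_exist k (fun i : 'I_3 => i : nat).
have [l [rho [rhoP l_tau]]] := reduction_sequence_exists.
have [[? ? ? ?] [? ? ? ?]] := rhoP.
apply: (@regularity_of_reduction k g.+1 R pi l rho _ _ _ _ _ _ _ _ _ _ _ _ (b top)) => //.
- exact: (@J_regular _ _ rhoP l_tau _ killP).
- exact: ltnW.
- exact: (@J_degree _ _ rhoP l_tau).
- exact: proj_graded.
- exact: graded_free_resolution_exists proj_surj proj_graded.
- by have [] := bP top; rewrite dg_top.
- exact: (@socle_notin_J _ _ rhoP l_tau _ killP).
Qed.

End Coordinates.

Lemma tangential_ring_gorenstein : gorenstein R /\ is_regularity pi 3.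
Proof.
have [b bP] := B_lifts.
have [co [coP co_lin coK]] := tau_coordinates (R_span bP) (R_free bP).
exact: (@tangential_gorenstein_regularity b bP co coP co_lin coK).
Qed.

End TangentialVariety.

Theorem theorem5p1 (k : fieldType) (g : nat)
  (char_k : 2%N \notin [pchar k]%R) (g_ge3 : (3 <= g)%N) :
  gorenstein (tangential_ring k g) /\ is_regularity (tangential_proj k g) 3%R.
Proof.
(* If g is zero in [k], then g - 1 is -1 there, so one of the two can serve as [G]. *)
have [g0|g_neq0] := eqVneq (g%:R : k) 0; last first.
  by apply: (@tangential_ring_gorenstein k g g_ge3 char_k g g.-1) => //; split; lia.
apply: (@tangential_ring_gorenstein k g g_ge3 char_k g.-1 g); first by split; lia.
rewrite -subn1 natrB ?g0 ?sub0r ?oppr_eq0 ?oner_eq0 //; lia.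
Qed.
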